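(* Let $\sigma\colon(\mathcal M,L)\to(\mathcal B,\tilde L)$ be a pseudo-Finsler submersion such that for every $v\in\mathcal A$ the vertical space at $\pi(v)$ is $g_v$-non-degenerate. For $v$ horizontal at $p$, $x$ $g_v$-horizontal and $w$ vertical at $p$, with $\tilde v=d\sigma(v)$, $\tilde x=d\sigma(x)$, assuming that the planes spanned by $\{v,w\}$ and $\{v,x\}$ are $g_v$-non-degenerate, \begin{align*} K_v(w)&=\frac{g_v((\nabla_v\mathbf T)^v_ww,v)+g_v(\mathbf A^v_vw,\mathbf A^v_vw)-g_v(\mathbf T^v_wv,\mathbf T^v_wv)}{L(v)g_v(w,w)-g_v(v,w)^2},\\ K_v(x)&=\tilde K_{\tilde v}(\tilde x)-\frac{3g_v(\mathbf A^v_xv,\mathbf A^v_xv)}{L(v)g_v(x,x)-g_v(v,x)^2}, \end{align*} where $K$ and $\tilde K$ are the flag curvatures of $(\mathcal M,L)$ and $(\mathcal B,\tilde L)$.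
   Context: **Metrics.** A pseudo-Finsler metric on $\mathcal M$ (with projection $\pi\colon T\mathcal M\to\mathcal M$) is a smooth $L\colon\mathcal A\to\mathbb R$, $\mathcal A\subset T\mathcal M\setminus\mathbf 0$ open and invariant under positive scalar multiplication, with $L(\lambda v)=\lambda^2L(v)$ for $\lambda>0$ and with non-degenerate fundamental tensor $g_v(e,h)=\frac12\frac{\partial^2}{\partial s\partial t}L(v+se+th)|_{s=t=0}$. Elements of $\mathcal A$ are admissible. **Anisotropic calculus.** An anisotropic tensor $T$ assigns smoothly to $v\in\mathcal A$ a tensor $T_v$ (or $T^v$) on $T_{\pi(v)}\mathcal M$; an anisotropic vector field $\mathcal X$ assigns $\mathcal X_v\in T_{\pi(v)}\mathcal M$. $T_V$ is the ordinary tensor $(T_V)_q=T_{V_q}$ for an admissible local vector field $V$. Fiber derivative: $(\dot\partial T)_v(e)=\frac{d}{dt}T_{v+te}|_{t=0}$. An anisotropic connection assigns to vector fields $E,H$ an anisotropic vector field $\nabla_EH$, $v\mapsto\nabla^v_EH$, $C^\infty$-linear in $E$, additive and satisfying the Leibniz rule in $H$. For anisotropic vector fields $\nabla^v_e\mathcal X=\nabla^v_e(\mathcal X_V)-(\dot\partial\mathcal X)_v(\nabla^v_eV)$, and for functions $f$ on $\mathcal A$, $(\nabla_ef)(v)=e(f(V))-(\dot\partial f)_v(\nabla^v_eV)$, for any admissible local extension $V$ of $v$ (independent of the choice); covariant derivatives of other anisotropic tensors are defined by the product rule. The Levi-Civita–Chern connection $\nabla$ of $(\mathcal M,L)$ is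 the unique anisotropic connection with $\nabla^v_EH-\nabla^v_HE=[E,H]_{\pi(v)}$ and $\nabla g=0$. Its curvature is $R_v(E,H)B=\nabla^v_E\nabla_HB-\nabla^v_H\nabla_EB-\nabla^v_{[E,H]}B$, and its flag curvature is $K_v(e)=\dfrac{g_v(R_v(v,e)e,v)}{L(v)g_v(e,e)-g_v(v,e)^2}$ when the denominator is non-zero. **Submersions.** Let $\sigma\colon\mathcal M\to\mathcal B$ be a surjective map with surjective differential, $\mathcal V_p=\ker d\sigma_p$ (vertical vectors). An admissible $v\in T_p\mathcal M$ is horizontal if $g_v(v,w)=0$ for all $w\in\mathcal V_p$. $\sigma\colon(\mathcal M,L)\to(\mathcal B,\tilde L)$ is a pseudo-Finsler submersion if the restriction of $L$ to the tangent spaces of the fibers is a pseudo-Finsler metric on each fiber, and $L(v)=\tilde L(d\sigma(v))$ for every horizontal $v$ (in particular $d\sigma(v)$ is admissible). A vector is $g_v$-horizontal if it is $g_v$-orthogonal to $\mathcal V_p$. **O'Neill tensors.** For admissible $v\in T_p\mathcal M$, write $e=e^\top_v+e^\bot_v$ with $e^\top_v\in\mathcal V_p$ and $e^\bot_v$ $g_v$-horizontal; $E^\top,E^\bot$ are the anisotropic vector fields $v\mapsto(E_v)^\top_v$, $v\mapsto(E_v)^\bot_v$. Put $\chi^v_he=(\nabla^v_hE^\bot)^\top_v+(\nabla^v_hE^\top)^\bot_v$ for any extension $E$ of $e$ (tensorial), and $\mathbf T^v_be=\chi^v_{b^\top_v}e$, $\mathbf A^v_be=\chi^v_{b^\bot_v}e$.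 *)

(* Defs.v *)
From HB Require Import structures.
From mathcomp Require Import all_boot all_order all_algebra.
From mathcomp Require Import all_classical all_reals.
From mathcomp Require Import topology normedtype derive.

Set Implicit Arguments.
Unset Strict Implicit.
Unset Printing Implicit Defensive.
Import Order.TTheory GRing.Theory Num.Theory numFieldNormedType.Exports.
Local Open Scope classical_set_scope.
Local Open Scope ring_scope.

(* C^k and C^oo maps on an open subset D of a finite-dimensional space. Only  *)
(* the values of f on D matter, as D is open wherever these are used.         *)
Fixpoint Ck_on (R : realType) (V W : normedModType R) (k : nat) (D : set V)
    (f : V -> W) : Prop :=
  if k is k'.+1 then
    (forall x, D x -> differentiable f x) /\
    (forall v, Ck_on k' D (fun x => 'D_v f x))
  else forall x, D x -> {for x, continuous f}.

Definition smooth_on (R : realType) (V W : normedModType R) (D : set V)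
    (f : V -> W) : Prop := forall k, Ck_on k D f.

Definition nondegenerate_on (R : realType) (n : nat)
    (b : 'rV[R]_n -> 'rV[R]_n -> R) (S : set 'rV[R]_n) : Prop :=
  forall e, S e -> (forall h, S h -> b e h = 0) -> e = 0.

Definition nondegenerate_plane (R : realType) (n : nat)
    (b : 'rV[R]_n -> 'rV[R]_n -> R) (e h : 'rV[R]_n) : Prop :=
  free [:: e; h] /\ nondegenerate_on b [set` <<[:: e; h]>>%VS].

(* [cinv] is total; only its values on the open image of the chart matter.    *)
Record chart (R : realType) (n : nat) (T : topologicalType) := Chart {
  cdom : set T;
  cmap :> T -> 'rV[R]_n;
  cinv : 'rV[R]_n -> T;
  cdom_open : open cdom;
  cimg_open : open (cmap @` cdom);
  cmapK : forall p, cdom p -> cinv (cmap p) = p;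
  cmap_continuous : forall p, cdom p -> {for p, continuous cmap};
  cinv_continuous : forall x, (cmap @` cdom) x -> {for x, continuous cinv}
}.

Definition cimg (R : realType) (n : nat) (T : topologicalType)
  (c : chart R n T) : set 'rV[R]_n := c @` cdom c.

Record manifold (R : realType) (n : nat) := Manifold {
  space :> topologicalType;
  space_hausdorff : hausdorff_space space;
  space_second_countable : @second_countable space;
  atlas : set (chart R n space);
  atlas_cover : forall p : space, exists2 c, atlas c & cdom c p;
  atlas_compat : forall c d, atlas c -> atlas d ->
    smooth_on (c @` (cdom c `&` cdom d)) (d \o cinv c)
}.

Arguments atlas {R n} m _ : rename.

Section Manifold.
Context {R : realType} {n : nat} {M : manifold R n}.

Definition chart_at (p : M) : chart R n M := s2val (cid2 (atlas_cover p)).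

(* T_pM is 'rV_n, a vector being identified with its coordinates in the       *)
(* preferred chart [chart_at p]. An element of TM is a pair (p, u); the       *)
(* product topology on pairs is not that of TM and is never used: openness    *)
(* and smoothness on TM are read in the induced charts [tchart_inv].          *)
Definition tangent : Type := (M * 'rV[R]_n)%type.

Definition tcoord (c : chart R n M) (p : M) (u : 'rV[R]_n) : 'rV[R]_n :=
  'd (c \o cinv (chart_at p)) (chart_at p p) u.

Definition tvec (c : chart R n M) (x y : 'rV[R]_n) : 'rV[R]_n :=
  'd (chart_at (cinv c x) \o cinv c) x y.

Definition tchart_inv (c : chart R n M) (z : 'rV[R]_n * 'rV[R]_n) : tangent :=
  (cinv c z.1, tvec c z.1 z.2).

Definition tchart_pre (c : chart R n M) (A : set tangent) :
    set ('rV[R]_n * 'rV[R]_n) :=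
  [set z | cimg c z.1 /\ A (tchart_inv c z)].

Definition topen (A : set tangent) : Prop :=
  forall c, atlas M c -> open (tchart_pre c A).

Definition vfield : Type := M -> 'rV[R]_n.
Definition avfield : Type := tangent -> 'rV[R]_n.

Definition vfield_in (c : chart R n M) (E : vfield) : 'rV[R]_n -> 'rV[R]_n :=
  fun x => tcoord c (cinv c x) (E (cinv c x)).

(* In these four predicates Omega is open in M and A is open in TM; outside   *)
(* of Omega, resp. A, the values are irrelevant, so that total functions      *)
(* represent local functions and fields.                                      *)
Definition smooth_fun (Omega : set M) (f : M -> R) : Prop :=
  forall c, atlas M c -> smooth_on (c @` (cdom c `&` Omega)) (f \o cinv c).

Definition smooth_vfield (Omega : set M) (E : vfield) : Prop :=
  forall c, atlas M c -> smooth_on (c @` (cdom c `&` Omega)) (vfield_in c E).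

Definition smooth_afun (A : set tangent) (f : tangent -> R) : Prop :=
  forall c, atlas M c -> smooth_on (tchart_pre c A) (f \o tchart_inv c).

Definition smooth_avfield (A : set tangent) (X : avfield) : Prop :=
  forall c, atlas M c -> smooth_on (tchart_pre c A)
    (fun z => tcoord c (cinv c z.1) (X (tchart_inv c z))).

(* The derivative e(f), for e in T_pM.                                        *)
Definition dfun (p : M) (e : 'rV[R]_n) (f : M -> R) : R :=
  'D_e (f \o cinv (chart_at p)) (chart_at p p).

(* Coordinate formula for the Lie bracket, in the preferred chart at p.       *)
Definition bracket (E H : vfield) : vfield := fun p =>
  let c := chart_at p in
  'D_(E p) (vfield_in c H) (c p) - 'D_(H p) (vfield_in c E) (c p).

(* The extension of e in T_pM to a vector field with constant coordinates in  *)
(* the preferred chart at p; it is smooth on the domain of this chart, and    *)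
(* admissible near p if e is admissible. All the notions below that use it    *)
(* are independent of the choice of an extension.                             *)
Definition ext (p : M) (e : 'rV[R]_n) : vfield := fun q =>
  'd (chart_at q \o cinv (chart_at p)) (chart_at p q) e.

Definition fundamental_tensor (L : tangent -> R) (v : tangent)
    (e h : 'rV[R]_n) : R :=
  2^-1 * derive1 (fun s : R =>
           derive1 (fun t : R => L (v.1, v.2 + s *: e + t *: h)) 0) 0.

Record pseudo_Finsler (A : set tangent) (L : tangent -> R) : Prop := {
  admissible_neq0 : forall v, A v -> v.2 != 0;
  admissible_open : topen A;
  admissible_conic : forall v (l : R), A v -> 0 < l -> A (v.1, l *: v.2);
  metric_smooth : smooth_afun A L;
  metric_homogeneous : forall v (l : R), A v -> 0 < l ->
    L (v.1, l *: v.2) = l ^+ 2 * L v;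
  metric_nondegenerate : forall v, A v ->
    nondegenerate_on (fundamental_tensor L v) [set: 'rV[R]_n]
}.

Definition connection : Type := vfield -> vfield -> avfield.

(* The axioms hold for fields and functions that are smooth on some open      *)
(* neighbourhood Omega of pi(v), so nabla operates on local fields.           *)
Record anisotropic_connection (A : set tangent) (nabla : connection) : Prop := {
  nabla_smooth : forall (Omega : set M) (E H : vfield), open Omega ->
    smooth_vfield Omega E -> smooth_vfield Omega H ->
    smooth_avfield [set v | A v /\ Omega v.1] (nabla E H);
  nabla_linearl : forall (Omega : set M) (f : M -> R) (E1 E2 H : vfield) v,
    open Omega -> smooth_fun Omega f -> smooth_vfield Omega E1 ->
    smooth_vfield Omega E2 -> smooth_vfield Omega H -> A v -> Omega v.1 ->
    nabla (fun q => f q *: E1 q + E2 q) H v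
    = f v.1 *: nabla E1 H v + nabla E2 H v;
  nabla_additiver : forall (Omega : set M) (E H1 H2 : vfield) v,
    open Omega -> smooth_vfield Omega E -> smooth_vfield Omega H1 ->
    smooth_vfield Omega H2 -> A v -> Omega v.1 ->
    nabla E (fun q => H1 q + H2 q) v = nabla E H1 v + nabla E H2 v;
  nabla_leibniz : forall (Omega : set M) (f : M -> R) (E H : vfield) v,
    open Omega -> smooth_fun Omega f -> smooth_vfield Omega E ->
    smooth_vfield Omega H -> A v -> Omega v.1 ->
    nabla E (fun q => f q *: H q) v
    = dfun v.1 (E v.1) f *: H v.1 + f v.1 *: nabla E H v
}.

Section Covariant.
Variable nabla : connection.

Definition cov_fun (E : vfield) (f : tangent -> R) (v : tangent) : R :=
  let V := ext v.1 v.2 in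
  dfun v.1 (E v.1) (fun q => f (q, V q))
  - 'D_(nabla E V v) (fun u => f (v.1, u)) v.2.

Definition cov_avfield (E : vfield) (X : avfield) : avfield := fun v =>
  let V := ext v.1 v.2 in
  nabla E (fun q => X (q, V q)) v
  - 'D_(nabla E V v) (fun u => X (v.1, u)) v.2.

(* Anisotropic tensors of type (0,2) and (1,2), as v |-> T_v.                 *)
Definition tensor02 : Type := tangent -> 'rV[R]_n -> 'rV[R]_n -> R.
Definition tensor12 : Type := tangent -> 'rV[R]_n -> 'rV[R]_n -> 'rV[R]_n.

(* (nabla_e T)_v(x, y) by the product rule, for e, x, y in T_pM, p = pi(v).   *)
Definition cov_tensor02 (T : tensor02) (v : tangent) (e x y : 'rV[R]_n) : R :=
  let E := ext v.1 e in
  let X : avfield := fun v' => ext v.1 x v'.1 in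
  let Y : avfield := fun v' => ext v.1 y v'.1 in
  cov_fun E (fun v' => T v' (X v') (Y v')) v
  - T v (cov_avfield E X v) y - T v x (cov_avfield E Y v).

Definition cov_tensor12 (T : tensor12) (v : tangent) (e x y : 'rV[R]_n) :
    'rV[R]_n :=
  let E := ext v.1 e in
  let X : avfield := fun v' => ext v.1 x v'.1 in
  let Y : avfield := fun v' => ext v.1 y v'.1 in
  cov_avfield E (fun v' => T v' (X v') (Y v')) v
  - T v (cov_avfield E X v) y - T v x (cov_avfield E Y v).

Definition curvature_field (E H B : vfield) : avfield := fun v =>
  cov_avfield E (nabla H B) v - cov_avfield H (nabla E B) v
  - nabla (bracket E H) B v.

Definition curvature (v : tangent) (e h b : 'rV[R]_n) : 'rV[R]_n :=
  curvature_field (ext v.1 e) (ext v.1 h) (ext v.1 b) v.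

Definition flag_curvature (L : tangent -> R) (v : tangent) (e : 'rV[R]_n) : R :=
  let g := fundamental_tensor L v in
  g (curvature v v.2 e e) v.2 / (L v * g e e - g v.2 e ^+ 2).

End Covariant.

Record Levi_Civita_Chern (A : set tangent) (L : tangent -> R)
    (nabla : connection) : Prop := {
  lcc_connection : anisotropic_connection A nabla;
  lcc_torsion_free : forall (Omega : set M) (E H : vfield) v,
    open Omega -> smooth_vfield Omega E -> smooth_vfield Omega H ->
    A v -> Omega v.1 -> nabla E H v - nabla H E v = bracket E H v.1;
  lcc_metric : forall v e x y, A v ->
    cov_tensor02 nabla (fundamental_tensor L) v e x y = 0
}.

End Manifold.

Arguments tangent {R n} M.
Arguments vfield {R n} M.
Arguments avfield {R n} M.
Arguments connection {R n} M.

Section Maps.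
Context {R : realType} {n m : nat} {M : manifold R n} {B : manifold R m}.

Definition smooth_map (s : M -> B) : Prop :=
  continuous s /\
  forall c d, atlas M c -> atlas B d ->
    smooth_on (c @` (cdom c `&` s @^-1` cdom d)) (d \o s \o cinv c).

Definition differential (s : M -> B) (p : M) (u : 'rV[R]_n) : 'rV[R]_m :=
  'd (chart_at (s p) \o s \o cinv (chart_at p)) (chart_at p p) u.

Definition tmap (s : M -> B) (v : tangent M) : tangent B :=
  (s v.1, differential s v.1 v.2).

Definition embedding (s : M -> B) : Prop :=
  [/\ smooth_map s, injective s,
      forall p, injective (differential s p) &
      forall U : set M, open U ->
        exists2 O : set B, open O & s @` U = O `&` range s].

End Maps.

Section Submersion.
Context {R : realType} {n m : nat} {M : manifold R n} {B : manifold R m}.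

Definition vertical (s : M -> B) (p : M) : set 'rV[R]_n :=
  [set w | differential s p w = 0].

Definition metric_horizontal (L : tangent M -> R) (s : M -> B) (v : tangent M)
    (e : 'rV[R]_n) : Prop :=
  forall w, vertical s v.1 w -> fundamental_tensor L v e w = 0.

Definition horizontal (A : set (tangent M)) (L : tangent M -> R) (s : M -> B)
    (v : tangent M) : Prop :=
  A v /\ metric_horizontal L s v v.2.

(* The fibre over b carries a unique structure of embedded submanifold; it is *)
(* given here by any embedding i : F -> M with image the fibre.               *)
Record pseudo_Finsler_submersion (A : set (tangent M)) (L : tangent M -> R)
    (A' : set (tangent B)) (L' : tangent B -> R) (s : M -> B) : Prop := {
  subm_smooth : smooth_map s;
  subm_surjective : forall b, exists p, s p = b;
  subm_differential : forall p u', exists u, differential s p u = u';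
  subm_fiber : forall b k (F : manifold R k) (i : F -> M),
    embedding i -> range i = s @^-1` [set b] ->
    pseudo_Finsler (tmap i @^-1` A) (L \o tmap i);
  subm_horizontal : forall v, horizontal A L s v ->
    A' (tmap s v) /\ L v = L' (tmap s v)
}.

Section ONeill.
Variables (L : tangent M -> R) (s : M -> B) (nabla : connection M).

(* The decomposition of e is unique as soon as the vertical space is          *)
(* g_v-non-degenerate; [vert] selects its vertical part.                      *)
Definition vert (v : tangent M) (e : 'rV[R]_n) : 'rV[R]_n :=
  xget 0 [set w | vertical s v.1 w /\ metric_horizontal L s v (e - w)].

Definition hor (v : tangent M) (e : 'rV[R]_n) : 'rV[R]_n := e - vert v e.

Definition ONeill_chi (v : tangent M) (h e : 'rV[R]_n) : 'rV[R]_n :=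
  let H := ext v.1 h in
  let E : avfield M := fun v' => ext v.1 e v'.1 in
  vert v (cov_avfield nabla H (fun v' => hor v' (E v')) v)
  + hor v (cov_avfield nabla H (fun v' => vert v' (E v')) v).

Definition ONeill_T (v : tangent M) (b e : 'rV[R]_n) : 'rV[R]_n :=
  ONeill_chi v (vert v b) e.

Definition ONeill_A (v : tangent M) (b e : 'rV[R]_n) : 'rV[R]_n :=
  ONeill_chi v (hor v b) e.

End ONeill.
End Submersion.

(* Main.v *)
Require Import Defs.
From HB Require Import structures.
From mathcomp Require Import all_boot all_order all_algebra.
From mathcomp Require Import all_classical all_reals.
From mathcomp Require Import topology normedtype derive.
From mathcomp Require Import interval_inference landau sequences ring lra.
Set Implicit Arguments.
Unset Strict Implicit.
Unset Printing Implicit Defensive.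
Import Order.TTheory GRing.Theory Num.Theory numFieldNormedType.Exports.
Local Open Scope classical_set_scope.
Local Open Scope ring_scope.

(* In the chart at a point, a tangent vector is a pair [z = (x, y)] and the    *)
(* connection is given by coefficients [Gam z], so that covariant derivatives  *)
(* are derivatives along the horizontal lift [(e, - Gam z e y)]. Horizontal    *)
(* vectors are the zeros of [k(z) = P_z y], with [P_z] the [g_z]-orthogonal    *)
(* projection on the vertical space. At a horizontal [z], a function that      *)
(* vanishes on all horizontal vectors has the same derivative along [t] as     *)
(* along the fibre vector [(0, Dk t)]. Applied to [L - L' o dsigma] this shows *)
(* that the 1-jets of the two metrics agree at [z], hence that [dsigma] is     *)
(* isometric on [g_z]-horizontal vectors and that the spray is tangent to the  *)
(* set of horizontal vectors and projects to the spray of the base.            *)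
(*   For the first formula, the same principle is applied to the function      *)
(* [z |-> g_z(y, nabla_y W)] for a vertical field [W], whose derivatives       *)
(* express the O'Neill tensors. For the second one, it is applied to the       *)
(* difference of the two sprays and to its fibre derivative: this computes     *)
(* [dsigma(R_v(x, v)v)] as the curvature of the base minus three times a       *)
(* vector whose product with [dsigma(x)] is [g_v(A_x v, A_x v)].               *)

(** * Calculus in normed modules *)

(** Everything is computed in one chart around the base point of [v] and one around its image. The
    tautological vector [z.2] is parallel along the lifts [hlift Gam z e], hence so are the pairing
    [lform] with it and the metric function ([rderive_lform_hlift], [rderive_metric_hlift]).

    The horizontal vectors are the zeros of [vpart P], whose fibre derivative there is the
    projection [P z] ([derive_kvert_fiber]). So every direction [t] becomes tangent to this zero set
    once the fibre vector [(0, 'D_t (vpart P) z)] is subtracted, and a function that vanishes on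
    horizontal vectors has zero derivative along the corrected direction: this is [tangent_derive].
    No submanifold structure is built; [constrained_derive] does the work of the implicit function
    theorem by a contraction. Applied to the two metrics, the principle gives equality of 1-jets
    ([metric_one_jet]), tangency of the spray to the horizontal set ([derive_kvert_spray]), isometry
    on horizontal vectors ([gform_lhor]) and projection of the spray ([spray_defect_lhor]).

    Let a_e be the covariant derivative [vpart_cov P Gam z e]. At a horizontal v one has T_w v = -
    a_w and A_x v = - a_x ([chi_lhor]). Take a vertical field W extending w, put b = nabla_v W, and
    let q be the horizontal part of b, which is A_v w ([chi_field]). Expanding R(v,w)w by
    [curv_field], and using [lform_cov_T] and [rderive_vdefect_hlift], gives g(R(v,w)w, v) =
    g((nabla_v T)_w w, v) - g(a_q, w) - g(a_(a_w), w). Then [gform_alpha_ghor] turns - g(a_q, w)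
    into g(q, q), and the symmetry [gform_alpha_sym] turns the last product into g(a_w, a_w). This
    is [vertical_curvature].

    For horizontal x, the skew-symmetry [lform_curv] reduces R(v,x)x to the Jacobi operator R(x,v)v,
    which [curv_jacobi] writes with the spray and the nonlinear connection. Differentiating the
    spray defect along the corrected lift of x ([horizontal_eq1]) leaves 2 [sff] (a_x);
    differentiating [sff] along the spray ([horizontal_eq2]) leaves one more, with the opposite
    sign. Their difference is the factor 3 of [dmap_curv], and [gform_sff] evaluates the product of
    [sff] (a_x) with the image of x as g(a_x, a_x). *)

Section LinearPredicate.
Context {R : pzRingType} {U V : lmodType R} (f : U -> V).
Hypothesis lf : linear f.

Lemma linD u v : f (u + v) = f u + f v.
Proof. by have := lf 1 u v; rewrite !scale1r. Qed.

Lemma lin0 : f 0 = 0.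
Proof. by apply: (addrI (f 0)); rewrite -linD !addr0. Qed.

Lemma linZ a u : f (a *: u) = a *: f u.
Proof. by rewrite -[a *: u]addr0 lf lin0 addr0. Qed.

Lemma linN u : f (- u) = - f u.
Proof. by rewrite -scaleN1r linZ scaleN1r. Qed.

Lemma linB u v : f (u - v) = f u - f v.
Proof. by rewrite linD linN. Qed.

End LinearPredicate.

(** * Directional derivatives: linearity, composition, scaling *)

Section Differentiability.
Context {R : realType}.
Implicit Types U V W : normedModType R.

Lemma near_eq_differentiable V W (f g : V -> W) (x : V) :
  (\forall y \near x, f y = g y) -> differentiable f x -> differentiable g x.
Proof.
move=> fg df; have /diff_locallyP[cdf fE] := df.
suff gE : g \o shift x = cst (g x) + 'd f x +o_ 0 id.
  have dgE : 'd g x = 'd f x :> (V -> W) by exact: diff_unique.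
  by apply/diff_locallyP; rewrite dgE.
apply/eqaddoP => e e0; move/eqaddoP: fE => /(_ e e0); apply: filter_app.
have fg' : \forall h \near (0 : V), f (h + x) = g (h + x).
  by have := fg; rewrite (near_shift 0) /= subr0.
near=> h; rewrite /= !fctE /= -(nbhs_singleton fg).
suff -> : g (h + x) = f (h + x) by [].
by apply/esym; near: h.
Unshelve. all: by end_near. Qed.

Lemma deriveDr V W (f : V -> W) x u v : differentiable f x ->
  'D_(u + v) f x = 'D_u f x + 'D_v f x.
Proof. by move=> df; rewrite !deriveE// linearD. Qed.

Lemma deriveZr V W (f : V -> W) x (k : R) u : differentiable f x ->
  'D_(k *: u) f x = k *: 'D_u f x.
Proof. by move=> df; rewrite !deriveE// linearZ. Qed.

Lemma deriveNr V W (f : V -> W) x u : differentiable f x ->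
  'D_(- u) f x = - 'D_u f x.
Proof. by move=> df; rewrite !deriveE// linearN. Qed.

Lemma deriveBr V W (f : V -> W) x u v : differentiable f x ->
  'D_(u - v) f x = 'D_u f x - 'D_v f x.
Proof. by move=> df; rewrite !deriveE// linearB. Qed.

Lemma derive_sumr V W (f : V -> W) x (I : Type) (r : seq I) (u : I -> V) :
  differentiable f x ->
  'D_(\sum_(i <- r) u i) f x = \sum_(i <- r) 'D_(u i) f x.
Proof.
move=> df; rewrite deriveE// linear_sum.
by apply: eq_bigr => i _; rewrite deriveE.
Qed.

Lemma derive_comp U V W (f : U -> V) (g : V -> W) x u :
  differentiable f x -> differentiable g (f x) ->
  'D_u (g \o f) x = 'D_('D_u f x) g (f x).
Proof.
move=> df dg; rewrite !deriveE//; last exact: differentiable_comp.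
by rewrite diff_comp.
Qed.

Lemma derive_clin V W (f : {linear V -> W}) x u :
  continuous f -> 'D_u f x = f u.
Proof.
by move=> cf; rewrite deriveE ?diff_lin//; exact: linear_differentiable.
Qed.

Lemma scale_is_bilinear W : bilinear_for
  (GRing.Scale.Law.clone _ _ *:%R _) (GRing.Scale.Law.clone _ _ *:%R _)
  (@GRing.scale R W).
Proof.
split=> [w|k] a x y /=; first by rewrite scalerDl scalerA.
by rewrite scalerDr !scalerA mulrC.
Qed.

HB.instance Definition _ W := bilinear_isBilinear.Build R R W W _ _
  (@GRing.scale R W) (@scale_is_bilinear W).

Lemma differentiable_scale_pair W (q : R * W) :
  differentiable (fun p : R * W => p.1 *: p.2) q.
Proof. exact: (differentiable_bilin q (@scale_continuous _ _)). Qed.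

Lemma differentiable_scale V W (k : V -> R) (f : V -> W) x :
  differentiable k x -> differentiable f x ->
  differentiable (fun y => k y *: f y) x.
Proof.
move=> dk df.
have dkf := differentiable_pair dk df.
apply: (@differentiable_comp _ _ _ _ _ (fun p : R * W => p.1 *: p.2) x dkf).
exact: differentiable_scale_pair.
Qed.

Lemma derive_scale V W (k : V -> R) (f : V -> W) x u :
  differentiable k x -> differentiable f x ->
  'D_u (fun y => k y *: f y) x = k x *: 'D_u f x + 'D_u k x *: f x.
Proof.
move=> dk df.
have dkf := differentiable_pair dk df.
have db := differentiable_scale_pair (k x, f x).
rewrite (derive_comp u dkf db) !deriveE// diff_pair//.
by rewrite (diff_bilin _ (@scale_continuous _ _)).
Qed.

End Differentiability.

(** * Continuous linear maps and finite-dimensional spaces *)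

Section FiniteDimension.
Context {R : realType}.
Implicit Types U V W : normedModType R.

(** A predicate on bare functions, so that maps such as [tcoord c q] need no declared linear
    structure. *)
Definition clinear V W (f : V -> W) : Prop := linear f /\ continuous f.

Lemma clinear_differentiable V W (f : V -> W) x :
  clinear f -> differentiable f x.
Proof.
move=> [lf cf]; pose fM := GRing.isLinear.Build _ _ _ _ f lf.
pose fL : {linear V -> W} := HB.pack f fM.
exact: (@linear_differentiable _ _ _ fL).
Qed.

Lemma clinear_derive V W (f : V -> W) x u : clinear f -> 'D_u f x = f u.
Proof.
move=> [lf cf]; pose fM := GRing.isLinear.Build _ _ _ _ f lf.
pose fL : {linear V -> W} := HB.pack f fM.
exact: (@derive_clin _ _ _ fL).
Qed.

(** A finite spanning family together with continuous coordinate functionals. This form passes to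
    products and turns every linear map into a finite sum. *)
Definition findim V : Prop := exists (N : nat) (e : 'I_N -> V)
  (c : 'I_N -> V -> R), (forall i, clinear (c i)) /\
  forall x, x = \sum_i c i x *: e i.

Lemma linear_sum_scale V W (f : V -> W) (I : Type) (r : seq I) (c : I -> R) u :
  linear f -> f (\sum_(i <- r) c i *: u i) = \sum_(i <- r) c i *: f (u i).
Proof.
move=> lf; pose fM := GRing.isLinear.Build _ _ _ _ f lf.
pose fL : {linear V -> W} := HB.pack f fM.
rewrite -[f _]/(fL _) linear_sum; apply: eq_bigr => i _.
by rewrite linearZ.
Qed.

Lemma sum_continuous V W N (F : 'I_N -> V -> W) :
  (forall i, continuous (F i)) -> continuous (fun x => \sum_i F i x).
Proof.
move=> cF x; have -> : (fun x => \sum_i F i x) = \sum_i F i.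
  by apply/funext => y; rewrite fct_sumE.
elim/big_ind : _ => [|f g cf cg|i _]; [exact: cst_continuous| |exact: cF].
exact: continuousD.
Qed.

Lemma findim_clinear V W (f : V -> W) : findim V -> linear f -> clinear f.
Proof.
move=> [N [e [c [lc ce]]]] lf; split=> //.
have -> : f = fun x => \sum_i c i x *: f (e i).
  by apply/funext => x; rewrite {1}(ce x) linear_sum_scale.
apply: sum_continuous => i x.
apply: (@continuous_comp _ _ _ (c i) (fun k : R => k *: f (e i))).
  exact: (lc i).2.
exact: scalel_continuous.
Qed.

Lemma clinear_coord n (i : 'I_n) : clinear (fun x : 'rV[R]_n => x 0 i).
Proof.
by split=> [a u v|]; [rewrite !mxE|exact: coord_continuous].
Qed.

Lemma findim_rV n : findim 'rV[R]_n.
Proof.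
exists n, (fun i => delta_mx 0 i), (fun i (x : 'rV[R]_n) => x 0 i); split.
  by move=> i; exact: clinear_coord.
exact: row_sum_delta.
Qed.

Lemma clinear_id V : clinear (@id V).
Proof. by split=> // x; exact: cvg_id. Qed.

Lemma clinear_fst V W : clinear (fst : V * W -> V).
Proof. by split=> // x; exact: cvg_fst. Qed.

Lemma clinear_snd V W : clinear (snd : V * W -> W).
Proof. by split=> // x; exact: cvg_snd. Qed.

Lemma clinear_comp U V W (f : U -> V) (g : V -> W) :
  clinear f -> clinear g -> clinear (g \o f).
Proof.
move=> [lf cf] [lg cg]; split=> [a x y /=|x]; first by rewrite lf lg.
by apply: continuous_comp; [exact: cf|exact: cg].
Qed.

Lemma clinear_pair U V W (f : U -> V) (g : U -> W) :
  clinear f -> clinear g -> clinear (fun x => (f x, g x)).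
Proof.
move=> [lf cf] [lg cg]; split=> [a x y /=|x]; first by rewrite lf lg.
by apply: cvg_pair; [exact: cf|exact: cg].
Qed.

Lemma clinear_cst0 V W : clinear (fun _ : V => 0 : W).
Proof. by split=> [a x y|x]; [rewrite scaler0 addr0|exact: cst_continuous]. Qed.

Lemma findim_prod V W : findim V -> findim W ->
  findim (V * W)%type.
Proof.
move=> [N [e [c [lc ce]]]] [N' [e' [c' [lc' ce']]]].
exists (N + N')%N, (fun i : 'I_(N + N') => match fintype.split i with inl j => (e j, 0)
  | inr j => (0, e' j) end).
exists (fun i : 'I_(N + N') => match fintype.split i with inl j => c j \o fst
  | inr j => c' j \o snd end); split=> [i|[x y]].
  case: fintype.split => j; apply: clinear_comp => //; [exact: clinear_fst|].
  exact: clinear_snd.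
rewrite big_split_ord /=.
under eq_bigr do
  rewrite (unsplitK (inl _ : 'I_N + 'I_N')%type) /= -[_ *: _]/(_, _) scaler0.
under [X in _ + X]eq_bigr do
  rewrite (unsplitK (inr _ : 'I_N + 'I_N')%type) /= -[_ *: _]/(_, _) scaler0.
rewrite {1}(ce x) {1}(ce' y).
have -> : \sum_(i < N) (c i x *: e i, 0 : W) = (\sum_i c i x *: e i, 0).
  by elim/big_rec2 : _ => // i a b _ ->; rewrite -[LHS]/(_, _) addr0.
have -> : \sum_(i < N') (0 : V, c' i y *: e' i) = (0, \sum_i c' i y *: e' i).
  by elim/big_rec2 : _ => // i a b _ ->; rewrite -[LHS]/(_, _) addr0.
by rewrite -[RHS]/(_, _) addr0 add0r.
Qed.

End FiniteDimension.

(** * Stability of C^k maps *)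

Section SmoothMaps.
Context {R : realType}.
Implicit Types (U V W : normedModType R) (k n : nat).

Lemma open_nearW V (D : set V) (P : V -> Prop) x : open D -> D x ->
  (forall y, D y -> P y) -> \forall y \near x, P y.
Proof. by move=> oD Dx DP; apply: filterS DP _; exact: open_nbhs_nbhs. Qed.

Lemma Ck_on_eq V W k (D : set V) (f g : V -> W) : open D ->
  (forall x, D x -> f x = g x) -> Ck_on k D f -> Ck_on k D g.
Proof.
elim: k f g => [|k IH] f g oD fg /=.
  move=> cf x Dx; have fx := cf x Dx; rewrite /prop_for /continuous_at -(fg _ Dx).
  apply: cvg_trans fx; apply: near_eq_cvg.
  by apply: open_nearW oD Dx _ => y /fg.
move=> [df dDf]; split=> [x Dx|v].
  apply: near_eq_differentiable (df x Dx).
  exact: open_nearW oD Dx _.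
apply: IH (dDf v) => // x Dx.
apply: near_eq_derive; exact: open_nearW oD Dx _.
Qed.

Lemma Ck_onS V W k (D : set V) (f : V -> W) : Ck_on k.+1 D f -> Ck_on k D f.
Proof.
elim: k f => [|k IH] f /= [df Df]; last by split=> // v; exact: IH (Df v).
by move=> x /df; exact: differentiable_continuous.
Qed.

Lemma Ck_on_sub V W k (D E : set V) (f : V -> W) :
  E `<=` D -> Ck_on k D f -> Ck_on k E f.
Proof.
move=> ED; elim: k f => [|k IH] f /=; first by move=> cf x /ED/cf.
by move=> [df Df]; split=> [x /ED/df//|v]; exact: IH (Df v).
Qed.

Lemma Ck_on_bigcup V W k (D : set V) (f : V -> W) :
  (forall x, D x -> exists2 E : set V, E x & Ck_on k E f) -> Ck_on k D f.
Proof.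
elim: k f => [|k IH] f DE /=; first by move=> x /DE[E Ex /(_ x Ex)].
split=> [x /DE[E Ex [df _]]|v]; first exact: df.
by apply: IH => x /DE[E Ex [_ Df]]; exists E => //; exact: Df.
Qed.

Lemma Ck_on_cst V W k (D : set V) (a : W) : Ck_on k D (fun=> a).
Proof.
elim: k a => [|k IH] a /=; first by move=> x _; exact: cst_continuous.
split=> [x _|v]; first exact: differentiable_cst.
suff -> : 'D_v (fun _ : V => a) = fun=> 0 by exact: IH.
by apply/funext => x; rewrite derive_cst.
Qed.

Lemma Ck_on_clinear U V W k (D : set U) (f : U -> V) (g : V -> W) :
  open D -> clinear g -> Ck_on k D f -> Ck_on k D (g \o f).
Proof.
move=> oD lg; elim: k f => [|k IH] f /=.
  move=> cf x Dx; apply: continuous_comp; first exact: cf.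
  exact: lg.2.
move=> [df Df]; split=> [x Dx|v].
  apply: differentiable_comp; first exact: df.
  exact: clinear_differentiable.
apply: Ck_on_eq oD _ (IH _ (Df v)) => x Dx /=.
have dg := clinear_differentiable (f x) lg.
by rewrite (derive_comp _ (df _ Dx) dg) (clinear_derive _ _ lg).
Qed.

Lemma Ck_onD V W k (D : set V) (f g : V -> W) : open D ->
  Ck_on k D f -> Ck_on k D g -> Ck_on k D (fun x => f x + g x).
Proof.
move=> oD; elim: k f g => [|k IH] f g /=.
  move=> cf cg x Dx.
  exact: (@continuousD _ _ _ f g x (cf _ Dx) (cg _ Dx)).
move=> [df Df] [dg Dg]; split=> [x Dx|v].
  exact: (@differentiableD _ _ _ f g x (df _ Dx) (dg _ Dx)).
apply: Ck_on_eq oD _ (IH _ _ (Df v) (Dg v)) => x Dx /=.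
apply/esym/(@deriveD _ _ _ f g x v); apply: diff_derivable; [exact: df|].
exact: dg.
Qed.

Lemma Ck_on_scale V W k (D : set V) (c : V -> R) (f : V -> W) : open D ->
  Ck_on k D c -> Ck_on k D f -> Ck_on k D (fun x => c x *: f x).
Proof.
move=> oD; elim: k c f => [|k IH] c f.
  move=> cc cf x Dx; have cx := cc x Dx; have fx := cf x Dx.
  exact: (continuousZ cx fx).
move=> cc cf; have cc' := Ck_onS cc; have cf' := Ck_onS cf.
move: cc cf => /= [dc Dc] [df Df]; split=> [x Dx|v].
  by apply: differentiable_scale; [exact: dc|exact: df].
have D1 := Ck_onD oD (IH _ _ cc' (Df v)) (IH _ _ (Dc v) cf').
apply: Ck_on_eq oD _ D1 => x Dx /=.
by rewrite derive_scale//; [exact: dc|exact: df].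
Qed.

Lemma Ck_on_sum V W k (D : set V) (I : Type) (r : seq I) (f : I -> V -> W) :
  open D -> (forall i, Ck_on k D (f i)) ->
  Ck_on k D (fun x => \sum_(i <- r) f i x).
Proof.
move=> oD cf; elim: r => [|i r IH].
  apply: (@Ck_on_eq _ _ _ _ (fun=> 0)) => //; last exact: Ck_on_cst.
  by move=> x _; rewrite big_nil.
apply: Ck_on_eq oD _ (Ck_onD oD (cf i) IH) => x _.
by rewrite big_cons.
Qed.

(** [Ck_on] differentiates in fixed directions only, while the chain rule produces the moving
    direction ['D_v f x]. Expanding it in the coordinates of [V] gives a sum of products to which
    the induction hypothesis applies. *)
Lemma Ck_on_comp U V W k (D : set U) (E : set V) (f : U -> V) (g : V -> W) :
  findim V -> open D -> open E -> (forall x, D x -> E (f x)) ->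
  Ck_on k D f -> Ck_on k E g -> Ck_on k D (g \o f).
Proof.
move=> [N [e [c [lc ce]]]] oD oE DE; elim: k g f DE => [|k IH] g f DE.
  move=> /= cf cg x Dx; apply: continuous_comp; first exact: cf.
  exact: cg (DE _ Dx).
move=> cf cg; have cf' := Ck_onS cf; move: cf cg => /= [df Df] [dg Dg].
split=> [x Dx|v].
  by apply: differentiable_comp; [exact: df|apply/dg/DE].
have : Ck_on k D (fun x => \sum_i c i ('D_v f x) *: 'D_(e i) g (f x)).
  apply: Ck_on_sum => // i; apply: Ck_on_scale => //.
    exact: (Ck_on_clinear oD (lc i) (Df v)).
  exact: (IH _ _ DE cf' (Dg (e i))).
apply: Ck_on_eq => // x Dx.
have dgx := dg _ (DE _ Dx).
rewrite (derive_comp _ (df _ Dx) dgx) {2}(ce ('D_v f x)) derive_sumr//.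
by apply: eq_bigr => i _; rewrite deriveZr.
Qed.

Lemma Ck_on_pair U V W k (D : set U) (f : U -> V) (g : U -> W) : open D ->
  Ck_on k D f -> Ck_on k D g -> Ck_on k D (fun x => (f x, g x)).
Proof.
move=> oD cf cg.
have lf : clinear (fun x : V => (x, 0 : W)).
  by apply: clinear_pair; [exact: clinear_id|exact: clinear_cst0].
have lg : clinear (fun x : W => (0 : V, x)).
  by apply: clinear_pair; [exact: clinear_cst0|exact: clinear_id].
have := Ck_onD oD (Ck_on_clinear oD lf cf) (Ck_on_clinear oD lg cg).
apply: Ck_on_eq => // x Dx /=.
by rewrite -[LHS]/(_, _) addr0 add0r.
Qed.

Lemma Ck_on_inv V k (D : set V) (f : V -> R) : open D ->
  (forall x, D x -> f x != 0) -> Ck_on k D f -> Ck_on k D (fun x => (f x)^-1).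
Proof.
move=> oD f0; elim: k => [|k IH].
  by move=> cf x Dx; apply: continuousV; [exact: f0|exact: cf].
move=> cf; have {}IH := IH (Ck_onS cf); move: cf => [df Df]; split=> [x Dx|v].
  exact: (differentiableV (df _ Dx) (f0 _ Dx)).
have := Ck_on_scale oD (Ck_on_scale oD IH IH) (Df v).
move=> /(Ck_on_clinear oD (g := -%R)) => H.
apply: Ck_on_eq oD _ (H _) => [x Dx|]; last first.
  split=> [a x y|]; first by rewrite opprD -scalerN.
  exact: opp_continuous.
rewrite (@deriveV _ _ f)//; [|exact: f0|exact: diff_derivable (df _ Dx)].
by rewrite /= -scaleNr expr2 invfM.
Qed.

End SmoothMaps.

(** * Germs of smooth maps *)

Section SmoothAt.
Context {R : realType}.
Implicit Types (U V W : normedModType R) (k n : nat).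

(** Smoothness near a point, with the neighbourhood hidden: an open condition ([smooth_at_near]), so
    that later statements carry no domains. *)
Definition smooth_at V W (f : V -> W) (x : V) : Prop :=
  exists2 D : set V, open D /\ D x & smooth_on D f.

Lemma smooth_onW V W (D : set V) (f : V -> W) x :
  open D -> D x -> smooth_on D f -> smooth_at f x.
Proof. by move=> oD Dx fD; exists D. Qed.

Lemma smooth_at_on V W (D : set V) (f : V -> W) :
  (forall x, D x -> smooth_at f x) -> smooth_on D f.
Proof.
move=> fD k; apply: Ck_on_bigcup => x /fD[E [_ Ex] fE].
by exists E => //; exact: fE.
Qed.

Lemma smooth_at_near V W (f : V -> W) x :
  smooth_at f x -> \forall y \near x, smooth_at f y.
Proof.
move=> [D [oD Dx] fD]; apply: (open_nearW oD Dx) => y Dy.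
exact: smooth_onW fD.
Qed.

Lemma smooth_at_diff V W (f : V -> W) x : smooth_at f x -> differentiable f x.
Proof. by move=> [D [_ Dx] /(_ 1%N)[+ _]]; exact. Qed.

Lemma smooth_at_cont V W (f : V -> W) x :
  smooth_at f x -> {for x, continuous f}.
Proof. by move=> /smooth_at_diff/differentiable_continuous. Qed.

Lemma smooth_at_derive V W (f : V -> W) x v :
  smooth_at f x -> smooth_at ('D_v f) x.
Proof.
by move=> [D oDx fD]; exists D => // k; have [_] := fD k.+1; exact.
Qed.

Lemma near_open (T : topologicalType) (P : T -> Prop) x :
  (\forall y \near x, P y) ->
  exists D : set T, [/\ open D, D x & forall y, D y -> P y].
Proof.
move=> Px; have : nbhs x [set y | P y] := Px.
by rewrite nbhsE => -[D [oD Dx] DP]; exists D.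
Qed.

Lemma smooth_at_eq V W (f g : V -> W) x : (\forall y \near x, f y = g y) ->
  smooth_at f x -> smooth_at g x.
Proof.
move=> /near_open[E [oE Ex Efg]] [D [oD Dx] fD].
exists (D `&` E); first by split=> //; exact: openI.
move=> k; apply: (@Ck_on_eq _ _ _ _ _ f); first exact: openI.
  by move=> y [_ /Efg].
by apply: Ck_on_sub (fD k); exact: subIsetl.
Qed.

Lemma smooth_at_cst V W (a : W) (x : V) : smooth_at (fun=> a) x.
Proof.
exists setT; first by split=> //; exact: openT.
by move=> k; exact: Ck_on_cst.
Qed.

Lemma clinear_smooth V W (f : V -> W) x : clinear f -> smooth_at f x.
Proof.
move=> lf; exists setT; first by split=> //; exact: openT.
move=> [|k]; first by move=> y _; exact: lf.2.
split=> [y _|v]; first exact: clinear_differentiable.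
apply: (@Ck_on_eq _ _ _ _ _ (fun=> f v)); [exact: openT| |exact: Ck_on_cst].
by move=> y _; rewrite clinear_derive.
Qed.

Lemma smooth_atI V W W' (f : V -> W) (g : V -> W') x :
  smooth_at f x -> smooth_at g x ->
  exists D : set V, [/\ open D, D x, smooth_on D f & smooth_on D g].
Proof.
move=> [D [oD Dx] fD] [E [oE Ex] gE]; exists (D `&` E); split=> //.
- exact: openI.
- by move=> k; apply: Ck_on_sub (fD k); exact: subIsetl.
- by move=> k; apply: Ck_on_sub (gE k); exact: subIsetr.
Qed.

Lemma smooth_atD V W (f g : V -> W) x : smooth_at f x -> smooth_at g x ->
  smooth_at (fun y => f y + g y) x.
Proof.
move=> sf sg; have [D [oD Dx fD gD]] := smooth_atI sf sg; exists D => // k.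
exact: Ck_onD (fD k) (gD k).
Qed.

Lemma smooth_at_scale V W (c : V -> R) (f : V -> W) x :
  smooth_at c x -> smooth_at f x -> smooth_at (fun y => c y *: f y) x.
Proof.
move=> sf sg; have [D [oD Dx fD gD]] := smooth_atI sf sg; exists D => // k.
exact: Ck_on_scale (fD k) (gD k).
Qed.

Lemma smooth_at_scaler V W (c : R) (f : V -> W) x :
  smooth_at f x -> smooth_at (fun y => c *: f y) x.
Proof. by apply: smooth_at_scale; exact: smooth_at_cst. Qed.

Lemma smooth_atN V W (f : V -> W) x :
  smooth_at f x -> smooth_at (fun y => - f y) x.
Proof.
move=> /(smooth_at_scaler (-1)); apply: smooth_at_eq.
by apply: nearW => y; rewrite scaleN1r.
Qed.

Lemma smooth_atB V W (f g : V -> W) x : smooth_at f x -> smooth_at g x ->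
  smooth_at (fun y => f y - g y) x.
Proof. by move=> sf sg; apply: smooth_atD => //; exact: smooth_atN. Qed.

Lemma smooth_at_sum V W (I : Type) (r : seq I) (f : I -> V -> W) x :
  (forall i, smooth_at (f i) x) -> smooth_at (fun y => \sum_(i <- r) f i y) x.
Proof.
move=> sf; elim: r => [|i r IH].
  apply: smooth_at_eq (smooth_at_cst 0 x).
  by apply: nearW => y; rewrite big_nil.
apply: smooth_at_eq (smooth_atD (sf i) IH).
by apply: nearW => y; rewrite big_cons.
Qed.

Lemma smooth_at_prod V (I : Type) (r : seq I) (f : I -> V -> R) x :
  (forall i, smooth_at (f i) x) -> smooth_at (fun y => \prod_(i <- r) f i y) x.
Proof.
move=> sf; elim: r => [|i r IH].
  apply: smooth_at_eq (@smooth_at_cst V R 1 x).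
  by apply: nearW => y; rewrite big_nil.
apply: smooth_at_eq (smooth_at_scale (sf i) IH).
by apply: nearW => y; rewrite big_cons.
Qed.

Lemma smooth_at_inv V (f : V -> R) x : f x != 0 -> smooth_at f x ->
  smooth_at (fun y => (f y)^-1) x.
Proof.
move=> fx0 [D [oD Dx] fD].
have : \forall y \near x, f y != 0.
  have cf : {for x, continuous f} by apply: smooth_at_cont; exists D.
  exact: (cvgr_neq0 _ cf fx0).
move=> /near_open[E [oE Ex Ef0]].
exists (D `&` E); first by split=> //; exact: openI.
move=> k; apply: Ck_on_inv; first exact: openI.
  by move=> y [_ /Ef0].
by apply: Ck_on_sub (fD k); exact: subIsetl.
Qed.

Lemma smooth_at_comp U V W (f : U -> V) (g : V -> W) x : findim V ->
  smooth_at f x -> smooth_at g (f x) -> smooth_at (g \o f) x.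
Proof.
move=> fV sf [E [oE Efx] gE]; have cf := smooth_at_cont sf.
move: sf => [D [oD Dx] fD].
have : \forall y \near x, E (f y) by apply: cf; exact: open_nbhs_nbhs.
move=> /near_open[D' [oD' D'x D'E]].
exists (D `&` D'); first by split=> //; exact: openI.
move=> k; apply: (Ck_on_comp fV (openI oD oD') oE) (gE k).
  by move=> y [_ /D'E].
by apply: Ck_on_sub (fD k); exact: subIsetl.
Qed.

Lemma smooth_at_clinear U V W (f : U -> V) (g : V -> W) x : clinear g ->
  smooth_at f x -> smooth_at (fun y => g (f y)) x.
Proof.
move=> lg [D [oD Dx] fD]; exists D => // k.
exact: (Ck_on_clinear oD lg (fD k)).
Qed.

Lemma smooth_at_pair U V W (f : U -> V) (g : U -> W) x :
  smooth_at f x -> smooth_at g x -> smooth_at (fun y => (f y, g y)) x.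
Proof.
move=> sf sg; have [D [oD Dx fD gD]] := smooth_atI sf sg; exists D => // k.
exact: Ck_on_pair (fD k) (gD k).
Qed.

Lemma smooth_at_coord V n (f : V -> 'rV[R]_n) x i :
  smooth_at f x -> smooth_at (fun y => f y 0 i) x.
Proof. by move=> sf; apply: (smooth_at_clinear (clinear_coord i)). Qed.

Lemma smooth_at_rV V n (f : V -> 'rV[R]_n) x :
  (forall i, smooth_at (fun y => f y 0 i) x) -> smooth_at f x.
Proof.
move=> sf; have : smooth_at (fun y => \sum_i f y 0 i *: delta_mx 0 i : 'rV_n) x.
  by apply: smooth_at_sum => i; apply: smooth_at_scale => //; exact: smooth_at_cst.
by apply: smooth_at_eq; apply: nearW => y; rewrite -row_sum_delta.
Qed.

Lemma derive_coord V n (f : V -> 'rV[R]_n) x u i : differentiable f x ->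
  ('D_u f x) 0 i = 'D_u (fun y => f y 0 i) x.
Proof.
move=> df; have lc := @clinear_coord R n i.
by rewrite (derive_comp u df (clinear_differentiable _ lc)) (clinear_derive _ _ lc).
Qed.

Lemma derive_linear V W (f : V -> W) x : differentiable f x ->
  linear (fun u => 'D_u f x).
Proof. by move=> df a u v; rewrite deriveDr// deriveZr. Qed.

End SmoothAt.

(** * Linear maps that depend on a parameter *)

Section ParametricLinear.
Context {R : realType} (U V W : normedModType R).
Variables (T : V -> U -> W) (u : V -> U) (x : V).
Hypothesis fU : findim U.
Hypothesis linT : \forall y \near x, linear (T y).

Lemma differentiable_plin : (forall b, differentiable (T ^~ b) x) ->
  differentiable u x -> differentiable (fun y => T y (u y)) x.
Proof.
have [N [e [c [lc ce]]]] := fU; move=> dT du.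
have : differentiable (\sum_i fun y => c i (u y) *: T y (e i)) x.
  apply: differentiable_sum => i; apply: differentiable_scale => //.
  apply: (differentiable_comp du); exact: clinear_differentiable.
apply: near_eq_differentiable; near=> y; rewrite fct_sumE.
rewrite {2}(ce (u y)) linear_sum_scale//.
by near: y.
Unshelve. all: by end_near. Qed.

Lemma derive_plin t : (forall b, differentiable (T ^~ b) x) ->
  differentiable u x ->
  'D_t (fun y => T y (u y)) x = 'D_t (T ^~ (u x)) x + T x ('D_t u x).
Proof.
have [N [e [c [lc ce]]]] := fU; move=> dT du.
have lT : linear (T x) := nbhs_singleton linT.
have dcu i : differentiable (c i \o u) x.
  apply: (differentiable_comp du); exact: clinear_differentiable.
have ds i : derivable (fun y => c i (u y) *: T y (e i)) x t.
  by apply: diff_derivable; exact: (differentiable_scale (dcu i) (dT (e i))).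
have ds' i : derivable (fun y => c i (u x) *: T y (e i)) x t.
  by apply: diff_derivable; apply: differentiable_scale => //;
     exact: differentiable_cst.
transitivity ('D_t (\sum_i fun y => c i (u y) *: T y (e i)) x).
  apply: near_eq_derive; near=> y; rewrite fct_sumE.
  rewrite {1}(ce (u y)) linear_sum_scale//.
  by near: y.
transitivity ('D_t (\sum_i fun y => c i (u x) *: T y (e i)) x
   + T x ('D_t u x)); last first.
  congr (_ + _); apply: near_eq_derive; near=> y; rewrite fct_sumE.
  rewrite [in RHS](ce (u x)) linear_sum_scale//.
  by near: y.
rewrite !derive_sum// {1}(ce ('D_t u x)) linear_sum_scale// -big_split /=.
apply: eq_bigr => i _.
rewrite (derive_scale _ (dcu i) (dT (e i))).
rewrite (derive_scale _ (differentiable_cst _ _) (dT (e i))).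
rewrite derive_cst scale0r addr0; congr (_ + _ *: _).
rewrite (derive_comp _ du (clinear_differentiable _ (lc i))).
by rewrite (clinear_derive _ _ (lc i)).
Unshelve. all: by end_near. Qed.

Lemma smooth_plin : (forall b, smooth_at (T ^~ b) x) ->
  smooth_at u x -> smooth_at (fun y => T y (u y)) x.
Proof.
have [N [e [c [lc ce]]]] := fU; move=> dT du.
have : smooth_at (fun y => \sum_i c i (u y) *: T y (e i)) x.
  apply: smooth_at_sum => i; apply: smooth_at_scale => //.
  exact: (smooth_at_clinear (lc i)).
apply: smooth_at_eq; near=> y.
rewrite {2}(ce (u y)) linear_sum_scale//.
by near: y.
Unshelve. all: by end_near. Qed.

End ParametricLinear.

Lemma smooth_at_derive_var {R : realType} (V W : normedModType R)
    (f : V -> W) (u : V -> V) x : findim V ->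
  smooth_at f x -> smooth_at u x -> smooth_at (fun y => 'D_(u y) f y) x.
Proof.
move=> fV sf su; apply: (@smooth_plin _ _ _ _ (fun y v => 'D_v f y)) => //.
  by near=> y; apply: derive_linear; apply: smooth_at_diff; near: y;
     exact: smooth_at_near.
by move=> b; exact: smooth_at_derive.
Unshelve. all: by end_near. Qed.

(** * Symmetry of second derivatives *)

Section SymmetryOfDerivatives.
Context {R : realType}.
Implicit Types (V W : normedModType R).

Lemma derive_line V W (f : V -> W) x v (s : R) :
  differentiable f (x + s *: v) ->
  is_derive s 1 (fun r : R => f (x + r *: v)) ('D_v f (x + s *: v)).
Proof.
move=> df; pose a (r : R) := x + r *: v.
have da : is_derive s 1 a v.
  have := @is_deriveD R R V (cst x) (fun r => r *: v) s 1 0 v _ _.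
  rewrite add0r; apply.
  apply: DeriveDef; first exact/derivable1_diffP.
  by rewrite deriveE// diff_val scale1r.
have daf : differentiable a s by apply/derivable1_diffP; apply: ex_derive.
apply: DeriveDef; first exact/derivable1_diffP/(differentiable_comp daf).
by rewrite (derive_comp _ daf df) derive_val.
Qed.

Lemma mean_value V (f : V -> R) x v (h : R) : 0 <= h ->
  (forall s, 0 <= s <= h -> differentiable f (x + s *: v)) ->
  exists2 s, 0 <= s <= h & f (x + h *: v) - f x = h * 'D_v f (x + s *: v).
Proof.
move=> h0 df.
have [||s sI fE] := @MVT_segment R (fun r => f (x + r *: v))
    (fun r => 'D_v f (x + r *: v)) 0 h h0.
- move=> s; rewrite in_itv /= => /andP[s0 sh]; apply: derive_line.
  by apply: df; rewrite !ltW.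
- apply: derivable_within_continuous => s; rewrite in_itv /= => sI.
  have ? := derive_line (df s sI); exact: ex_derive.
- exists s; first by move: sI; rewrite in_itv.
  by move: fE; rewrite scale0r addr0 subr0 mulrC.
Qed.

Lemma derive_translate V W (f : V -> W) x w v : differentiable f (x + w) ->
  'D_v (fun y => f (y + w)) x = 'D_v f (x + w).
Proof.
move=> df; have ds : is_diff x (fun y : V => y + w) id.
  exact: is_diff_eq (is_diffD (is_diff_id x) (is_diff_cst w x)) (addr0 _).
rewrite (derive_comp (f := fun y => y + w)) ?ex_diff//.
by congr ('D_ _ f _); rewrite deriveE ?ex_diff// diff_val.
Qed.

(** The mean value theorem, used along [u] for the difference of [f] and its translate by [h *: v],
    and then along [v] for ['D_u f]. *)
Lemma second_difference V (f : V -> R) x u v (h : R) : 0 <= h ->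
  (forall s t, 0 <= s <= h -> 0 <= t <= h ->
    smooth_at f (x + s *: u + t *: v)) ->
  exists s t, [/\ 0 <= s <= h, 0 <= t <= h &
   f (x + h *: u + h *: v) - f (x + h *: u) - (f (x + h *: v) - f x)
   = h * (h * 'D_v ('D_u f) (x + s *: u + t *: v))].
Proof.
move=> h0 sf; pose phi y := f (y + h *: v) - f y.
have hh : 0 <= h <= h by rewrite h0 lexx.
have h00 : 0 <= (0 : R) <= h by rewrite lexx h0.
have df s t : 0 <= s <= h -> 0 <= t <= h ->
    differentiable f (x + s *: u + t *: v).
  by move=> sI tI; apply: smooth_at_diff; exact: sf.
have dft s : 0 <= s <= h -> differentiable (fun y => f (y + h *: v)) (x + s *: u).
  move=> sI; apply: (@differentiable_comp _ _ _ _ (fun y => y + h *: v)).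
    by apply: differentiableD.
  exact: df.
have df0 s : 0 <= s <= h -> differentiable f (x + s *: u).
  by move=> sI; have := df s 0 sI h00; rewrite scale0r addr0.
have [|s sI sE] := @mean_value V phi x u h h0.
  by move=> s sI; apply: differentiableB; [exact: dft|exact: df0].
have dphi : 'D_u phi (x + s *: u)
    = 'D_u f (x + s *: u + h *: v) - 'D_u f (x + s *: u).
  rewrite (@deriveB _ _ _ (fun y => f (y + h *: v)) f).
  - by rewrite derive_translate//; exact: df.
  - exact: diff_derivable (dft s sI).
  - exact: diff_derivable (df0 s sI).
have [|t tI tE] := @mean_value V ('D_u f) (x + s *: u) v h h0.
  by move=> t tI; apply/smooth_at_diff/smooth_at_derive/sf.
by exists s, t; split=> //; rewrite -tE -dphi -sE /phi opprB addrA addrAC -!addrA.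
Qed.

Lemma second_difference_swap (a b c d : R) : a - b - c + d = a - b - (c - d).
Proof. by rewrite opprB addrA addrAC. Qed.

Lemma second_difference_swap' (a b c d : R) : a - b - c + d = a - c - (b - d).
Proof. by rewrite second_difference_swap !opprB !addrA; ring. Qed.

Lemma dist_half (a b c e : R) :
  `|a - c| < e / 2 -> `|b - c| < e / 2 -> `|b - a| <= e.
Proof.
move=> ac bc; rewrite -(subrKA c) (splitr e) (le_trans (ler_normD _ _))//.
by rewrite lerD ?(ltW bc)// distrC ltW.
Qed.

(** The second difference over a parallelogram is symmetric in [u] and [v], and it equals h^2 times
    either mixed derivative at some point of the parallelogram. Both derivatives are continuous at
    [x]. *)
Lemma derive_sym_real V (f : V -> R) x u v : smooth_at f x ->
  'D_u ('D_v f) x = 'D_v ('D_u f) x.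
Proof.
move=> sf; apply/eqP; rewrite -subr_eq0 -normr_le0; apply/ler_addgt0Pr => e e0.
rewrite add0r.
have near_line (P : V -> Prop) : (\forall y \near x, P y) ->
    exists2 d : R, 0 < d & forall (s t h : R), 0 <= s <= h -> 0 <= t <= h ->
     h < d -> P (x + s *: u + t *: v).
  move=> /nbhs_ballP[d /= d0 dP].
  exists (d / (`|u| + `|v| + 1)).
    by rewrite divr_gt0// ltr_wpDl// addr_ge0.
  move=> s t h /andP[s0 sh] /andP[t0 th].
  rewrite ltr_pdivlMr; last by rewrite ltr_wpDl// addr_ge0.
  move=> hd; apply: dP; rewrite -ball_normE /= -addrA opprD addrA subrr add0r.
  rewrite normrN; apply: le_lt_trans hd.
  rewrite (le_trans (ler_normD _ _))// !normrZ !ger0_norm//.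
  have h0 := le_trans s0 sh.
  rewrite !mulrDr mulr1 ler_wpDr// lerD// ler_wpM2r//.
have e2 : 0 < e / 2 by rewrite divr_gt0.
have /near_line[d1 d10 d1P] := smooth_at_near sf.
have /(smooth_at_cont (V:=V) (W:=R))/(@cvgrPdist_lt _ _)/(_ _ e2) :=
  smooth_at_derive u (smooth_at_derive v sf).
move=> /near_line[d2 d20 d2P].
have /(smooth_at_cont (V:=V) (W:=R))/(@cvgrPdist_lt _ _)/(_ _ e2) :=
  smooth_at_derive v (smooth_at_derive u sf).
move=> /near_line[d3 d30 d3P].
pose h := Num.min d1 (Num.min d2 d3) / 2.
have m0 : 0 < Num.min d1 (Num.min d2 d3) by rewrite !lt_min d10 d20 d30.
have h0 : 0 < h by rewrite divr_gt0.
have : h < Num.min d1 (Num.min d2 d3) by rewrite ltr_pdivrMr// ltr_pMr// ltr1n.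
rewrite !lt_min => /and3P[h1 h2 h3].
have [|s [t [sI tI st]]] := @second_difference V f x u v h (ltW h0).
  by move=> s t sI tI; exact: d1P sI tI h1.
have [|t' [s' [tI' sI' st']]] := @second_difference V f x v u h (ltW h0).
  move=> t' s' tI' sI'; rewrite addrAC; exact: d1P sI' tI' h1.
have {}st : f (x + h *: u + h *: v) - f (x + h *: u) - f (x + h *: v) + f x
    = h * (h * 'D_v ('D_u f) (x + s *: u + t *: v)).
  by rewrite -st; exact: second_difference_swap.
have {}st' : f (x + h *: u + h *: v) - f (x + h *: u) - f (x + h *: v) + f x
    = h * (h * 'D_u ('D_v f) (x + s' *: u + t' *: v)).
  have swap a b : x + a *: u + b *: v = x + b *: v + a *: u by rewrite addrAC.
  by rewrite !swap -st'; exact: second_difference_swap'.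
(* Cancelling [h] twice, the two mixed derivatives agree at two intermediate points, where each is
   within [e / 2] of its value at [x]. *)
have /(mulfI (lt0r_neq0 h0))/(mulfI (lt0r_neq0 h0)) E := etrans (esym st) st'.
have := d2P s' t' h sI' tI' h2; have := d3P s t h sI tI h3; rewrite E.
exact: dist_half.
Qed.

Lemma derive_sym V n (f : V -> 'rV[R]_n) x u v : smooth_at f x ->
  'D_u ('D_v f) x = 'D_v ('D_u f) x.
Proof.
move=> sf; apply/rowP => i.
have E w w' : ('D_w ('D_w' f) x) 0 i = 'D_w ('D_w' (fun y => f y 0 i)) x.
  rewrite derive_coord; last exact/smooth_at_diff/smooth_at_derive.
  apply: near_eq_derive; near=> y; rewrite derive_coord//.
  by apply: smooth_at_diff; near: y; exact: smooth_at_near.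
have H := derive_sym_real u v (smooth_at_coord i sf).
apply: etrans (E u v) _.
apply: etrans H _.
exact: esym (E v u).
Unshelve. all: by end_near. Qed.

End SymmetryOfDerivatives.

(** * Derivatives of functions that vanish on a zero set *)

Section ConstrainedDerivative.
Context {R : realType}.
Implicit Types (V W : normedModType R).

Lemma rV_norm_le n (x : 'rV[R]_n) (r : R) : 0 <= r ->
  (forall i, `|x 0 i| <= r) -> `|x| <= r.
Proof.
move=> r0 xr; rewrite [leLHS]/Num.norm/= mx_normrE.
by apply: bigmax_le => // -[i j] _ /=; rewrite ord1.
Qed.

Lemma rV_coord_le n (x : 'rV[R]_n) i : `|x 0 i| <= `|x|.
Proof.
rewrite [leRHS]/Num.norm/= mx_normrE.
exact: (le_bigmax _ (fun ij => `|x ij.1 ij.2|) (0, i)).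
Qed.

Lemma clinear_bound V W (f : V -> W) : clinear f ->
  exists2 C : R, 0 < C & forall x, `|f x| <= C * `|x|.
Proof.
move=> [lf cf]; pose fM := GRing.isLinear.Build _ _ _ _ f lf.
pose fL : {linear V -> W} := HB.pack f fM.
exact: (@linear_lipschitz _ _ _ fL).
Qed.

Lemma differentiable_coord_fun V n (f : V -> 'rV[R]_n) x i :
  differentiable f x -> differentiable (fun y => f y 0 i) x.
Proof.
move=> df; have lc := @clinear_coord R n i.
exact: (differentiable_comp df (clinear_differentiable _ lc)).
Qed.

Lemma near_diff V W (f : V -> W) x (e : R) : 0 < e -> differentiable f x ->
  \forall y \near x, `|f y - f x - 'd f x (y - x)| <= e * `|y - x|.
Proof.
move=> e0 /diff_locally/eqaddoP/(_ e e0); rewrite (near_shift 0 x) /= subr0.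
apply: filterS => h /=; rewrite !fctE addrK opprD addrA; exact.
Qed.

(** Convergence on the finitely many basis vectors gives convergence in operator norm. *)
Lemma near_linear_bound V W n (T : V -> 'rV[R]_n -> W) x (e : R) : 0 < e ->
  (\forall y \near x, linear (T y)) ->
  (forall b, {for x, continuous (T ^~ b)}) ->
  \forall y \near x, forall c, `|T x c - T y c| <= e * `|c|.
Proof.
move=> e0 lT cT; have lTx : linear (T x) := nbhs_singleton lT.
(* There are [n] error terms, each at most [d] times the norm of [c]; the successor keeps the
   divisor nonzero when [n = 0]. *)
pose d : R := e / n.+1%:R.
have d0 : 0 < d by rewrite divr_gt0.
have nT : \forall y \near x, forall i : 'I_n,
    `|T x (delta_mx 0 i) - T y (delta_mx 0 i)| < d.
  by apply: filter_forall => i; have /(@cvgrPdist_lt _ _) := cT (delta_mx 0 i);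
    exact.
near=> y.
have Ty i : `|T x (delta_mx 0 i) - T y (delta_mx 0 i)| < d.
  by move: i; near: y.
have lTy : linear (T y) by near: y.
move=> c; rewrite [c in X in `|X|]row_sum_delta.
rewrite (linear_sum_scale _ _ _ lTx) (linear_sum_scale _ _ _ lTy) -sumrB.
rewrite (le_trans (ler_norm_sum _ _ _))//.
have le_i (i : 'I_n) : `|c 0 i *: T x (delta_mx 0 i)
    - c 0 i *: T y (delta_mx 0 i)| <= `|c| * d.
  rewrite -scalerBr normrZ ler_pM//; first exact: rV_coord_le.
  exact: ltW.
rewrite (le_trans (ler_sum _ (fun i _ => le_i i)))//.
rewrite sumr_const card_ord -mulrnAr mulrC ler_wpM2r// -mulr_natr.
rewrite /d -mulrA ler_piMr ?(ltW e0)// mulrC ler_pdivrMr// mul1r.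
by rewrite ler_nat.
Unshelve. all: by end_near. Qed.

Lemma mean_value_norm V n (f : V -> 'rV[R]_n) x v (q : R) : 0 <= q ->
  (forall s : R, 0 <= s <= 1 -> differentiable f (x + s *: v)) ->
  (forall s : R, 0 <= s <= 1 -> `|'D_v f (x + s *: v)| <= q) ->
  `|f (x + v) - f x| <= q.
Proof.
move=> q0 df Df; apply: rV_norm_le => // i.
have [|s sI] := @mean_value R V (fun y => f y 0 i) x v 1 ler01.
  by move=> s sI; apply: (@differentiable_coord_fun _ _ f); exact: df.
rewrite scale1r mul1r -derive_coord; last exact: df.
by rewrite !mxE => ->; apply: le_trans (Df s sI); exact: rV_coord_le.
Qed.

(** The two bounds make [f] preserve the closed ball of radius [r], which is complete, so the Banach
    fixed point theorem applies there. *)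
Lemma fixed_point_ball n (f : 'rV[R]_n -> 'rV[R]_n) (r : R) : 0 <= r ->
  (forall c d, `|c| <= r -> `|d| <= r -> `|f c - f d| <= 2^-1 * `|c - d|) ->
  `|f 0| <= r / 2 -> exists2 c, `|c| <= r & f c = c.
Proof.
move=> r0 lf f0; pose U := [set c : 'rV[R]_n | `|c| <= r].
have fU : set_fun U U f.
  move=> c Uc; rewrite /U /=; rewrite -(subrK (f 0) (f c)).
  rewrite (le_trans (ler_normD _ _))// [r]splitr lerD//.
  have := lf c 0 Uc; rewrite normr0 subr0 => /(_ r0)/le_trans; apply.
  by rewrite mulrC; apply: ler_wpM2r; [rewrite invr_ge0|exact: Uc].
pose X : completeNormedModType R :=
  HB.pack_for (completeNormedModType R) 'rV[R]_n.
pose fM := isFun.Build X X U U f fU.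
pose fF : {fun U >-> U} := HB.pack f fM.
have ctr : is_contraction fF.
  have h0 : (0 : R) <= 2^-1 by rewrite invr_ge0.
  exists (NngNum h0); split=> /=; first by rewrite invf_lt1// ltr1n.
  by move=> [c d] [/= Uc Ud]; exact: lf.
have [||c Uc cE] := @banach_fixed_point R X U fF ctr; last by exists c.
  apply: (preimage_closed _ (@closed_le _ r)) => y _.
  exact: norm_continuous.
by exists 0; rewrite /U /= normr0.
Qed.

(* [F] need not be a submersion at [x]: its differential is only onto the      *)
(* image of the projection [p], and [F] takes values there. For small [t > 0]  *)
(* a contraction produces [c = o(t)] with [F (x + t *: u + K c) = 0]; dividing *)
(* [f (x + t *: u + K c) = 0] by [t] gives the claim.                          *)
Lemma constrained_derive V W n (F : V -> 'rV[R]_n) (K : 'rV[R]_n -> V)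
    (p : 'rV[R]_n -> 'rV[R]_n) (f : V -> W) x u :
  clinear K -> linear p -> smooth_at F x ->
  F x = 0 -> (\forall y \near x, p (F y) = F y) ->
  (forall c, 'D_(K c) F x = p c) ->
  differentiable f x -> (\forall y \near x, F y = 0 -> f y = 0) ->
  'D_u F x = 0 -> 'D_u f x = 0.
Proof.
move=> lK lp sF Fx0 pF DF df Ff DuF.
have dF := smooth_at_diff sF.
(* Differentiating [p \o F = F] along [K c] shows that [p] is idempotent. *)
have pp c : p (p c) = p c.
  rewrite -(DF c).
  have <- : 'D_(K c) (p \o F) x = p ('D_(K c) F x).
    have clp : clinear p by exact: findim_clinear (findim_rV n) lp.
    rewrite (derive_comp _ dF (clinear_differentiable _ clp)).
    by rewrite (clinear_derive _ _ clp).
  by apply: near_eq_derive; near=> y; near: y.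
(* Near [x] the derivative of [F] along [K c] is close to [p c]; this makes the map [psi] below a
   contraction with ratio one half. *)
have near_DF : \forall y \near x, forall c,
    `|p c - 'D_(K c) F y| <= 2^-1 * `|c|.
  have lT : \forall y \near x, linear (fun c => 'D_(K c) F y).
    apply: filterS (smooth_at_near sF) => y /smooth_at_diff dFy r c c'.
    by rewrite lK.1 deriveDr// deriveZr.
  have cT c : {for x, continuous ('D_(K c) F)}.
    by apply: smooth_at_cont; exact: smooth_at_derive.
  have h0 : (0 : R) < 2^-1 by rewrite invr_gt0.
  by apply: filterS (near_linear_bound h0 lT cT) => y + c; rewrite -DF; exact.
have [CK CK0 CKP] := clinear_bound lK.
have ldf : clinear ('d f x).
  by split=> [a v w|]; [rewrite linearP|exact: diff_continuous].
have [Cf Cf0 CfP] := clinear_bound ldf.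
have fx0 : f x = 0 by exact: (nbhs_singleton Ff).
apply/eqP; rewrite -normr_le0; apply/ler_addgt0Pr => e' e'0; rewrite add0r.
(* The error terms of the final estimate add up to [e * M * t]; the added 1 makes the divisor in [e]
   positive. *)
set M := `|u| + CK + Cf * CK.
have M0 : 0 < M + 1 by rewrite ltr_wpDl// !addr_ge0// ?mulr_ge0// ltW.
pose e := Num.min 1 (e' / (M + 1)).
have e0 : 0 < e by rewrite lt_min ltr01 divr_gt0.
have e1 : e <= 1 by rewrite ge_min lexx.
have eM : e * (M + 1) <= e'.
  by rewrite -ler_pdivlMr// ge_min lexx orbT.
have [t t0 [c cE]] : exists2 t : R, 0 < t & exists c, [/\ `|c| <= e * t,
    f (x + (t *: u + K c)) = 0 &
    `|f (x + (t *: u + K c)) - f x - 'd f x (t *: u + K c)|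
      <= e * `|t *: u + K c|].
  (* As [F x = 0] and ['D_u F x = 0], a first-order remainder with constant [d] bounds
     [F (x + t *: u)] by [e * t / 2], which is the bound on [psi 0] that the fixed point needs. *)
  pose d := e / (2 * (`|u| + 1)).
  have d0 : 0 < d by rewrite divr_gt0// mulr_gt0// ltr_wpDl.
  have : \forall y \near x, [/\ smooth_at F y,
      forall c, `|p c - 'D_(K c) F y| <= 2^-1 * `|c|,
      p (F y) = F y, F y = 0 -> f y = 0 &
      `|f y - f x - 'd f x (y - x)| <= e * `|y - x| /\
      `|F y - F x - 'd F x (y - x)| <= d * `|y - x|].
    near=> y; split; [| | | |split].
    - by near: y; exact: smooth_at_near.
    - by near: y.
    - by near: y.
    - by near: y.
    - by near: y; exact: near_diff.
    - by near: y; exact: near_diff.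
  move=> /nbhs_ballP[r /= r0 rP].
  pose t := r / (2 * (`|u| + CK + 1)).
  have N0 : 0 < `|u| + CK + 1 by rewrite ltr_wpDl// addr_ge0// ltW.
  have t0 : 0 < t by rewrite divr_gt0// mulr_gt0.
  have tr : t * (`|u| + CK + 1) < r.
    by rewrite /t invfM mulrA mulfVK ?gt_eqF// ltr_pdivrMr// ltr_pMr// ltr1n.
  have inball c : `|c| <= e * t -> ball x r (x + (t *: u + K c)).
    move=> ct; rewrite -ball_normE /= opprD addrA subrr add0r normrN.
    apply: le_lt_trans tr; rewrite (le_trans (ler_normD _ _))// normrZ gtr0_norm//.
    rewrite -addrA mulrDr lerD2l (le_trans (CKP c))// mulrDr mulr1 ler_wpDr ?(ltW t0)//.
    rewrite mulrC ler_wpM2r ?(ltW CK0)// (le_trans ct)//.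
    by rewrite ler_piMl// ltW.
  (* A fixed point [c] satisfies [F (x + (t *: u + K c)) = p c - c]. Applying [p], which fixes the
     left side and kills the right side, gives [F = 0] at this point. *)
  pose psi c := p c - F (x + (t *: u + K c)).
  have et0 : 0 <= e * t by rewrite mulr_ge0// ltW.
  have [||c cr cE] := @fixed_point_ball n psi (e * t) et0.
  - move=> c c' cr c'r; rewrite -{1}(subrK c' c) [c - c' + c']addrC.
    pose a (b : 'rV[R]_n) := x + (t *: u + K b).
    have seg s : 0 <= s <= 1 -> `|c' + s *: (c - c')| <= e * t.
      move=> /andP[s0 s1]; have -> : c' + s *: (c - c') = (1 - s) *: c' + s *: c.
        by rewrite scalerBl scale1r scalerBr addrA addrAC.
      have s1' : 0 <= 1 - s by rewrite subr_ge0.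
      rewrite (le_trans (ler_normD _ _))// !normrZ !ger0_norm//.
      have -> : e * t = (1 - s) * (e * t) + s * (e * t) by ring.
      by rewrite lerD// ler_wpM2l.
    have ca b : differentiable (fun=> x + t *: u : V) (b : 'rV[R]_n).
      exact: differentiable_cst.
    have dK b : differentiable K b by exact: clinear_differentiable.
    have aE : a = (fun=> x + t *: u) + K.
      by apply/funext => b; rewrite /a addrA.
    have da b : differentiable a b by rewrite aE; exact: differentiableD.
    have Da b w : 'D_w a b = K w.
      rewrite aE deriveD; [|exact: diff_derivable|exact: diff_derivable].
      by rewrite derive_cst add0r clinear_derive.
    have dFa b : `|b| <= e * t -> differentiable F (a b).
      by move=> /inball/rP[/smooth_at_diff].
    have dpsi b w : `|b| <= e * t ->
        differentiable psi b /\ 'D_w psi b = p w - 'D_(K w) F (a b).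
      move=> /dFa dFb; have clp : clinear p.
        by exact: findim_clinear (findim_rV n) lp.
      have dp := clinear_differentiable b clp.
      have dFab := differentiable_comp (da b) dFb.
      split; first exact: (differentiableB dp dFab).
      rewrite (@deriveB _ _ _ p (F \o a)); [|exact: diff_derivable..].
      by rewrite (clinear_derive _ _ clp) (derive_comp _ (da b) dFb) Da.
    apply: mean_value_norm => [|s sI|s sI]; first by rewrite mulr_ge0// invr_ge0.
      by have [] := dpsi _ 0 (seg s sI).
    have [_ ->] := dpsi _ (c - c') (seg s sI).
    by have [_ ->] := rP _ (inball _ (seg s sI)).
  - rewrite /psi (lin0 lp) (lin0 lK.1) sub0r normrN.
    have /inball/rP[_ _ _ _ [_]] : `|0 : 'rV[R]_n| <= e * t by rewrite normr0.
    rewrite (lin0 lK.1) addr0 [x + _]addrC addrK.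
    have -> : 'd F x (t *: u) = 0.
      by rewrite -(deriveE _ dF) (deriveZr _ _ dF) DuF scaler0.
    rewrite Fx0 !subr0 => /le_trans; apply.
    rewrite normrZ gtr0_norm//.
    have -> : d * (t * `|u|) = (e * t / 2) * ((`|u| + 1)^-1 * `|u|).
      by rewrite /d invfM; ring.
    by rewrite ler_piMr ?divr_ge0// mulrC ler_pdivrMr ?mul1r ?lerDl//.
  have [sFc _ pFc fFc [dfc dFc]] := rP _ (inball c cr).
  have Fc : F (x + (t *: u + K c)) = 0.
    have := congr1 p cE; rewrite /psi (linB lp) pp pFc => /eqP.
    by rewrite -subr_eq0 addrAC subrr add0r oppr_eq0 => /eqP.
  exists t => //; exists c; split=> //; first exact: fFc.
  by move: dfc; have -> : x + (t *: u + K c) - x = t *: u + K c by rewrite addrC addKr.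
move: cE => [ct fc0]; rewrite fc0 fx0 subrr sub0r normrN => dfc.
have tuK : `|t *: u + K c| <= t * (`|u| + CK).
  rewrite (le_trans (ler_normD _ _))// normrZ gtr0_norm// mulrDr lerD2l.
  rewrite (le_trans (CKP c))// mulrC ler_wpM2r ?(ltW CK0)// (le_trans ct)//.
  by rewrite ler_piMl// ltW.
(* Both terms of ['d f x (t *: u + K c) - 'd f x (K c)] are small compared to [t]: the first because
   [f] vanishes at both ends of the step, the second because [c] is. *)
have : t * `|'D_u f x| <= t * e'.
  have -> : t * `|'D_u f x| = `|t *: 'D_u f x| by rewrite normrZ gtr0_norm.
  have -> : t *: 'D_u f x = 'd f x (t *: u + K c) - 'd f x (K c).
    by rewrite linearD addrK linearZ deriveE.
  rewrite (le_trans (ler_normB _ _))//.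
  have h1 := le_trans dfc (ler_wpM2l (ltW e0) tuK).
  have h2 := le_trans (CfP (K c)) (ler_wpM2l (ltW Cf0) (le_trans (CKP c)
    (ler_wpM2l (ltW CK0) ct))).
  rewrite (le_trans (lerD h1 h2))// (le_trans _ (ler_wpM2l (ltW t0) eM))//.
  have -> : t * (e * (M + 1)) =
      e * (t * (`|u| + CK)) + Cf * (CK * (e * t)) + t * e by rewrite /M; ring.
  by rewrite lerDl mulr_ge0// ltW.
by rewrite ler_pM2l.
Unshelve. all: by end_near. Qed.

End ConstrainedDerivative.

(** * Bilinear product rules and derivatives of real functions *)

Section DerivativeRules.
Context {R : realType}.
Implicit Types U V W X : normedModType R.

Lemma derive_pbilin V U X W (T : V -> U -> X -> W) (a : V -> U) (b : V -> X)
    x t : findim U -> findim X ->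
  (\forall y \near x, forall v, linear (T y ^~ v)) ->
  (\forall y \near x, forall u, linear (T y u)) ->
  (forall u v, differentiable (fun y => T y u v) x) ->
  differentiable a x -> differentiable b x ->
  'D_t (fun y => T y (a y) (b y)) x = 'D_t (fun y => T y (a x) (b x)) x
    + T x ('D_t a x) (b x) + T x (a x) ('D_t b x).
Proof.
move=> fU fX lTl lTr dT da db.
have dTa v : differentiable (fun y => T y (a y) v) x.
  apply: (@differentiable_plin _ _ _ _ (fun y u => T y u v)) => //.
  by apply: filterS lTl => y; exact.
rewrite (@derive_plin _ _ _ _ (fun y v => T y (a y) v))//; last first.
  by apply: filterS lTr => y; exact.
rewrite (@derive_plin _ _ _ _ (fun y u => T y u (b x)))//.
by apply: filterS lTl => y; exact.
Qed.

Lemma smooth_pbilin V U X W (T : V -> U -> X -> W) (a : V -> U) (b : V -> X)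
    x : findim U -> findim X ->
  (\forall y \near x, forall v, linear (T y ^~ v)) ->
  (\forall y \near x, forall u, linear (T y u)) ->
  (forall u v, smooth_at (fun y => T y u v) x) ->
  smooth_at a x -> smooth_at b x -> smooth_at (fun y => T y (a y) (b y)) x.
Proof.
move=> fU fX lTl lTr dT da db.
apply: (@smooth_plin _ _ _ _ (fun y v => T y (a y) v)) => //.
  by apply: filterS lTr => y; exact.
move=> v; apply: (@smooth_plin _ _ _ _ (fun y u => T y u v)) => //.
by apply: filterS lTl => y; exact.
Qed.

Lemma derive_pair U V W (f : U -> V) (g : U -> W) x t :
  differentiable f x -> differentiable g x ->
  'D_t (fun y => (f y, g y)) x = ('D_t f x, 'D_t g x).
Proof.
move=> df dg; rewrite (deriveE _ (differentiable_pair df dg)).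
by rewrite (diff_pair df dg) (deriveE _ df) (deriveE _ dg).
Qed.

Lemma derive_opp V W (f : V -> W) x t : differentiable f x ->
  'D_t (fun y => - f y) x = - 'D_t f x.
Proof. by move=> df; exact: (deriveN (diff_derivable df)). Qed.

Lemma derive_add V W (f g : V -> W) x t : differentiable f x ->
  differentiable g x -> 'D_t (fun y => f y + g y) x = 'D_t f x + 'D_t g x.
Proof.
by move=> df dg; exact: (deriveD (diff_derivable df) (diff_derivable dg)).
Qed.

Lemma derive_sub V W (f g : V -> W) x t : differentiable f x ->
  differentiable g x -> 'D_t (fun y => f y - g y) x = 'D_t f x - 'D_t g x.
Proof.
by move=> df dg; exact: (deriveB (diff_derivable df) (diff_derivable dg)).
Qed.

End DerivativeRules.

(* ['D_v f x] with its type forced to be [R], so that the ring operations     *)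
(* applied to it are the ones of [R] and not those of a normed module; it is  *)
(* locked so that comparing two derivatives never unfolds them to limits.     *)
HB.lock Definition rderive {R : realType} {V : normedModType R} (f : V -> R)
  (x v : V) : R := 'D_v f x.

Section RealDerivativeRules.
Context {R : realType}.
Implicit Types U V W X : normedModType R.

Lemma rderiveD V (f : V -> R) x u v : differentiable f x ->
  rderive f x (u + v) = rderive f x u + rderive f x v.
Proof. rewrite rderive.unlock; exact: deriveDr. Qed.

Lemma rderiveZ V (f : V -> R) x r u : differentiable f x ->
  rderive f x (r *: u) = r * rderive f x u.
Proof. rewrite rderive.unlock; exact: deriveZr. Qed.

Lemma rderive_cst V x u (a : R) : rderive (fun _ : V => a) x u = 0.
Proof. rewrite rderive.unlock; exact: derive_cst. Qed.

Lemma rderive_scale V (f : V -> R) x (r : R) u : differentiable f x ->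
  rderive (fun y => r * f y) x u = r * rderive f x u.
Proof. by move=> df; rewrite rderive.unlock; exact: (@deriveZ R V R f r x u (diff_derivable df)). Qed.

Lemma rderive_sub V (f g : V -> R) x u : differentiable f x ->
  differentiable g x ->
  rderive (fun y => f y - g y) x u = rderive f x u - rderive g x u.
Proof.
by move=> df dg; rewrite rderive.unlock; exact: (@deriveB R V R f g x u (diff_derivable df)
  (diff_derivable dg)).
Qed.

Lemma rderive_mul V (f g : V -> R) x u : differentiable f x ->
  differentiable g x ->
  rderive (fun y => f y * g y) x u = f x * rderive g x u + rderive f x u * g x.
Proof. rewrite rderive.unlock; exact: derive_scale. Qed.

Lemma rderive_near V (f g : V -> R) x u : (\forall y \near x, f y = g y) ->
  rderive f x u = rderive g x u.
Proof. rewrite rderive.unlock; exact: near_eq_derive. Qed.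

Lemma rderive_comp U V (f : U -> V) (g : V -> R) x u :
  differentiable f x -> differentiable g (f x) ->
  rderive (fun y => g (f y)) x u = rderive g (f x) ('D_u f x).
Proof. rewrite rderive.unlock; exact: derive_comp. Qed.

Lemma smooth_rderive V (f : V -> R) x u :
  smooth_at f x -> smooth_at (fun y => rderive f y u) x.
Proof. rewrite rderive.unlock; exact: smooth_at_derive. Qed.

Lemma rderive_sym V (f : V -> R) x u v : smooth_at f x ->
  rderive (fun y => rderive f y v) x u = rderive (fun y => rderive f y u) x v.
Proof. rewrite rderive.unlock; exact: derive_sym_real. Qed.

Lemma rderive_plin V U (T : V -> U -> R) (u : V -> U) x t : findim U ->
  (\forall y \near x, linear (T y)) -> (forall b, differentiable (T ^~ b) x) ->
  differentiable u x ->
  rderive (fun y => T y (u y)) x t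
    = rderive (T ^~ (u x)) x t + T x ('D_t u x).
Proof. by move=> *; rewrite rderive.unlock; exact: derive_plin. Qed.

Lemma rderive_pbilin V U X (T : V -> U -> X -> R) (a : V -> U) (b : V -> X)
    x t : findim U -> findim X ->
  (\forall y \near x, forall v, linear (T y ^~ v)) ->
  (\forall y \near x, forall u, linear (T y u)) ->
  (forall u v, differentiable (fun y => T y u v) x) ->
  differentiable a x -> differentiable b x ->
  rderive (fun y => T y (a y) (b y)) x t
    = rderive (fun y => T y (a x) (b x)) x t
      + T x ('D_t a x) (b x) + T x (a x) ('D_t b x).
Proof. by move=> *; rewrite rderive.unlock; exact: derive_pbilin. Qed.

(** By symmetry of second derivatives, differentiating along [t] a derivative in the moving
    direction [u] amounts to differentiating ['D_t f] along [u x], plus the variation of [u]. *)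
Lemma rderive_along V (f : V -> R) (u : V -> V) x t : findim V ->
  smooth_at f x -> differentiable u x ->
  rderive (fun y => rderive f y (u y)) x t
    = rderive (fun y => rderive f y t) x (u x) + rderive f x ('D_t u x).
Proof.
move=> fV sf du.
apply: etrans (@rderive_plin _ _ (rderive f) u x t fV _ _ du) _.
- apply: filterS (smooth_at_near sf) => y /smooth_at_diff.
  by rewrite rderive.unlock; exact: derive_linear.
- by move=> b; exact/smooth_at_diff/smooth_rderive.
- by rewrite (rderive_sym t (u x) sf).
Qed.

End RealDerivativeRules.

(* [lform L z b] is [g_z(z.2, b)], see [gform_pos_hom].                        *)
HB.lock Definition lform {R : realType} {n : nat}
  (L : 'rV[R]_n * 'rV[R]_n -> R) (z : 'rV[R]_n * 'rV[R]_n) (b : 'rV[R]_n) : R :=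
  2^-1 * rderive L z (0, b).

(** The base part of half the differential of [L]. It depends on the chart; [bformE] gives its value
    in terms of [Gam]. *)
HB.lock Definition bform {R : realType} {n : nat}
  (L : 'rV[R]_n * 'rV[R]_n -> R) (z : 'rV[R]_n * 'rV[R]_n) (a : 'rV[R]_n) : R :=
  2^-1 * rderive L z (a, 0).

HB.lock Definition gform {R : realType} {n : nat}
  (L : 'rV[R]_n * 'rV[R]_n -> R) (z : 'rV[R]_n * 'rV[R]_n) (a b : 'rV[R]_n) :
  R := rderive (fun y => lform L y b) z (0, a).

(** Replaces forms and derivatives by variables, so that [ring] and [lra] never compare them up to
    conversion. *)
Ltac abstract_atoms :=
  repeat match goal with
  | |- context [gform ?L ?z ?a ?b] =>
      let s := fresh "s" in set s := (gform L z a b); clearbody s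
  | |- context [lform ?L ?z ?a] =>
      let s := fresh "s" in set s := (lform L z a); clearbody s
  | |- context [bform ?L ?z ?a] =>
      let s := fresh "s" in set s := (bform L z a); clearbody s
  | |- context [rderive ?f ?z ?a] =>
      let s := fresh "s" in set s := (rderive f z a); clearbody s
  end.
Ltac rring := abstract_atoms; ring.
Ltac rlra := abstract_atoms; intros; lra.

Section MetricForms.
Context {R : realType} {n : nat}.
Local Notation V := 'rV[R]_n.
Local Notation Z := (V * V)%type.

Lemma pair0D (a b : V) : (0, a + b) = (0, a) + (0, b) :> Z.
Proof. by rewrite -[RHS]/(_, _) addr0. Qed.

Lemma pair0Z (r : R) (a : V) : (0, r *: a) = r *: (0, a) :> Z.
Proof. by rewrite -[RHS]/(_, _) scaler0. Qed.

Variables (L : Z -> R) (z : Z).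
Hypothesis sL : smooth_at L z.

Lemma smooth_lform_at b : smooth_at (fun y => lform L y b) z.
Proof.
rewrite lform.unlock; apply: (@smooth_at_scaler R Z R).
exact: smooth_rderive.
Qed.

Lemma smooth_gform_at a b : smooth_at (fun y => gform L y a b) z.
Proof. by rewrite gform.unlock; apply: smooth_rderive; exact: smooth_lform_at. Qed.

Lemma gform_sym_at a b : gform L z a b = gform L z b a.
Proof.
have E u w : gform L z u w = 2^-1 * rderive (fun y => rderive L y (0, w)) z (0, u).
  have dL := smooth_at_diff (smooth_rderive (0, w) sL).
  by rewrite gform.unlock lform.unlock; exact: (rderive_scale 2^-1 (0, u) dL).
by rewrite !E (rderive_sym _ _ sL).
Qed.

Lemma gform_linl_at b : linear (gform L z ^~ b).
Proof.
move=> r a a'; have dl := smooth_at_diff (smooth_lform_at b).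
by rewrite gform.unlock pair0D pair0Z rderiveD// rderiveZ.
Qed.

Lemma gform_linr_at a : linear (gform L z a).
Proof. by move=> r b b'; rewrite !(gform_sym_at a) gform_linl_at. Qed.

End MetricForms.

(** * Pseudo-Finsler metrics in coordinates *)

Section LocalFinsler.
Context {R : realType} {n : nat}.
Local Notation V := 'rV[R]_n.
Local Notation Z := (V * V)%type.
Variables (O : set Z) (L : Z -> R) (Gam : Z -> V -> V -> V).

(* A point [z] is a tangent vector [z.2] at [z.1]. This is the horizontal lift *)
(* of [e] for the nonlinear connection of [Gam]: covariant derivatives are     *)
(* derivatives along it, corrected by [Gam].                                   *)
Definition hlift (z : Z) (e : V) : Z := (e, - Gam z e z.2).

(** The chart form of a pseudo-Finsler metric with its Levi-Civita-Chern connection.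
    Torsion-freeness is [lf_Gam_sym]; the vanishing of nabla g is [lf_metric], where the fibre
    correction of the covariant derivative is absorbed by [hlift]. *)
Record local_finsler : Prop := {
  lf_open : open O;
  lf_smooth : forall z, O z -> smooth_at L z;
  lf_conic : forall z (r : R), O z -> 0 < r -> O (z.1, r *: z.2);
  lf_homogeneous : forall z (r : R), O z -> 0 < r ->
    L (z.1, r *: z.2) = r ^+ 2 * L z;
  lf_nondegenerate : forall z a, O z -> (forall b, gform L z a b = 0) -> a = 0;
  lf_Gam_smooth : forall z a b, O z -> smooth_at (fun z => Gam z a b) z;
  lf_Gam_linl : forall z b, linear (Gam z ^~ b);
  lf_Gam_linr : forall z a, linear (Gam z a);
  lf_Gam_sym : forall z a b, O z -> Gam z a b = Gam z b a;
  lf_metric : forall z e a b, O z ->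
    rderive (fun z => gform L z a b) z (hlift z e)
      = gform L z (Gam z e a) b + gform L z a (Gam z e b)
}.

Hypothesis F : local_finsler.

Let findimV : findim V. Proof. exact: findim_rV. Qed.
Let findimZ : findim Z. Proof. exact: findim_prod. Qed.

Lemma lf_near z : O z -> \forall y \near z, O y.
Proof. by move=> Oz; apply: open_nbhs_nbhs; split=> //; exact: lf_open F. Qed.

Lemma smooth_lform z b : O z -> smooth_at (fun z => lform L z b) z.
Proof. by move=> Oz; exact: (smooth_lform_at (lf_smooth F Oz)). Qed.

Lemma smooth_gform z a b : O z -> smooth_at (fun z => gform L z a b) z.
Proof. by move=> Oz; exact: (smooth_gform_at (lf_smooth F Oz)). Qed.

Lemma diff_lform z b : O z -> differentiable (fun z => lform L z b) z.
Proof. by move=> Oz; apply: smooth_at_diff; exact: smooth_lform. Qed.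

Lemma diff_gform z a b : O z -> differentiable (fun z => gform L z a b) z.
Proof. by move=> Oz; apply: smooth_at_diff; exact: smooth_gform. Qed.

Lemma gform_sym z a b : O z -> gform L z a b = gform L z b a.
Proof. by move=> Oz; exact: (gform_sym_at (lf_smooth F Oz)). Qed.

Lemma lformD z a b : O z -> lform L z (a + b) = lform L z a + lform L z b.
Proof.
move=> Oz; have dL := smooth_at_diff (lf_smooth F Oz).
by rewrite lform.unlock pair0D rderiveD// mulrDr.
Qed.

Lemma lformZ z r a : O z -> lform L z (r *: a) = r * lform L z a.
Proof.
move=> Oz; have dL := smooth_at_diff (lf_smooth F Oz).
by rewrite lform.unlock pair0Z rderiveZ// mulrCA.
Qed.

Lemma lformN z a : O z -> lform L z (- a) = - lform L z a.
Proof. by move=> Oz; rewrite -scaleN1r lformZ// mulN1r. Qed.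

Lemma lformB z a b : O z -> lform L z (a - b) = lform L z a - lform L z b.
Proof. by move=> Oz; rewrite lformD// lformN. Qed.

Lemma lform_lin z : O z -> linear (lform L z).
Proof. by move=> Oz r a b; rewrite lformD// lformZ. Qed.

Lemma gformDl z a b c : O z ->
  gform L z (a + b) c = gform L z a c + gform L z b c.
Proof.
by move=> Oz; rewrite gform.unlock pair0D rderiveD//; exact: diff_lform.
Qed.

Lemma gformZl z r a c : O z -> gform L z (r *: a) c = r * gform L z a c.
Proof.
by move=> Oz; rewrite gform.unlock pair0Z rderiveZ//; exact: diff_lform.
Qed.

Lemma gformNl z a c : O z -> gform L z (- a) c = - gform L z a c.
Proof. by move=> Oz; rewrite -scaleN1r gformZl// mulN1r. Qed.

Lemma gformBl z a b c : O z -> gform L z (a - b) c = gform L z a c - gform L z b c.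
Proof. by move=> Oz; rewrite gformDl// gformNl. Qed.

Lemma gformDr z a b c : O z -> gform L z c (a + b) = gform L z c a + gform L z c b.
Proof. by move=> Oz; rewrite !(gform_sym c)// gformDl. Qed.

Lemma gformZr z r a c : O z -> gform L z c (r *: a) = r * gform L z c a.
Proof. by move=> Oz; rewrite !(gform_sym c)// gformZl. Qed.

Lemma gformNr z a c : O z -> gform L z c (- a) = - gform L z c a.
Proof. by move=> Oz; rewrite !(gform_sym c)// gformNl. Qed.

Lemma rderive_lform_fiber z a b :
  rderive (fun z => lform L z b) z (0, a) = gform L z a b.
Proof. by rewrite gform.unlock. Qed.

Lemma rderive_bform z a b : O z ->
  rderive (fun z => bform L z a) z (0, b)
    = rderive (fun z => lform L z b) z (a, 0).
Proof.
move=> Oz; have sL := lf_smooth F Oz; rewrite bform.unlock lform.unlock.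
have da := smooth_at_diff (smooth_rderive (a, 0) sL).
have db := smooth_at_diff (smooth_rderive (0, b) sL).
apply: etrans (rderive_scale 2^-1 (0, b) da) _.
apply: etrans _ (esym (rderive_scale 2^-1 (a, 0) db)).
exact: (congr1 ( *%R 2^-1) (rderive_sym _ _ sL)).
Qed.

Lemma rderive_lform z (u : Z -> V) t : O z -> differentiable u z ->
  rderive (fun z => lform L z (u z)) z t
    = rderive (fun y => lform L y (u z)) z t + lform L z ('D_t u z).
Proof.
move=> Oz du; apply: rderive_plin => //.
  by apply: filterS (lf_near Oz) => y; exact: lform_lin.
by move=> b; exact: diff_lform.
Qed.

Lemma rderive_gform z (u v : Z -> V) t : O z ->
  differentiable u z -> differentiable v z ->
  rderive (fun z => gform L z (u z) (v z)) z t
    = rderive (fun y => gform L y (u z) (v z)) z t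
      + gform L z ('D_t u z) (v z) + gform L z (u z) ('D_t v z).
Proof.
move=> Oz du dv; apply: rderive_pbilin => //.
- by apply: filterS (lf_near Oz) => y Oy c r a b; rewrite gformDl// gformZl.
- by apply: filterS (lf_near Oz) => y Oy c r a b; rewrite gformDr// gformZr.
- by move=> a b; exact: diff_gform.
Qed.

Lemma diff_Gam z a b : O z -> differentiable (fun z => Gam z a b) z.
Proof. by move=> Oz; apply: smooth_at_diff; exact: lf_Gam_smooth. Qed.

Lemma derive_Gam z (u v : Z -> V) t : O z ->
  differentiable u z -> differentiable v z ->
  'D_t (fun z => Gam z (u z) (v z)) z
    = 'D_t (fun y => Gam y (u z) (v z)) z
      + Gam z ('D_t u z) (v z) + Gam z (u z) ('D_t v z).
Proof.
move=> Oz du dv; apply: (@derive_pbilin R Z V V V Gam) => //.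
- by apply: filterS (lf_near Oz) => y _ b; exact: lf_Gam_linl.
- by apply: filterS (lf_near Oz) => y _ b; exact: lf_Gam_linr.
- by move=> a b; exact: diff_Gam.
Qed.

Lemma diff_snd (z : Z) : differentiable (snd : Z -> V) z.
Proof. exact/clinear_differentiable/clinear_snd. Qed.

Lemma derive_snd (z t : Z) : 'D_t (snd : Z -> V) z = t.2.
Proof. exact/clinear_derive/clinear_snd. Qed.

Lemma gform0l z a : O z -> gform L z 0 a = 0.
Proof. by move=> Oz; rewrite -(scale0r 0) gformZl// mul0r. Qed.

Lemma gform0r z a : O z -> gform L z a 0 = 0.
Proof. by move=> Oz; rewrite gform_sym// gform0l. Qed.

Lemma lform0 z : O z -> lform L z 0 = 0.
Proof. by move=> Oz; rewrite -(scale0r 0) lformZ// mul0r. Qed.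

(** Euler's relation: differentiate [L (z.1, r *: z.2) = r ^+ 2 * L z] in [r] at 1. *)
Lemma euler_homogeneous z : O z -> L z = lform L z z.2.
Proof.
move=> Oz; have dL := smooth_at_diff (lf_smooth F Oz).
have zE (r : R) : (z.1, 0) + r *: (0, z.2) = (z.1, r *: z.2) :> Z.
  by apply: (congr2 pair); rewrite /= ?scaler0 ?addr0 ?add0r.
have z1 : (z.1, 0) + 1 *: (0, z.2) = z :> Z.
  by rewrite zE scale1r -surjective_pairing.
have dLz : differentiable L ((z.1, 0) + 1 *: (0, z.2) : Z) by rewrite z1.
have := derive_val (is_derive := derive_line dLz); rewrite z1 => D1.
have D2 : rderive (fun r : R => L ((z.1, 0) + r *: (0, z.2) : Z)) 1 1
    = rderive (fun r : R => L z * (r * r)) 1 1.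
  apply: rderive_near; apply: filterS (lt_nbhsr ltr01) => r r0.
  by rewrite zE (lf_homogeneous F)// mulrC expr2.
have D3 : rderive (fun r : R => L z * (r * r)) 1 1 = L z * 2.
  have did : differentiable (fun r : R => r) (1 : R) by [].
  have d1 : rderive (fun r : R => r) 1 1 = 1.
    by rewrite rderive.unlock; exact: derive_id.
  rewrite rderive_scale; last exact: differentiable_scale.
  by rewrite rderive_mul// d1 !mulr1.
have D4 : rderive L z (0, z.2) = L z * 2 by rewrite -D3 -D2 rderive.unlock D1.
by rewrite lform.unlock D4 mulrCA mulVf ?mulr1.
Qed.

(** The fibre derivative of Euler's relation along [b] reads [2 * lform L z b = gform L z z.2 b +
    lform L z b]. *)
Lemma gform_pos_hom z b : O z -> gform L z z.2 b = lform L z b.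
Proof.
move=> Oz; have dL := smooth_at_diff (lf_smooth F Oz).
have : rderive L z (0, b) = rderive (fun z => lform L z z.2) z (0, b).
  by apply: rderive_near; apply: filterS (lf_near Oz) => y /euler_homogeneous.
rewrite (@rderive_lform z snd)//; last exact: diff_snd.
rewrite rderive_lform_fiber derive_snd /= gform_sym// => E.
have E2 : rderive L z (0, b) = 2 * lform L z b.
  by rewrite lform.unlock mulrA divff// mul1r.
have {E E2} : gform L z z.2 b + lform L z b = 2 * lform L z b by rewrite -E E2.
rlra.
Qed.

(** In the derivative of [gform L z z.2 a], the variation [- Gam z e z.2] of the vector part of the
    lift cancels the first term of [lf_metric]. *)
Lemma rderive_lform_hlift z e a : O z ->
  rderive (fun z => lform L z a) z (hlift z e) = lform L z (Gam z e a).
Proof.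
move=> Oz; rewrite -gform_pos_hom//.
have -> : rderive (fun z => lform L z a) z (hlift z e) =
    rderive (fun z => gform L z z.2 a) z (hlift z e).
  by apply: rderive_near; apply: filterS (lf_near Oz) => y /gform_pos_hom ->.
rewrite (@rderive_gform z snd (fun=> a))//; last first.
  exact: diff_snd.
rewrite (lf_metric F)// derive_snd derive_cst /= gformNl// gform0r//.
by rring.
Qed.

Lemma rderive_metric_hlift z e : O z -> rderive L z (hlift z e) = 0.
Proof.
move=> Oz.
have -> : rderive L z (hlift z e) = rderive (fun z => lform L z z.2) z (hlift z e).
  by apply: rderive_near; apply: filterS (lf_near Oz) => y /euler_homogeneous.
rewrite (@rderive_lform z snd)//; last exact: diff_snd.
by rewrite rderive_lform_hlift// derive_snd /= lformN// subrr.
Qed.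

Lemma pair_hlift z a b : (a, b) = hlift z a + (0, b + Gam z a z.2) :> Z.
Proof. by rewrite -[RHS]/(_, _) addr0 [b + _]addrC addKr. Qed.

Lemma rderive_metric z a b : O z ->
  rderive L z (a, b) = 2 * lform L z (b + Gam z a z.2).
Proof.
move=> Oz; have dL := smooth_at_diff (lf_smooth F Oz).
rewrite (pair_hlift z a b) rderiveD// rderive_metric_hlift// add0r.
by rewrite lform.unlock mulrA divff// mul1r.
Qed.

Lemma bformE z a : O z -> bform L z a = lform L z (Gam z a z.2).
Proof.
move=> Oz; rewrite bform.unlock rderive_metric// add0r mulrA mulVf//.
by rewrite mul1r.
Qed.

Lemma smooth_lform_comp z (u : Z -> V) : O z -> smooth_at u z ->
  smooth_at (fun y => lform L y (u y)) z.
Proof.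
move=> Oz su; apply: (@smooth_plin R V Z R (lform L)) => //.
- by apply: filterS (lf_near Oz) => y; exact: lform_lin.
- by move=> b; exact: smooth_lform.
Qed.

Lemma rderive_gform0 z t b : O z -> rderive (fun y => gform L y 0 b) z t = 0.
Proof.
move=> Oz; rewrite -(@rderive_cst R Z z t 0); apply: rderive_near.
by apply: filterS (lf_near Oz) => y Oy; exact: gform0l.
Qed.

Definition spray (z : Z) : V := Gam z z.2 z.2.

Lemma smooth_fst (z : Z) : smooth_at (fst : Z -> V) z.
Proof. exact/clinear_smooth/clinear_fst. Qed.

Lemma near_fst (z : Z) (Q : V -> Prop) : (\forall x \near z.1, Q x) ->
  \forall y \near z, Q y.1.
Proof. exact: (smooth_at_cont (smooth_fst z)). Qed.

Lemma smooth_snd (z : Z) : smooth_at (snd : Z -> V) z.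
Proof. exact/clinear_smooth/clinear_snd. Qed.

Lemma smooth_Gam z (u v : Z -> V) : O z -> smooth_at u z -> smooth_at v z ->
  smooth_at (fun z => Gam z (u z) (v z)) z.
Proof.
move=> Oz su sv; apply: (@smooth_pbilin R Z V V V Gam) => //.
- by apply: filterS (lf_near Oz) => y _ b; exact: lf_Gam_linl.
- by apply: filterS (lf_near Oz) => y _ b; exact: lf_Gam_linr.
- by move=> a b; exact: lf_Gam_smooth.
Qed.

Lemma smooth_spray z : O z -> smooth_at spray z.
Proof. by move=> Oz; apply: smooth_Gam => //; exact: smooth_snd. Qed.

Lemma diff_spray z : O z -> differentiable spray z.
Proof. by move=> Oz; apply: smooth_at_diff; exact: smooth_spray. Qed.

Lemma smooth_nonlinear_connection z e : O z ->
  smooth_at (fun z => Gam z e z.2) z.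
Proof.
move=> Oz; apply: smooth_Gam => //; first exact: smooth_at_cst.
exact: smooth_snd.
Qed.

Lemma derive_hlift_pos z t : O z ->
  differentiable (fun z => hlift z z.2) z /\
  'D_t (fun z => hlift z z.2) z = (t.2, - 'D_t spray z).
Proof.
move=> Oz; have ds := diff_spray Oz; have d2 := diff_snd z.
have dN : differentiable (fun z => - spray z) z by exact: differentiableN.
have dp := differentiable_pair d2 dN; split => //.
apply: etrans (derive_pair _ d2 dN) _.
by rewrite derive_snd (derive_opp _ ds).
Qed.

Lemma derive_hlift z e t : O z ->
  differentiable (fun z => hlift z e) z /\
  'D_t (fun z => hlift z e) z = (0, - 'D_t (fun z => Gam z e z.2) z).
Proof.
move=> Oz.
have dG : differentiable (fun z => Gam z e z.2) z.
  by apply: smooth_at_diff; exact: smooth_nonlinear_connection.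
have dN : differentiable (fun z => - Gam z e z.2) z by exact: differentiableN.
have dc : differentiable (fun=> e) z by exact: differentiable_cst.
have dp := differentiable_pair dc dN; split => //.
apply: etrans (derive_pair _ dc dN) _.
by rewrite derive_cst (derive_opp _ dG).
Qed.

(** The nonlinear connection is half the fibre derivative of the spray. Both sides of the identity
    [rderive (lform a) (hlift y y.2) = bform a] are differentiated along the fibre; exchanging
    derivatives and using [lf_metric] leaves a relation between products with an arbitrary [a]. *)
Lemma derive_spray_fiber z b : O z ->
  'D_((0, b) : Z) spray z = 2 *: Gam z b z.2.
Proof.
move=> Oz; apply/eqP; rewrite eq_sym -subr_eq0; apply/eqP.
apply: (lf_nondegenerate F Oz) => a.
have /(@rderive_near _ _ _ _ _ (0, b)) : \forall y \near z,
    rderive (fun z => lform L z a) y (hlift y y.2) = bform L y a.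
  apply: filterS (lf_near Oz) => y Oy.
  by rewrite rderive_lform_hlift// bformE// (lf_Gam_sym F).
have [dS DS] := derive_hlift_pos (0, b) Oz.
rewrite (rderive_along _ findimZ (smooth_lform a Oz) dS) DS rderive_bform//.
have -> : rderive (fun y => rderive (fun z => lform L z a) y (0, b)) z
    (hlift z z.2) = rderive (fun y => gform L y b a) z (hlift z z.2).
  by congr (rderive _ z _); apply/funext => y; exact: rderive_lform_fiber.
rewrite (lf_metric F)// (pair_hlift z b) /= (pair_hlift z a 0).
have dl c := diff_lform c Oz.
rewrite !rderiveD// !rderive_lform_hlift// !rderive_lform_fiber add0r.
rewrite (lf_Gam_sym F b a Oz) gformBl// gformDl// gformNl// gformZl//.
rewrite (lf_Gam_sym F z.2 b Oz) (lf_Gam_sym F z.2 a Oz) (gform_sym b)//.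
rlra.
Qed.

(** The arguments stand for fields constant in the chart. These commute, so there is no bracket
    term. *)
Definition curv (z : Z) (e h b : V) : V :=
  'D_(hlift z e) (fun z => Gam z h b) z + Gam z e (Gam z h b)
  - ('D_(hlift z h) (fun z => Gam z e b) z + Gam z h (Gam z e b)).

Lemma derive_nonlinear_connection z h t : O z ->
  'D_t (fun z => Gam z h z.2) z
    = 'D_t (fun z' => Gam z' h z.2) z + Gam z h t.2.
Proof.
move=> Oz; have dh : differentiable (fun=> h) z by exact: differentiable_cst.
rewrite (@derive_Gam z (fun=> h) snd)//; last exact: diff_snd.
by rewrite derive_cst derive_snd (lin0 (lf_Gam_linl F _ _)) addr0.
Qed.

(** Since [lform] is parallel, a product with it differentiates along lifts by [Gam] only. Two such
    derivatives commute up to the variation of the lifts themselves, a fibre vector given by the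
    curvature applied to [z.2]. *)
Lemma lform_curv z e h b : O z ->
  lform L z (curv z e h b) = - gform L z (curv z e h z.2) b.
Proof.
move=> Oz.
have A c c' : lform L z (Gam z c' (Gam z c b))
    + lform L z ('D_(hlift z c') (fun z => Gam z c b) z)
    = rderive (fun z' => rderive (fun z => lform L z b) z' (hlift z c')) z
        (hlift z c)
      - gform L z ('D_(hlift z c') (fun z' => Gam z' c z.2) z
          - Gam z c (Gam z c' z.2)) b.
  have [dX DX] := derive_hlift c (hlift z c') Oz.
  have := rderive_along (hlift z c') findimZ (smooth_lform b Oz) dX.
  rewrite DX derive_nonlinear_connection//= (linN (lf_Gam_linr F _ _)).
  rewrite rderive_lform_fiber gformNl// => <-.
  rewrite -rderive_lform_hlift// -(@rderive_lform z (fun z => Gam z c b))//.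
    by apply: rderive_near; apply: filterS (lf_near Oz) => y Oy;
      rewrite rderive_lform_hlift.
  exact: diff_Gam.
rewrite /curv lformB// !lformD//.
have := A e h; have := A h e.
rewrite (rderive_sym _ _ (smooth_lform b Oz)).
rewrite !gformBl// !gformDl//.
rlra.
Qed.

(** The Jacobi operator in terms of the spray and the nonlinear connection, the two objects that the
    submersion relates to those of the base. *)
Lemma curv_jacobi z x : O z -> curv z x z.2 z.2
  = 'D_(hlift z x) spray z + Gam z (Gam z x z.2) z.2
    - 'D_(hlift z z.2) (fun z => Gam z x z.2) z.
Proof.
move=> Oz; rewrite /curv derive_nonlinear_connection//=.
rewrite (@derive_Gam z snd snd)//; [|exact: diff_snd..].
rewrite derive_snd /= (linN (lf_Gam_linr F _ _)) (linN (lf_Gam_linl F _ _)).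
rewrite (linN (lf_Gam_linr F _ _)).
rewrite (lf_Gam_sym F (Gam z x z.2) z.2 Oz).
set a := 'D_ _ _ _; set b := 'D_ _ _ _; set c := Gam z z.2 _; set d := Gam z x _.
apply/rowP => i; rewrite !mxE; ring.
Qed.

End LocalFinsler.

(** * Submersions in coordinates *)

HB.lock Definition deriv1 {R : realType} {n m : nat}
  (f : 'rV[R]_n -> 'rV[R]_m) (x u : 'rV[R]_n) : 'rV[R]_m := 'D_u f x.

HB.lock Definition deriv2 {R : realType} {n m : nat}
  (f : 'rV[R]_n -> 'rV[R]_m) (x u v : 'rV[R]_n) : 'rV[R]_m :=
  'D_u (fun x => deriv1 f x v) x.

HB.lock Definition deriv3 {R : realType} {n m : nat}
  (f : 'rV[R]_n -> 'rV[R]_m) (x u v w : 'rV[R]_n) : 'rV[R]_m :=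
  'D_u (fun x => deriv2 f x v w) x.

(* The vertical part of the tautological field: it cuts out the horizontal    *)
(* vectors.                                                                   *)
HB.lock Definition vpart {R : realType} {n : nat}
  (P : 'rV[R]_n * 'rV[R]_n -> 'rV[R]_n -> 'rV[R]_n)
  (z : 'rV[R]_n * 'rV[R]_n) : 'rV[R]_n := P z z.2.

(* The failure of [sg] to map the spray of [Gam] to the spray of [Gam'].      *)
HB.lock Definition spray_diff {R : realType} {n m : nat}
  (sg : 'rV[R]_n -> 'rV[R]_m)
  (Gam : 'rV[R]_n * 'rV[R]_n -> 'rV[R]_n -> 'rV[R]_n -> 'rV[R]_n)
  (Gam' : 'rV[R]_m * 'rV[R]_m -> 'rV[R]_m -> 'rV[R]_m -> 'rV[R]_m)
  (z : 'rV[R]_n * 'rV[R]_n) : 'rV[R]_m :=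
  deriv2 sg z.1 z.2 z.2 + spray Gam' (sg z.1, deriv1 sg z.1 z.2)
  - deriv1 sg z.1 (spray Gam z).

(* At a horizontal [z], this is minus the O'Neill tensor [chi_e z.2], see      *)
(* [chi_lhor].                                                                 *)
HB.lock Definition vpart_cov {R : realType} {n : nat}
  (P : 'rV[R]_n * 'rV[R]_n -> 'rV[R]_n -> 'rV[R]_n)
  (Gam : 'rV[R]_n * 'rV[R]_n -> 'rV[R]_n -> 'rV[R]_n -> 'rV[R]_n)
  (z : 'rV[R]_n * 'rV[R]_n) (e : 'rV[R]_n) : 'rV[R]_n :=
  'D_(hlift Gam z e) (vpart P) z.

HB.lock Definition field_cov {R : realType} {n : nat}
  (Gam : 'rV[R]_n * 'rV[R]_n -> 'rV[R]_n -> 'rV[R]_n -> 'rV[R]_n)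
  (z : 'rV[R]_n * 'rV[R]_n) (e : 'rV[R]_n) (W : 'rV[R]_n -> 'rV[R]_n) :
  'rV[R]_n := 'D_e W z.1 + Gam z e (W z.1).

HB.lock Definition cov_local {R : realType} {n : nat}
  (Gam : 'rV[R]_n * 'rV[R]_n -> 'rV[R]_n -> 'rV[R]_n -> 'rV[R]_n)
  (z : 'rV[R]_n * 'rV[R]_n) (h : 'rV[R]_n)
  (X : 'rV[R]_n * 'rV[R]_n -> 'rV[R]_n) : 'rV[R]_n :=
  'D_(hlift Gam z h) X z + Gam z h (X z).

HB.lock Definition chi_local {R : realType} {n : nat}
  (P : 'rV[R]_n * 'rV[R]_n -> 'rV[R]_n -> 'rV[R]_n)
  (Gam : 'rV[R]_n * 'rV[R]_n -> 'rV[R]_n -> 'rV[R]_n -> 'rV[R]_n)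
  (z : 'rV[R]_n * 'rV[R]_n) (h e : 'rV[R]_n) : 'rV[R]_n :=
  P z (cov_local Gam z h (fun y => e - P y e))
  + (cov_local Gam z h (fun y => P y e)
     - P z (cov_local Gam z h (fun y => P y e))).

Lemma scale_add4 (R : pzRingType) (V : lmodType R) (a : R) (p q r s : V) :
  a *: p + q + (a *: r + s) = a *: (p + r) + (q + s).
Proof. by rewrite scalerDr addrACA. Qed.

Lemma scale_comb (R : pzRingType) (V : lmodType R) (a : R) (p q r s t u : V) :
  a *: p + q + (a *: r + s - (a *: t + u)) = a *: (p + (r - t)) + (q + (s - u)).
Proof.
by rewrite opprD [a *: r + s + _]addrACA -scalerBr [LHS]addrACA -scalerDr.
Qed.

Section LocalSubmersion.
Context {R : realType} {n m : nat}.
Local Notation V := 'rV[R]_n.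
Local Notation Z := (V * V)%type.
Local Notation V' := 'rV[R]_m.
Local Notation Z' := (V' * V')%type.
Variables (O : set Z) (L : Z -> R) (Gam : Z -> V -> V -> V).
Variables (O' : set Z') (L' : Z' -> R) (Gam' : Z' -> V' -> V' -> V').
Variables (sg : V -> V') (P : Z -> V -> V).

Local Notation dmap z := (deriv1 sg z.1).
Local Notation d2map z := (deriv2 sg z.1).
Definition tlift (z : Z) : Z' := (sg z.1, dmap z z.2).
(* Horizontality of the vector [z] itself; [ghor z b] below is that of another *)
(* vector [b] at the same point, for [g_z].                                    *)
Definition lhor (z : Z) : Prop := forall w, dmap z w = 0 -> lform L z w = 0.

(** The projection [P] is abstract here and is provided by [vproj]. The two metrics are related
    through [ls_horizontal] only. *)
Record local_submersion : Prop := {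
  ls_smooth : forall z, O z -> smooth_at sg z.1;
  ls_surjective : forall z u', O z -> exists u, dmap z u = u';
  ls_horizontal : forall z, O z -> lhor z -> O' (tlift z) /\ L z = L' (tlift z);
  ls_proj_smooth : forall z b, O z -> smooth_at (fun z => P z b) z;
  ls_proj_linear : forall z, linear (P z);
  ls_proj_vertical : forall z b, O z -> dmap z (P z b) = 0;
  ls_proj_orthogonal : forall z b w, O z -> dmap z w = 0 ->
    gform L z (P z b) w = gform L z b w;
  ls_nondegenerate : forall z w, O z -> dmap z w = 0 ->
    (forall w', dmap z w' = 0 -> gform L z w w' = 0) -> w = 0
}.

Hypotheses (F : local_finsler O L Gam) (F' : local_finsler O' L' Gam').
Hypothesis S : local_submersion.

Let findimV : findim V. Proof. exact: findim_rV. Qed.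
Let findimZ : findim Z. Proof. exact: findim_prod. Qed.

Lemma smooth_dmap z u : O z -> smooth_at (fun z => dmap z u) z.
Proof.
move=> Oz; apply: (@smooth_at_comp _ _ _ _ fst (fun x => deriv1 sg x u)) => //.
  exact: smooth_fst.
by rewrite deriv1.unlock; apply: smooth_at_derive; exact: ls_smooth.
Qed.

Lemma dmap_lin z : O z -> linear (dmap z).
Proof.
move=> Oz; rewrite deriv1.unlock.
by apply: derive_linear; apply/smooth_at_diff/(ls_smooth S).
Qed.

Lemma d2map_lin z u : O z -> linear (d2map z u).
Proof.
move=> Oz a b c; rewrite deriv2.unlock deriv1.unlock.
have sgz := ls_smooth S Oz.
have db := smooth_at_diff (smooth_at_derive b sgz).
have dc := smooth_at_diff (smooth_at_derive c sgz).
apply: etrans (near_eq_derive (g := fun x => a *: 'D_b sg x + 'D_c sg x) u _) _.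
  apply: filterS (smooth_at_near sgz) => x.
  by move=> /smooth_at_diff/derive_linear ->.
have dab : differentiable (fun x => a *: 'D_b sg x) z.1.
  exact: (differentiableZ a db).
rewrite (derive_add u dab dc); congr (_ + _).
exact: (deriveZ a (diff_derivable db)).
Qed.

Lemma d2map_sym z u v : O z -> d2map z u v = d2map z v u.
Proof.
by rewrite deriv2.unlock deriv1.unlock => /(ls_smooth S); exact: derive_sym.
Qed.

Lemma smooth_dmap_comp z (u : Z -> V) : O z -> smooth_at u z ->
  smooth_at (fun z => dmap z (u z)) z.
Proof.
move=> Oz su; apply: (@smooth_plin R V Z V' (fun z => dmap z)) => //.
  by apply: filterS (lf_near F Oz) => y; exact: dmap_lin.
by move=> b; exact: smooth_dmap.
Qed.

Lemma derive_dmap z (u : Z -> V) t : O z -> differentiable u z ->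
  'D_t (fun z => dmap z (u z)) z = d2map z t.1 (u z) + dmap z ('D_t u z).
Proof.
move=> Oz du.
have lT : \forall y \near z, linear (dmap y).
  by apply: filterS (lf_near F Oz) => y; exact: dmap_lin.
have dT b : differentiable (fun z => dmap z b) z.
  by apply: smooth_at_diff; exact: smooth_dmap.
rewrite (@derive_plin R V Z V' (fun z => dmap z) u z findimV lT t dT du).
by congr (_ + _); rewrite deriv2.unlock.
Qed.

Lemma smooth_tlift z : O z -> smooth_at tlift z.
Proof.
move=> Oz; apply: smooth_at_pair.
  by apply: (smooth_at_comp (f := fst)) (ls_smooth S Oz) => //; exact: smooth_fst.
by apply: smooth_dmap_comp => //; exact: smooth_snd.
Qed.

Lemma derive_tlift z t : O z ->
  'D_t tlift z = (dmap z t.1, d2map z t.1 z.2 + dmap z t.2).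
Proof.
move=> Oz.
have ds : differentiable (fun z : Z => sg z.1) z.
  apply: smooth_at_diff; apply: (smooth_at_comp (f := fst)) (ls_smooth S Oz) => //.
  exact: smooth_fst.
have d2 : differentiable (fun z : Z => dmap z z.2) z.
  by apply: smooth_at_diff; apply: smooth_dmap_comp => //; exact: smooth_snd.
apply: etrans (derive_pair t ds d2) _.
by rewrite (derive_dmap t Oz (diff_snd z)) derive_snd deriv1.unlock.
Qed.

Lemma proj_id z w : O z -> dmap z w = 0 -> P z w = w.
Proof.
move=> Oz vw; apply/eqP; rewrite -subr_eq0; apply/eqP.
have vP := ls_proj_vertical S w Oz.
apply: (ls_nondegenerate S Oz) => [|w' vw'].
  by rewrite (linB (dmap_lin Oz)) vP vw subrr.
by rewrite (gformBl F _ _ _ Oz) (ls_proj_orthogonal S)// subrr.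
Qed.

Lemma proj_unique z b c : O z -> dmap z c = 0 ->
  (forall w, dmap z w = 0 -> gform L z c w = gform L z b w) -> c = P z b.
Proof.
move=> Oz vc cb; apply/eqP; rewrite -subr_eq0; apply/eqP.
have vP := ls_proj_vertical S b Oz.
apply: (ls_nondegenerate S Oz) => [|w' vw'].
  by rewrite (linB (dmap_lin Oz)) vP vc subrr.
by rewrite (gformBl F _ _ _ Oz) (ls_proj_orthogonal S)// cb// subrr.
Qed.

Local Notation kvert := (vpart P).

Lemma smooth_proj z (u : Z -> V) : O z -> smooth_at u z ->
  smooth_at (fun z => P z (u z)) z.
Proof.
move=> Oz su; apply: (@smooth_plin R V Z V P) => //.
  by apply: filterS (lf_near F Oz) => y _; exact: ls_proj_linear.
by move=> b; exact: ls_proj_smooth.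
Qed.

Lemma smooth_kvert z : O z -> smooth_at kvert z.
Proof.
by move=> Oz; rewrite vpart.unlock; apply: smooth_proj => //; exact: smooth_snd.
Qed.

Lemma kvert_vertical z : O z -> dmap z (kvert z) = 0.
Proof. by rewrite vpart.unlock; exact: ls_proj_vertical. Qed.

Lemma gform_kvert z w : O z -> dmap z w = 0 ->
  gform L z (kvert z) w = lform L z w.
Proof.
move=> Oz vw; rewrite vpart.unlock (ls_proj_orthogonal S)//.
exact: (gform_pos_hom F).
Qed.

Lemma kvert_eq0 z : O z -> (kvert z = 0 <-> lhor z).
Proof.
move=> Oz; split=> [k0 w vw|hz]; first by rewrite -gform_kvert// k0 (gform0l F).
apply: (ls_nondegenerate S Oz); first exact: kvert_vertical.
by move=> w vw; rewrite gform_kvert//; exact: hz.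
Qed.

Definition vertical_field (z : Z) (W : V -> V) : Prop :=
  smooth_at W z.1 /\ \forall y \near z, dmap y (W y.1) = 0.

(** Freeze the fibre variable at [z.2] and project the constant field [w]. *)
Lemma vertical_field_ext z w : O z -> dmap z w = 0 ->
  exists2 W, vertical_field z W & W z.1 = w.
Proof.
move=> Oz vw; exists (fun x => P (x, z.2) w); last first.
  by rewrite -surjective_pairing; exact: proj_id.
have si x : smooth_at (fun x : V => (x, z.2) : Z) x.
  by apply: smooth_at_pair; [exact/clinear_smooth/clinear_id|exact: smooth_at_cst].
split.
  apply: (@smooth_at_comp _ _ _ _ (fun x => (x, z.2)) (fun y => P y w)) => //.
  by rewrite -surjective_pairing; exact: ls_proj_smooth.
have : \forall y \near z, O (y.1, z.2).
  have cz : {for z, continuous (fun y : Z => (y.1, z.2) : Z)}.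
    apply: (@continuous_comp _ _ _ fst (fun x : V => (x, z.2) : Z)).
      exact: (clinear_fst _ _).2.
    exact/smooth_at_cont/si.
  have nO : nbhs ((z.1, z.2) : Z) O.
    by rewrite -surjective_pairing; exact: (lf_near F Oz).
  exact: cz _ nO.
by apply: filterS => y Oy; exact: (ls_proj_vertical S w Oy).
Qed.

Lemma smooth_field z (W : V -> V) : smooth_at W z.1 ->
  smooth_at (fun y : Z => W y.1) z.
Proof.
move=> sW; apply: (smooth_at_comp (f := fst)) sW => //; exact: smooth_fst.
Qed.

Lemma derive_field z (W : V -> V) (t : Z) :
  'D_t (fun y : Z => W y.1) z = 'D_(t.1) W z.1.
Proof.
by [].
Qed.

Lemma derive_vertical z (u : Z -> V) t : O z -> differentiable u z ->
  (\forall y \near z, dmap y (u y) = 0) ->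
  d2map z t.1 (u z) + dmap z ('D_t u z) = 0.
Proof.
move=> Oz du vu; rewrite -(derive_dmap t Oz du).
transitivity ('D_t (fun _ : Z => 0 : V') z); last by rewrite derive_cst.
exact: near_eq_derive.
Qed.

Lemma derive_vertical0 z (u : Z -> V) t : O z -> differentiable u z ->
  (forall y, O y -> dmap y (u y) = 0) -> u z = 0 -> dmap z ('D_t u z) = 0.
Proof.
move=> Oz du vu u0; have vu' : \forall y \near z, dmap y (u y) = 0 by exact: filterS vu (lf_near F Oz).
have := derive_vertical t Oz du vu'.
by rewrite u0 (lin0 (d2map_lin _ Oz)) add0r.
Qed.

Lemma derive_kvert_vertical z t : O z -> lhor z -> dmap z ('D_t kvert z) = 0.
Proof.
move=> Oz hz; apply: (derive_vertical0 t Oz); last exact/kvert_eq0.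
- by apply: smooth_at_diff; exact: smooth_kvert.
- exact: kvert_vertical.
Qed.

(** Differentiate [gform L y (kvert y) (W y.1) = lform L y (W y.1)]. As [kvert] vanishes at [z],
    only its own derivative survives on the left. *)
Lemma gform_derive_kvert z t W : O z -> lhor z -> vertical_field z W ->
  gform L z ('D_t kvert z) (W z.1) = rderive (fun y => lform L y (W y.1)) z t.
Proof.
move=> Oz hz [sW vW]; have k0 := (kvert_eq0 Oz).2 hz.
have dk := smooth_at_diff (smooth_kvert Oz).
have dW := smooth_at_diff (smooth_field sW).
have := rderive_gform F t Oz dk dW.
rewrite k0 (gform0l F)// addr0.
rewrite (rderive_gform0 F _ _ Oz) add0r => <-; apply: rderive_near.
by apply: filterS2 (lf_near F Oz) vW => y Oy vWy; exact: gform_kvert.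
Qed.

Lemma derive_kvert_fiber z c : O z -> lhor z ->
  'D_((0, c) : Z) kvert z = P z c.
Proof.
move=> Oz hz; apply: proj_unique => //; first exact: derive_kvert_vertical.
move=> w vw; have [W [sW vW] <-] := vertical_field_ext Oz vw.
rewrite gform_derive_kvert//.
rewrite (rderive_lform F _ Oz (smooth_at_diff (smooth_field sW))).
rewrite rderive_lform_fiber derive_field//= derive0 (lform0 F)// addr0//.
Qed.

(** For [y] near [z] the operator [P z] is close to [P y], which is the identity on vertical vectors
    at [y]; so [P z] is injective on them. *)
Lemma proj_eq0_near z : O z ->
  \forall y \near z, P z (kvert y) = 0 -> kvert y = 0.
Proof.
move=> Oz.
have lP : \forall y \near z, linear (P y).
  by apply: filterS (lf_near F Oz) => y _; exact: ls_proj_linear.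
have cP b : {for z, continuous (fun y => P y b)}.
  by apply: smooth_at_cont; exact: ls_proj_smooth.
have h0 : (0 : R) < 2^-1 by rewrite invr_gt0.
apply: filterS2 (lf_near F Oz) (near_linear_bound h0 lP cP) => y Oy Py k0.
have := Py (kvert y); rewrite k0 sub0r normrN proj_id//; last first.
  exact: kvert_vertical.
move=> kle; apply/eqP; rewrite -normr_eq0 eq_le normr_ge0 andbT.
have : `|kvert y| - 2^-1 * `|kvert y| <= 0 by rewrite subr_le0.
by rewrite -{1}[`|kvert y|]mul1r -mulrBl pmulr_rle0// subr_gt0 invf_lt1// ltr1n.
Qed.

(** The vector ['D_t kvert z] is vertical and the fibre derivative of [kvert] is [P z], so
    [t - (0, 'D_t kvert z)] is in the kernel of the derivative of [kvert]. Then [constrained_derive]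
    applies along it. *)
Lemma tangent_derive (W : normedModType R) (f : Z -> W) z t : O z -> lhor z ->
  differentiable f z -> (\forall y \near z, lhor y -> f y = 0) ->
  'D_t f z = 'D_((0, 'D_t kvert z) : Z) f z.
Proof.
move=> Oz hz df f0; have k0 := (kvert_eq0 Oz).2 hz.
have lP := ls_proj_linear S z.
have clP : clinear (P z) by exact: findim_clinear.
have dk := smooth_at_diff (smooth_kvert Oz).
(* [kvert y] lies in a vertical space that moves with [y]. Composing with [P z] brings the values
   into a fixed space without changing the zeros near [z]. *)
pose G y := P z (kvert y).
have sG : smooth_at G z by apply: (smooth_at_clinear clP); exact: smooth_kvert.
have DG u : 'D_u G z = P z ('D_u kvert z).
  rewrite -[LHS]/('D_u (P z \o kvert) z).
  rewrite (derive_comp u dk (clinear_differentiable _ clP)).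
  by rewrite (clinear_derive _ _ clP).
have vk u := derive_kvert_vertical u Oz hz.
apply/eqP; rewrite -subr_eq0 -deriveBr//; apply/eqP.
have clK : clinear (fun c : V => (0, c) : Z).
  by apply: clinear_pair; [exact: clinear_cst0|exact: clinear_id].
apply: (constrained_derive clK lP sG) => //.
- by rewrite /G k0 (lin0 lP).
- apply: filterS (lf_near F Oz) => y _; rewrite /G.
  by rewrite proj_id//; exact: ls_proj_vertical.
- move=> c; rewrite DG derive_kvert_fiber// proj_id//.
  exact: ls_proj_vertical.
- apply: filterS3 (lf_near F Oz) f0 (proj_eq0_near Oz) => y Oy fy ky Gy0.
  by apply: fy; apply/kvert_eq0 => //; exact: ky.
- rewrite (deriveBr _ _ (smooth_at_diff sG)) !DG derive_kvert_fiber//.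
  by rewrite !proj_id ?subrr//; exact: ls_proj_vertical.
Qed.

Lemma rtangent_derive (f : Z -> R) z t : O z -> lhor z ->
  differentiable f z -> (\forall y \near z, lhor y -> f y = 0) ->
  rderive f z t = rderive f z (0, 'D_t kvert z).
Proof. by move=> *; rewrite rderive.unlock; exact: tangent_derive. Qed.

Lemma rtangent_derive_eq (f g : Z -> R) z t : O z -> lhor z ->
  differentiable f z -> differentiable g z ->
  (\forall y \near z, lhor y -> f y = g y) -> 'D_t kvert z = 0 ->
  rderive f z t = rderive g z t.
Proof.
move=> Oz hz df dg fg Dk.
have H := rtangent_derive t Oz hz (differentiableB df dg).
apply/eqP; rewrite -subr_eq0 -rderive_sub// H; last first.
  by apply: filterS fg => y fgy hy; rewrite /= fgy// subrr.
rewrite Dk rderive.unlock; apply/eqP; exact: derive0.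
Qed.

(** * Comparison of metrics and sprays at horizontal vectors *)

Lemma smooth_pullback z : O z -> lhor z -> smooth_at (fun y => L' (tlift y)) z.
Proof.
move=> Oz hz; have [Oz' _] := ls_horizontal S Oz hz.
apply: (smooth_at_comp (f := tlift)) (lf_smooth F' Oz').
  by apply: findim_prod; exact: findim_rV.
exact: smooth_tlift.
Qed.

Lemma rderive_pullback z t (f : Z' -> R) : O z ->
  differentiable f (tlift z) -> rderive (fun y => f (tlift y)) z t
  = rderive f (tlift z) (dmap z t.1, d2map z t.1 z.2 + dmap z t.2).
Proof.
move=> Oz df; have dt := smooth_at_diff (smooth_tlift Oz).
by rewrite (rderive_comp _ dt df) derive_tlift.
Qed.

(** The difference of [L] and the pulled back metric vanishes on horizontal vectors, so its
    derivative along [t] is the one along a vertical fibre vector. There [L] has zero derivative by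
    horizontality, and the pullback because [dmap z] kills vertical vectors. *)
Lemma metric_one_jet z t : O z -> lhor z ->
  rderive L z t
    = rderive L' (tlift z) (dmap z t.1, d2map z t.1 z.2 + dmap z t.2).
Proof.
move=> Oz hz; have [Oz' _] := ls_horizontal S Oz hz.
have dL := smooth_at_diff (lf_smooth F Oz).
have dL' := smooth_at_diff (lf_smooth F' Oz').
have dp := smooth_at_diff (smooth_pullback Oz hz).
rewrite -rderive_pullback//; apply/eqP; rewrite -subr_eq0 -rderive_sub//.
rewrite rtangent_derive//; [|exact: differentiableB|]; last first.
  apply: filterS (lf_near F Oz) => y Oy hy.
  by have [_ ->] := ls_horizontal S Oy hy; rewrite subrr.
have vk := derive_kvert_vertical t Oz hz.
rewrite rderive_sub// (rderive_metric F _ _ Oz) rderive_pullback//=.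
have dl0 : dmap z 0 = 0 by exact: lin0 (dmap_lin Oz).
rewrite (lin0 (lf_Gam_linl F _ _)) addr0 hz// mulr0 sub0r dl0 vk addr0.
rewrite d2map_sym// (lin0 (d2map_lin _ Oz)).
by rewrite rderive.unlock derive0 oppr0.
Qed.

Lemma lform_lhor z a : O z -> lhor z ->
  lform L z a = lform L' (tlift z) (dmap z a).
Proof.
move=> Oz hz; have := metric_one_jet (0, a) Oz hz.
have dl0 : dmap z 0 = 0 by exact: lin0 (dmap_lin Oz).
rewrite /= dl0 d2map_sym// (lin0 (d2map_lin _ Oz)) add0r lform.unlock.
by move=> ->.
Qed.

Lemma bform_lhor z a : O z -> lhor z ->
  bform L z a = bform L' (tlift z) (dmap z a)
    + lform L' (tlift z) (d2map z a z.2).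
Proof.
move=> Oz hz; have [Oz' _] := ls_horizontal S Oz hz.
have := metric_one_jet (a, 0) Oz hz.
have dl0 : dmap z 0 = 0 by exact: lin0 (dmap_lin Oz).
rewrite /= dl0 addr0 !(bform.unlock, lform.unlock) => ->.
rewrite -mulrDr -rderiveD; last exact/smooth_at_diff/(lf_smooth F').
by congr (_ * rderive _ _ _); rewrite -[RHS]/(_, _) addr0 add0r.
Qed.

Lemma vertical_field_derive z W u : O z -> vertical_field z W ->
  d2map z u (W z.1) + dmap z ('D_u W z.1) = 0.
Proof.
move=> Oz [sW vW].
have := derive_vertical (u, 0) Oz (smooth_at_diff (smooth_field sW)) vW.
by rewrite derive_field.
Qed.

(** Geodesics stay horizontal, infinitesimally. Tested on a vertical field, the derivative is
    [lform] of nabla_v W: its [Gam] part gives [d2map z w z.2] by [bform_lhor], and its other part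
    gives the opposite because the field stays vertical. *)
Lemma derive_kvert_spray z : O z -> lhor z -> 'D_(hlift Gam z z.2) kvert z = 0.
Proof.
move=> Oz hz; apply: (ls_nondegenerate S Oz); first exact: derive_kvert_vertical.
move=> w vw; have [W vW Ww] := vertical_field_ext Oz vw.
have [sW _] := vW; have [Oz' _] := ls_horizontal S Oz hz.
rewrite -Ww gform_derive_kvert//.
rewrite (rderive_lform F _ Oz (smooth_at_diff (smooth_field sW))) derive_field.
rewrite (rderive_lform_hlift F)// Ww (lf_Gam_sym F)// -(bformE F)// bform_lhor//.
rewrite vw lform_lhor// /=; have := vertical_field_derive z.2 Oz vW.
rewrite Ww addrC => /eqP; rewrite addr_eq0 => /eqP ->.
rewrite (d2map_sym w)// (lformN F')// addrK (bformE F')//.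
by rewrite (lin0 (lf_Gam_linl F' _ _)) (lform0 F').
Qed.

Definition ghor (z : Z) (b : V) : Prop :=
  forall w, dmap z w = 0 -> gform L z b w = 0.

Lemma proj_ghor z b : O z -> ghor z b -> P z b = 0.
Proof.
move=> Oz hb; apply/esym/proj_unique => // [|w vw].
  by rewrite (lin0 (dmap_lin Oz)).
by rewrite (gform0l F)// hb.
Qed.

Lemma ghor_proj z b : O z -> ghor z (b - P z b).
Proof.
by move=> Oz w vw; rewrite (gformBl F)// (ls_proj_orthogonal S)// subrr.
Qed.

Lemma d2map_linl z v : O z -> linear (d2map z ^~ v).
Proof.
by move=> Oz a u u'; rewrite !(d2map_sym _ v)// d2map_lin.
Qed.

Lemma dmap0 z : O z -> dmap z 0 = 0.
Proof. by move=> Oz; rewrite (lin0 (dmap_lin Oz)). Qed.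

Lemma tlift_near z : O z -> lhor z -> \forall y \near z, O' (tlift y).
Proof.
move=> Oz hz; have [Oz' _] := ls_horizontal S Oz hz.
exact: (smooth_at_cont (smooth_tlift Oz) (lf_near F' Oz')).
Qed.

Lemma rderive_lform_pullback z a t : O z -> lhor z ->
  differentiable (fun y => lform L' (tlift y) (dmap y a)) z /\
  rderive (fun y => lform L' (tlift y) (dmap y a)) z t
    = lform L' (tlift z) (Gam' (tlift z) (dmap z t.1) (dmap z a))
      + gform L' (tlift z) (d2map z t.1 z.2 + dmap z t.2
          + Gam' (tlift z) (dmap z t.1) (dmap z z.2)) (dmap z a)
      + lform L' (tlift z) (d2map z t.1 a).
Proof.
move=> Oz hz; have [Oz' _] := ls_horizontal S Oz hz.
have dt := smooth_at_diff (smooth_tlift Oz).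
have lT : \forall y \near z, linear (fun b => lform L' (tlift y) b).
  by apply: filterS (tlift_near Oz hz) => y; exact: (lform_lin F').
have dl b : differentiable (lform L' ^~ b) (tlift z) by exact: (diff_lform F').
have dT b : differentiable (fun y => lform L' (tlift y) b) z.
  exact: (differentiable_comp dt (dl b)).
have dda : differentiable (fun y => dmap y a) z.
  by apply: smooth_at_diff; exact: smooth_dmap.
split; first exact: (@differentiable_plin R V' Z R (fun y => lform L' (tlift y))
  (fun y => dmap y a) z (findim_rV m) lT dT dda).
rewrite (rderive_plin (T := fun y => lform L' (tlift y)) t (findim_rV m) lT dT dda).
rewrite (rderive_pullback t Oz (dl (dmap z a))).
have -> : 'D_t (fun y => dmap y a) z = d2map z t.1 a.
  have := @derive_dmap z (fun=> a) t Oz (differentiable_cst _ _).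
  by rewrite derive_cst dmap0// addr0.
rewrite (pair_hlift Gam' (tlift z) (dmap z t.1)) rderiveD//.
by rewrite (rderive_lform_hlift F')// rderive_lform_fiber.
Qed.

(** A horizontal [b] makes [(0, b)] tangent to the set of horizontal vectors, so [lform_lhor] may be
    differentiated along it. *)
Lemma gform_lhor z a b : O z -> lhor z -> ghor z b ->
  gform L z a b = gform L' (tlift z) (dmap z a) (dmap z b).
Proof.
move=> Oz hz hb; have [Oz' _] := ls_horizontal S Oz hz.
have [dg Dg] := rderive_lform_pullback a (0, b) Oz hz.
have Dk : 'D_((0, b) : Z) kvert z = 0 by rewrite derive_kvert_fiber// proj_ghor.
have dl := diff_lform F a Oz.
have fg : \forall y \near z, lhor y ->
    lform L y a = lform L' (tlift y) (dmap y a).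
  by apply: filterS (lf_near F Oz) => y Oy hy; exact: lform_lhor.
have := rtangent_derive_eq Oz hz dl dg fg Dk.
rewrite rderive_lform_fiber Dg /= dmap0// (lin0 (lf_Gam_linl F' _ _)).
rewrite (lin0 (lf_Gam_linl F' _ _)) !(lin0 (d2map_linl _ Oz)) (lform0 F')//.
by rewrite !add0r !addr0 => E; rewrite (gform_sym F)// E (gform_sym F').
Qed.

Local Notation spray_defect := (spray_diff sg Gam Gam').

(** Differentiating [lform_lhor] along the spray, which is tangent, shows that the defect is
    orthogonal to every [dmap z a]; these are all the vectors of the base. *)
Lemma spray_defect_lhor z : O z -> lhor z -> spray_defect z = 0.
Proof.
move=> Oz hz; have [Oz' _] := ls_horizontal S Oz hz.
apply: (lf_nondegenerate F' Oz') => u'; have [a <-] := ls_surjective S u' Oz.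
have [dg Dg] := rderive_lform_pullback a (hlift Gam z z.2) Oz hz.
have dl := diff_lform F a Oz.
have fg : \forall y \near z, lhor y ->
    lform L y a = lform L' (tlift y) (dmap y a).
  by apply: filterS (lf_near F Oz) => y Oy hy; exact: lform_lhor.
have := rtangent_derive_eq Oz hz dl dg fg (derive_kvert_spray Oz hz).
rewrite (rderive_lform_hlift F)// (lf_Gam_sym F)// -(bformE F)// bform_lhor//.
rewrite (bformE F')// Dg /= (lf_Gam_sym F' (dmap z a))// (d2map_sym a)//.
rewrite -/(spray Gam z) (linN (dmap_lin Oz)).
have -> : d2map z z.2 z.2 - dmap z (spray Gam z)
    + Gam' (tlift z) (dmap z z.2) (dmap z z.2) = spray_defect z.
  by rewrite spray_diff.unlock addrAC.
rlra.
Qed.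

(* The failure of [sg] to map one nonlinear connection to the other; at a      *)
(* horizontal [z] it is half of the fibre derivative of [spray_defect].        *)
Definition sff (z : Z) (b : V) : V' :=
  d2map z b z.2 + Gam' (tlift z) (dmap z b) (dmap z z.2) - dmap z (Gam z b z.2).

Lemma sff_lin z : O z -> linear (sff z).
Proof.
move=> Oz a b c; rewrite /sff (d2map_linl _ Oz) (dmap_lin Oz).
rewrite (lf_Gam_linl F) (lf_Gam_linl F') (dmap_lin Oz).
rewrite !scalerDr scalerN; apply/rowP => i; rewrite !mxE; ring.
Qed.

Local Notation d3map z := (deriv3 sg z.1).

Lemma smooth_d2map z u v : O z -> smooth_at (fun y => d2map y u v) z.
Proof.
move=> Oz; apply: (@smooth_at_comp _ _ _ _ fst (fun x => deriv2 sg x u v)) => //.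
  exact: smooth_fst.
rewrite deriv2.unlock deriv1.unlock.
by do 2!apply: smooth_at_derive; exact: ls_smooth.
Qed.

Lemma smooth_d2map_comp z (u v : Z -> V) : O z -> smooth_at u z ->
  smooth_at v z -> smooth_at (fun y => d2map y (u y) (v y)) z.
Proof.
move=> Oz su sv; apply: (@smooth_pbilin R Z V V V' (fun z => d2map z)) => //.
- by apply: filterS (lf_near F Oz) => y Oy b; exact: d2map_linl.
- by apply: filterS (lf_near F Oz) => y Oy b; exact: d2map_lin.
- by move=> a b; exact: smooth_d2map.
Qed.

Lemma derive_d2map z (u v : Z -> V) t : O z -> smooth_at u z ->
  smooth_at v z -> 'D_t (fun y => d2map y (u y) (v y)) z
  = d3map z t.1 (u z) (v z) + d2map z ('D_t u z) (v z)
    + d2map z (u z) ('D_t v z).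
Proof.
move=> Oz /smooth_at_diff du /smooth_at_diff dv.
apply: etrans (@derive_pbilin R Z V V V' (fun z => d2map z) u v z t _ _ _ _ _ du dv) _ => //.
- by apply: filterS (lf_near F Oz) => y Oy b; exact: d2map_linl.
- by apply: filterS (lf_near F Oz) => y Oy b; exact: d2map_lin.
- by move=> a b; apply: smooth_at_diff; exact: smooth_d2map.
- by rewrite deriv3.unlock.
Qed.

Lemma d3map_sym z u v w : O z -> d3map z u v w = d3map z v u w.
Proof.
move=> Oz; rewrite deriv3.unlock deriv2.unlock deriv1.unlock.
by apply: derive_sym; apply: smooth_at_derive; exact: ls_smooth.
Qed.

Lemma derive_spray_defect z t : O z -> lhor z ->
  smooth_at spray_defect z /\ 'D_t spray_defect z =
  d3map z t.1 z.2 z.2 + 2 *: d2map z t.2 z.2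
  + 'D_((dmap z t.1, d2map z t.1 z.2 + dmap z t.2) : Z') (spray Gam') (tlift z)
  - (d2map z t.1 (spray Gam z) + dmap z ('D_t (spray Gam) z)).
Proof.
move=> Oz hz; have [Oz' _] := ls_horizontal S Oz hz.
have st := smooth_tlift Oz; have ss := smooth_spray F Oz.
have ss' := smooth_spray F' Oz'.
have s1 : smooth_at (fun y : Z => d2map y y.2 y.2) z.
  by apply: smooth_d2map_comp => //; exact: smooth_snd.
have s2 : smooth_at (fun y => spray Gam' (tlift y)) z.
  apply: (smooth_at_comp (f := tlift)) ss' => //.
  by apply: findim_prod; exact: findim_rV.
have s3 : smooth_at (fun y => dmap y (spray Gam y)) z.
  exact: smooth_dmap_comp.
rewrite spray_diff.unlock.
split; first exact: (smooth_atB (smooth_atD s1 s2) s3).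
have d1 := smooth_at_diff s1; have d2 := smooth_at_diff s2.
have d3 := smooth_at_diff s3.
have H1 := derive_d2map t Oz (smooth_snd z) (smooth_snd z).
have H2 := derive_comp t (smooth_at_diff st) (smooth_at_diff ss').
have H3 := derive_dmap t Oz (smooth_at_diff ss).
apply: etrans (derive_sub t (smooth_at_diff (smooth_atD s1 s2)) d3) _.
apply: etrans (congr2 (fun a b => a - b) (derive_add t d1 d2) H3) _.
apply: (congr2 (fun a b => a - b)); last by [].
apply: etrans (congr2 +%R H1 H2) _.
rewrite (derive_tlift t Oz) derive_snd (d2map_sym z.2 t.2 Oz).
by rewrite scaler_nat mulr2n !addrA.
Qed.

Lemma derive_spray_defect_fiber z b : O z -> lhor z ->
  'D_((0, b) : Z) spray_defect z = 2 *: sff z b.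
Proof.
move=> Oz hz; have [Oz' _] := ls_horizontal S Oz hz.
rewrite (derive_spray_defect _ Oz hz).2 /= (derive_spray_fiber F)// dmap0//.
rewrite !(lin0 (d2map_linl _ Oz)) add0r (derive_spray_fiber F')//.
have -> : d3map z 0 z.2 z.2 = 0.
  rewrite deriv3.unlock derive0//.
by rewrite !add0r (linZ (dmap_lin Oz)) /sff scalerBr scalerDr.
Qed.

(** [(0, x)] is tangent to the set of horizontal vectors, where the spray defect vanishes. *)
Lemma sff_ghor z x : O z -> lhor z -> ghor z x -> sff z x = 0.
Proof.
move=> Oz hz hx.
have [sE _] := derive_spray_defect 0 Oz hz.
have E0 : \forall y \near z, lhor y -> spray_defect y = 0.
  by apply: filterS (lf_near F Oz) => y Oy; exact: spray_defect_lhor.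
have := tangent_derive ((0, x) : Z) Oz hz (smooth_at_diff sE) E0.
rewrite (derive_kvert_fiber x Oz hz) (proj_ghor Oz hx).
rewrite !(derive_spray_defect_fiber _ Oz hz) (lin0 (sff_lin Oz)) scaler0.
by move=> /eqP; rewrite scaler_eq0 pnatr_eq0 => /eqP.
Qed.

Lemma derive_spray_defect_tangent z t : O z -> lhor z ->
  'D_t kvert z = 0 -> 'D_t spray_defect z = 0.
Proof.
move=> Oz hz Dk.
have [sE _] := derive_spray_defect 0 Oz hz.
have E0 : \forall y \near z, lhor y -> spray_defect y = 0.
  by apply: filterS (lf_near F Oz) => y Oy; exact: spray_defect_lhor.
by rewrite (tangent_derive t Oz hz (smooth_at_diff sE) E0) Dk derive0.
Qed.

Lemma derive_kvert_tangent z e : O z -> lhor z ->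
  'D_(hlift Gam z e - (0, 'D_(hlift Gam z e) kvert z)) kvert z = 0.
Proof.
move=> Oz hz; have dk := smooth_at_diff (smooth_kvert Oz).
rewrite deriveBr// derive_kvert_fiber// proj_id ?subrr//.
exact: derive_kvert_vertical.
Qed.

(** * O'Neill tensors through derivatives of the vertical part *)

Local Notation alpha := (vpart_cov P Gam).
Local Notation cov_field := (field_cov Gam).

Lemma alpha_vertical z e : O z -> lhor z -> dmap z (alpha z e) = 0.
Proof. by rewrite vpart_cov.unlock; exact: derive_kvert_vertical. Qed.

Lemma gform_alpha z e W : O z -> lhor z -> vertical_field z W ->
  gform L z (alpha z e) (W z.1) = lform L z (cov_field z e W).
Proof.
move=> Oz hz vW; rewrite vpart_cov.unlock field_cov.unlock.
rewrite gform_derive_kvert//; have [sW _] := vW.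
rewrite (rderive_lform F _ Oz (smooth_at_diff (smooth_field sW))) derive_field.
by rewrite (rderive_lform_hlift F)// -(lformD F)// addrC.
Qed.

(** Symmetry of the second fundamental form of the fibres: the two products differ by [lform] of a
    bracket of vertical fields, which is vertical. *)
Lemma gform_alpha_sym z w w' : O z -> lhor z -> dmap z w = 0 ->
  dmap z w' = 0 -> gform L z (alpha z w) w' = gform L z (alpha z w') w.
Proof.
move=> Oz hz vw vw'.
have [W vW Ww] := vertical_field_ext Oz vw.
have [W' vW' Ww'] := vertical_field_ext Oz vw'.
have E1 := gform_alpha w Oz hz vW'; have E2 := gform_alpha w' Oz hz vW.
move: E1 E2; rewrite field_cov.unlock Ww Ww' !(lformD F _ _ Oz) => -> ->.
rewrite (lf_Gam_sym F w' w Oz); apply: (congr1 (+%R ^~ _)).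
have := vertical_field_derive w Oz vW'; have := vertical_field_derive w' Oz vW.
rewrite Ww Ww' (d2map_sym w w' Oz) !(lform_lhor _ Oz hz) => e1 e2.
by have /addrI -> := etrans e1 (esym e2).
Qed.

(* Vanishes on horizontal vectors; its derivatives along them are where the    *)
(* O'Neill tensors come from.                                                  *)
Definition vdefect (W : V -> V) (z : Z) : R := lform L z (cov_field z z.2 W).

Lemma near_field_linear (z : Z) (W : V -> V) : smooth_at W z.1 ->
  \forall y \near z, linear (fun v => 'D_v W y.1).
Proof.
move=> /smooth_at_near/near_fst; apply: filterS => y /smooth_at_diff.
exact: derive_linear.
Qed.

Lemma smooth_cov_field z W (u : Z -> V) : O z -> smooth_at W z.1 ->
  smooth_at u z -> smooth_at (fun y => cov_field y (u y) W) z.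
Proof.
move=> Oz sW su; rewrite field_cov.unlock; apply: smooth_atD; last first.
  by apply: (smooth_Gam F) => //; exact: smooth_field.
apply: (@smooth_plin R V Z V (fun z v => 'D_v W z.1)) => //.
- exact: near_field_linear.
- by move=> b; exact: (smooth_field (smooth_at_derive b sW)).
Qed.

Lemma vdefect_lhor z W : O z -> lhor z -> vertical_field z W ->
  vdefect W z = 0.
Proof.
move=> Oz hz vW; rewrite /vdefect -gform_alpha//.
by rewrite vpart_cov.unlock derive_kvert_spray// (gform0l F).
Qed.

Lemma vertical_field_near z W : vertical_field z W ->
  \forall y \near z, vertical_field y W.
Proof.
move=> [sW vW]; have [E [oE Ez EW]] := near_open vW.
have nE : \forall y \near z, E y by exact: open_nbhs_nbhs.
apply: filterS2 (near_fst (smooth_at_near sW)) nE => y sWy Ey; split=> //.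
by apply: filterS (open_nbhs_nbhs (conj oE Ey)) => y'; exact: EW.
Qed.

Lemma vdefect_smooth z W : O z -> vertical_field z W ->
  smooth_at (vdefect W) z.
Proof.
move=> Oz [sW _]; apply: (smooth_lform_comp F Oz).
by apply: smooth_cov_field => //; exact: smooth_snd.
Qed.

(** [vdefect W] is the derivative of [lform L y (W y.1)] along the spray. By [rderive_along] the
    fibre derivative moves inside, and the spray itself varies by [derive_spray_fiber]. *)
Lemma rderive_vdefect_fiber z W a : O z -> lhor z -> vertical_field z W ->
  rderive (vdefect W) z (0, a)
    = gform L z a (cov_field z z.2 W) + gform L z (alpha z a) (W z.1).
Proof.
move=> Oz hz vW; have [sW _] := vW.
have sWf : smooth_at (fun y : Z => W y.1) z by exact: smooth_field.
have sl := smooth_lform_comp F Oz sWf.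
have -> : rderive (vdefect W) z (0, a) = rderive (fun y =>
    rderive (fun y => lform L y (W y.1)) y (hlift Gam y y.2)) z (0, a).
  apply: rderive_near.
  apply: filterS2 (lf_near F Oz) (vertical_field_near vW) => y Oy [sWy _].
  rewrite (rderive_lform F _ Oy (smooth_at_diff (smooth_field sWy))).
  rewrite derive_field (rderive_lform_hlift F)// -(lformD F)// addrC.
  by rewrite /vdefect field_cov.unlock.
have [dS DS] := derive_hlift_pos F (0, a) Oz.
rewrite (rderive_along _ findimZ sl dS) DS (derive_spray_fiber F)//=.
have -> : rderive (fun y => rderive (fun y => lform L y (W y.1)) y (0, a)) z
    (hlift Gam z z.2)
    = rderive (fun y => gform L y a (W y.1)) z (hlift Gam z z.2).
  apply: rderive_near.
  apply: filterS2 (lf_near F Oz) (vertical_field_near vW) => y Oy [sWy _].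
  rewrite (rderive_lform F _ Oy (smooth_at_diff (smooth_field sWy))).
  by rewrite derive_field/= derive0 (lform0 F)// addr0 rderive_lform_fiber.
have dW := smooth_at_diff sWf.
rewrite (rderive_gform F _ Oz (differentiable_cst _ _) dW) derive_field.
rewrite derive_cst (gform0l F)// addr0 (lf_metric F)//.
rewrite (pair_hlift Gam z a) (rderiveD _ _ (smooth_at_diff sl)).
rewrite -gform_derive_kvert// (rderive_lform F _ Oz dW) derive_field /= derive0.
rewrite (lform0 F)// addr0 rderive_lform_fiber (gformDl F)// (gformNl F)//.
rewrite (gformZl F)// field_cov.unlock (gformDr F)// (lf_Gam_sym F a)//.
rewrite vpart_cov.unlock.
rlra.
Qed.

(** [vdefect W] vanishes on horizontal vectors, to which [(0, x)] is tangent. The resulting identity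
    relates A_v w to A_x v. *)
Lemma gform_alpha_ghor z W x : O z -> lhor z -> vertical_field z W ->
  ghor z x ->
  gform L z x (cov_field z z.2 W) = - gform L z (alpha z x) (W z.1).
Proof.
move=> Oz hz vW hx; have dv := smooth_at_diff (vdefect_smooth Oz vW).
have v0 : \forall y \near z, lhor y -> vdefect W y = 0.
  apply: filterS2 (lf_near F Oz) (vertical_field_near vW) => y Oy vWy hy.
  exact: vdefect_lhor.
have := rtangent_derive ((0, x) : Z) Oz hz dv v0.
rewrite derive_kvert_fiber// proj_ghor// rderive_vdefect_fiber//.
have -> : rderive (vdefect W) z (0, 0) = 0 by rewrite rderive.unlock derive0.
rlra.
Qed.

(** By [rtangent_derive] the lift of [e] may be replaced by the fibre vector [(0, alpha z e)], along
    which the derivative is known. *)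
Lemma rderive_vdefect_hlift z W e : O z -> lhor z -> vertical_field z W ->
  rderive (vdefect W) z (hlift Gam z e)
    = gform L z (alpha z e) (cov_field z z.2 W)
      + gform L z (alpha z (alpha z e)) (W z.1).
Proof.
move=> Oz hz vW; have dv := smooth_at_diff (vdefect_smooth Oz vW).
have v0 : \forall y \near z, lhor y -> vdefect W y = 0.
  apply: filterS2 (lf_near F Oz) (vertical_field_near vW) => y Oy vWy hy.
  exact: vdefect_lhor.
rewrite (rtangent_derive _ Oz hz dv v0) rderive_vdefect_fiber//.
by rewrite vpart_cov.unlock.
Qed.

Local Notation acov := (cov_local Gam).
Local Notation chi := (chi_local P Gam).

Lemma alphaD z a b : O z -> alpha z (a + b) = alpha z a + alpha z b.
Proof.
move=> Oz; rewrite vpart_cov.unlock -deriveDr; last first.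
  by apply: smooth_at_diff; exact: smooth_kvert.
congr ('D_ _ _ z); apply: (congr2 pair) => //=.
by rewrite (linD (lf_Gam_linl F _ _)) opprD.
Qed.

Lemma projD z a b : P z (a + b) = P z a + P z b.
Proof. exact: linD (ls_proj_linear S z) _ _. Qed.

Lemma projB z a b : P z (a - b) = P z a - P z b.
Proof. exact: linB (ls_proj_linear S z) _ _. Qed.

Lemma projK z b : O z -> P z (P z b) = P z b.
Proof. by move=> Oz; rewrite proj_id//; exact: ls_proj_vertical. Qed.

Lemma derive_proj z (u : Z -> V) t : O z -> differentiable u z ->
  'D_t (fun y => P y (u y)) z = 'D_t (fun y => P y (u z)) z + P z ('D_t u z).
Proof.
move=> Oz du; apply: (@derive_plin R V Z V P) => //.
- by apply: filterS (lf_near F Oz) => y _; exact: ls_proj_linear.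
- by move=> b; apply: smooth_at_diff; exact: ls_proj_smooth.
Qed.

Lemma derive_proj_vertical z W t : O z -> vertical_field z W ->
  'D_t (fun y => P y (W z.1)) z = 'D_(t.1) W z.1 - P z ('D_(t.1) W z.1).
Proof.
move=> Oz [sW vW].
have H := derive_proj t Oz (smooth_at_diff (smooth_field sW)).
rewrite derive_field in H.
apply/eqP; rewrite eq_sym subr_eq -H -derive_field; apply/eqP.
apply: near_eq_derive.
by apply: filterS2 (lf_near F Oz) vW => y Oy vWy; rewrite proj_id.
Qed.

Lemma chi_field z h W : O z -> vertical_field z W ->
  chi z h (W z.1) = cov_field z h W - P z (cov_field z h W).
Proof.
move=> Oz vW; have [sW vW1] := vW.
have Pw : P z (W z.1) = W z.1 by rewrite proj_id// (nbhs_singleton vW1).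
have dP : differentiable (fun y => P y (W z.1)) z.
  by apply: smooth_at_diff; exact: ls_proj_smooth.
have D1 := derive_proj_vertical (hlift Gam z h) Oz vW.
have D2 := derive_sub (hlift Gam z h) (differentiable_cst (W z.1) z) dP.
rewrite derive_cst sub0r D1 in D2.
have E1 : acov z h (fun y => P y (W z.1))
    = cov_field z h W - P z ('D_h W z.1).
  by rewrite cov_local.unlock D1 Pw field_cov.unlock addrAC.
have E2 : acov z h (fun y => W z.1 - P y (W z.1))
    = - ('D_h W z.1 - P z ('D_h W z.1)).
  by rewrite cov_local.unlock D2 Pw subrr (lin0 (lf_Gam_linr F _ _)) addr0.
rewrite chi_local.unlock E1 E2 (linN (ls_proj_linear S z)) !projB projK// subrr oppr0 add0r.
by rewrite opprB addrA subrK.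
Qed.

(** The vertical part of [z.2] is zero at [z] with vertical derivative, so the second term of [chi]
    vanishes. The first is minus the derivative of the vertical part of the tautological field,
    which is parallel. *)
Lemma chi_lhor z h : O z -> lhor z -> chi z h z.2 = - alpha z h.
Proof.
move=> Oz hz; have k0 := (kvert_eq0 Oz).2 hz.
have Pv : P z z.2 = 0 by rewrite -k0 vpart.unlock.
have dP b : differentiable (fun y => P y b) z.
  by apply: smooth_at_diff; exact: ls_proj_smooth.
set t := hlift Gam z h; set p := 'D_t (fun y => P y z.2) z.
have vp : dmap z p = 0.
  by apply: (derive_vertical0 t Oz (dP z.2)) => // y; exact: ls_proj_vertical.
have aE : alpha z h = p - P z (Gam z h z.2).
  have := derive_proj t Oz (diff_snd z); rewrite derive_snd.
  rewrite /t /= (linN (ls_proj_linear S z)) vpart_cov.unlock => <-.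
  by rewrite vpart.unlock.
have D2 := derive_sub t (differentiable_cst z.2 z) (dP z.2).
rewrite derive_cst sub0r -/p in D2.
rewrite chi_local.unlock cov_local.unlock -/t D2 -/p Pv subr0 (lin0 (lf_Gam_linr F _ _)) addr0.
rewrite projD (linN (ls_proj_linear S z)) proj_id// subrr addr0 aE opprB.
by rewrite addrC.
Qed.

Lemma gform_proj_sym z a b : O z -> gform L z (P z a) b = gform L z a (P z b).
Proof.
move=> Oz; have va := ls_proj_vertical S a Oz; have vb := ls_proj_vertical S b Oz.
rewrite (gform_sym F (P z a) b Oz) -(ls_proj_orthogonal S b Oz va).
by rewrite -(ls_proj_orthogonal S a Oz vb) (gform_sym F (P z a) (P z b) Oz).
Qed.

Lemma lform_proj z b : O z -> lhor z -> lform L z (P z b) = 0.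
Proof. by move=> Oz; apply; exact: ls_proj_vertical. Qed.

Lemma smooth_acov z (u : Z -> V) (X : Z -> V) : O z -> smooth_at u z ->
  smooth_at X z -> smooth_at (fun y => acov y (u y) X) z.
Proof.
move=> Oz su sX; rewrite cov_local.unlock; apply: smooth_atD; last exact: (smooth_Gam F).
apply: (@smooth_at_derive_var R Z V X (fun y => hlift Gam y (u y))) => //.
apply: smooth_at_pair => //; apply: smooth_atN; apply: (smooth_Gam F) => //.
exact: smooth_snd.
Qed.

Lemma lform_acov z h X : O z -> smooth_at X z ->
  lform L z (acov z h X) = rderive (fun y => lform L y (X y)) z (hlift Gam z h).
Proof.
move=> Oz sX; rewrite (rderive_lform F _ Oz (smooth_at_diff sX)).
by rewrite (rderive_lform_hlift F)// cov_local.unlock (lformD F)// addrC.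
Qed.

(** [lform] kills vertical vectors, so only the derivative of [P y e] counts. Its [lform] is
    [gform L y (kvert y) e], where only [kvert] contributes since it vanishes at [z]. *)
Lemma lform_chi z h e : O z -> lhor z ->
  lform L z (chi z h e) = gform L z (alpha z h) e.
Proof.
move=> Oz hz; have sP := ls_proj_smooth S e Oz.
rewrite chi_local.unlock (lformD F)// (lformB F)// !lform_proj// add0r subr0 lform_acov//.
have -> : rderive (fun y => lform L y (P y e)) z (hlift Gam z h)
    = rderive (fun y => gform L y (kvert y) e) z (hlift Gam z h).
  apply: rderive_near; apply: filterS (lf_near F Oz) => y Oy.
  rewrite -gform_kvert//; last exact: ls_proj_vertical.
  by rewrite -gform_proj_sym// proj_id//; exact: kvert_vertical.
have dk := smooth_at_diff (smooth_kvert Oz).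
rewrite (rderive_gform F _ Oz dk (differentiable_cst _ _)) derive_cst.
rewrite ((kvert_eq0 Oz).2 hz) (gform0l F)// addr0 vpart_cov.unlock.
by rewrite (rderive_gform0 F _ _ Oz) add0r.
Qed.

Lemma smooth_chi z (u : Z -> V) e : O z -> smooth_at u z ->
  smooth_at (fun y => chi y (u y) e) z.
Proof.
move=> Oz su; have sP := ls_proj_smooth S e Oz.
have s1 : smooth_at (fun y => acov y (u y) (fun y => e - P y e)) z.
  apply: smooth_acov => //; apply: smooth_atB => //; exact: smooth_at_cst.
have s2 : smooth_at (fun y => acov y (u y) (fun y => P y e)) z.
  exact: smooth_acov.
rewrite chi_local.unlock; apply: smooth_atD; first exact: smooth_proj.
by apply: smooth_atB => //; exact: smooth_proj.
Qed.

Lemma hlift_lin z : linear (hlift Gam z).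
Proof.
move=> a b c; apply: (congr2 pair) => //=.
by rewrite (lf_Gam_linl F) opprD scalerN.
Qed.

Lemma acov_linl z X : smooth_at X z -> linear (fun h => acov z h X).
Proof.
move=> /smooth_at_diff dX a b c; rewrite cov_local.unlock hlift_lin derive_linear//.
exact: etrans (congr1 (+%R _) (lf_Gam_linl F z (X z) a b c))
  (scale_add4 _ _ _ _ _).
Qed.

Lemma acov_linr z h a X Y : smooth_at X z -> smooth_at Y z ->
  acov z h (fun y => a *: X y + Y y) = a *: acov z h X + acov z h Y.
Proof.
move=> /smooth_at_diff dX /smooth_at_diff dY.
have daX : differentiable (fun y => a *: X y) z by exact: (differentiableZ a dX).
rewrite cov_local.unlock; apply: etrans _ (scale_add4 _ _ _ _ _).
apply: congr2 (lf_Gam_linr F z h a (X z) (Y z)).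
apply: etrans (derive_add _ daX dY) _; apply: (congr1 (+%R ^~ _)).
exact: (deriveZ a (diff_derivable dX)).
Qed.

Lemma chi_linl z e : O z -> linear (fun h => chi z h e).
Proof.
move=> Oz; have sP := ls_proj_smooth S e Oz.
have sQ : smooth_at (fun y => e - P y e) z.
  by apply: smooth_atB => //; exact: smooth_at_cst.
move=> a b c; rewrite chi_local.unlock (acov_linl sQ) (acov_linl sP) !(ls_proj_linear S z).
exact: scale_comb.
Qed.

Lemma chi_linr z h : O z -> linear (chi z h).
Proof.
move=> Oz a b c.
have sP e := ls_proj_smooth S e Oz.
have sQ e : smooth_at (fun y => e - P y e) z.
  by apply: smooth_atB => //; exact: smooth_at_cst.
have E1 : acov z h (fun y => P y (a *: b + c))
    = acov z h (fun y => a *: P y b + P y c).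
  by congr acov; apply/funext => y; exact: (ls_proj_linear S y).
have E2 : acov z h (fun y => a *: b + c - P y (a *: b + c))
    = acov z h (fun y => a *: (b - P y b) + (c - P y c)).
  congr acov; apply/funext => y; rewrite (ls_proj_linear S y) scalerBr opprD.
  by rewrite addrACA.
rewrite chi_local.unlock E1 E2 (acov_linr h a (sQ b) (sQ c)) (acov_linr h a (sP b) (sP c)).
by rewrite !(ls_proj_linear S z); apply/rowP => i; rewrite !mxE; ring.
Qed.

(** The derivative of [u] enters only through its horizontal part, to which [P z] is applied, and
    through its vertical part, whose vertical part is removed. *)
Lemma chi_tensorial z h (u : Z -> V) : O z -> smooth_at u z ->
  P z (acov z h (fun y => u y - P y (u y)))
  + (acov z h (fun y => P y (u y)) - P z (acov z h (fun y => P y (u y))))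
  = chi z h (u z).
Proof.
move=> Oz su; have du := smooth_at_diff su; set t := hlift Gam z h.
have dPu := smooth_at_diff (smooth_proj Oz su).
have dP := smooth_at_diff (ls_proj_smooth S (u z) Oz).
have D1 := derive_proj t Oz du.
have E1 : acov z h (fun y => P y (u y))
    = acov z h (fun y => P y (u z)) + P z ('D_t u z).
  by rewrite cov_local.unlock -/t D1 addrAC.
have E2 : acov z h (fun y => u y - P y (u y))
    = acov z h (fun y => u z - P y (u z)) + ('D_t u z - P z ('D_t u z)).
  rewrite cov_local.unlock -/t (derive_sub t du dPu) D1.
  rewrite (derive_sub t (differentiable_cst (u z) z) dP) derive_cst sub0r.
  by rewrite opprD addrCA [RHS]addrAC addrA.
rewrite chi_local.unlock E1 E2 !projD (linN (ls_proj_linear S z)) (projK _ Oz) subrr addr0.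
by rewrite opprD addrACA subrr addr0.
Qed.

Lemma derive_cov_field z W (u : Z -> V) t : O z -> smooth_at W z.1 ->
  smooth_at u z -> 'D_t (fun y => cov_field y (u y) W) z
  = ('D_(t.1) (fun x => 'D_(u z) W x) z.1 + 'D_('D_t u z) W z.1)
    + ('D_t (fun y => Gam y (u z) (W z.1)) z + Gam z ('D_t u z) (W z.1)
       + Gam z (u z) ('D_(t.1) W z.1)).
Proof.
move=> Oz sW su; rewrite field_cov.unlock.
have lD := near_field_linear sW.
have sD b : smooth_at (fun y : Z => 'D_b W y.1) z.
  exact: (smooth_field (smooth_at_derive b sW)).
have sWf := smooth_field sW.
have d1 : differentiable (fun y => 'D_(u y) W y.1) z.
  apply: smooth_at_diff.
  exact: (@smooth_plin R V Z V (fun z v => 'D_v W z.1)).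
have d2 : differentiable (fun y => Gam y (u y) (W y.1)) z.
  by apply: smooth_at_diff; exact: (smooth_Gam F).
apply: etrans (derive_add t d1 d2) _; apply: (congr2 +%R); last first.
  apply: etrans (derive_Gam F t Oz (smooth_at_diff su) (smooth_at_diff sWf)) _.
  by rewrite derive_field.
apply: etrans (@derive_plin R V Z V (fun y v => 'D_v W y.1) u z findimV lD
  t (fun b => smooth_at_diff (sD b)) (smooth_at_diff su)) _.
by rewrite (derive_field z ('D_(u z) W) t).
Qed.

(** The curvature is evaluated with the tautological field in the place of an extension of [z.2]. As
    it is parallel, its bracket with [W] is nabla_v W, whence the last term. *)
Lemma curv_field z W : O z -> smooth_at W z.1 ->
  curv Gam z z.2 (W z.1) (W z.1)
  = acov z z.2 (fun y => cov_field y (W y.1) W)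
    - acov z (W z.1) (fun y => cov_field y y.2 W)
    - cov_field z (cov_field z z.2 W) W.
Proof.
move=> Oz sW; set w := W z.1; have sWf := smooth_field sW.
have dW := smooth_at_diff sW.
rewrite /curv cov_local.unlock (derive_cov_field _ Oz sW sWf).
rewrite (derive_cov_field _ Oz sW (smooth_snd z)) derive_field derive_snd.
rewrite field_cov.unlock -/w /=.
rewrite (@derive_sym R V n W z.1 z.2 w sW).
set D2 := 'D_w _ _; set Dv := 'D_(z.2) W z.1; set Dw := 'D_w W z.1.
set G1 := 'D_(hlift Gam z z.2) _ z; set G2 := 'D_(hlift Gam z w) _ z.
rewrite (deriveNr _ dW) (deriveDr _ _ dW) (lf_Gam_sym F w z.2 Oz).
set DG := 'D_(Gam z z.2 w) W z.1; set DD := 'D_Dv W z.1.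
rewrite !(linD (lf_Gam_linr F _ _)) !(linD (lf_Gam_linl F _ _)).
rewrite !(linN (lf_Gam_linl F _ _)).
set a := Gam z z.2 (Gam _ _ _); set b := Gam z w (Gam _ _ _).
set c := Gam z (Gam z z.2 w) w; set d := Gam z Dv w; set e := Gam z w Dv.
set f := Gam z z.2 Dw.
move: D2 DG DD a b c d e f G1 G2 => D2 DG DD a b c d e f G1 G2.
apply/rowP => i; rewrite !mxE; ring.
Qed.

(** * Curvature of vertical and horizontal planes *)

Definition oneill_T (z : Z) (b e : V) : V := chi z (P z b) e.
Definition oneill_A (z : Z) (b e : V) : V := chi z (b - P z b) e.

Definition cov_T (z : Z) (e a b : V) : V :=
  acov z e (fun y => oneill_T y a b)
  - oneill_T z (Gam z e a) b - oneill_T z a (Gam z e b).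

Lemma smooth_oneill_T z a b : O z -> smooth_at (fun y => oneill_T y a b) z.
Proof. by move=> Oz; apply: smooth_chi => //; exact: ls_proj_smooth. Qed.

Lemma oneill_T_linl z b : O z -> linear (oneill_T z ^~ b).
Proof.
move=> Oz r a c; rewrite /oneill_T (ls_proj_linear S z); exact: chi_linl.
Qed.

Lemma oneill_T_linr z a : O z -> linear (oneill_T z a).
Proof. by move=> Oz; exact: chi_linr. Qed.

Lemma rderive_lform_oneill_T z t (a b : Z -> V) : O z ->
  smooth_at a z -> smooth_at b z ->
  differentiable (fun y => lform L y (oneill_T y (a y) (b y))) z /\
  rderive (fun y => lform L y (oneill_T y (a y) (b y))) z t
  = rderive (fun y => lform L y (oneill_T y (a z) (b z))) z t
    + lform L z (oneill_T z ('D_t a z) (b z))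
    + lform L z (oneill_T z (a z) ('D_t b z)).
Proof.
move=> Oz sa sb.
have ll : \forall y \near z, forall v,
    linear (fun u => lform L y (oneill_T y u v)).
  apply: filterS (lf_near F Oz) => y Oy v r c d.
  by rewrite (oneill_T_linl v Oy) (lform_lin F Oy).
have lr : \forall y \near z, forall u,
    linear (fun v => lform L y (oneill_T y u v)).
  apply: filterS (lf_near F Oz) => y Oy v r c d.
  by rewrite (oneill_T_linr v Oy) (lform_lin F Oy).
have sT u v := smooth_lform_comp F Oz (smooth_oneill_T u v Oz).
split.
  apply: smooth_at_diff.
  exact: (@smooth_pbilin R Z V V R (fun y u v => lform L y (oneill_T y u v))).
exact: (@rderive_pbilin R Z V V (fun y u v => lform L y (oneill_T y u v)) a b
  z t findimV findimV ll lr (fun u v => smooth_at_diff (sT u v))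
  (smooth_at_diff sa) (smooth_at_diff sb)).
Qed.

(** On horizontal vectors T_W W and nabla_W W have the same product with the position vector, hence
    the same derivative along the spray, which is tangent. The other two terms come from the product
    rule for T. *)
Lemma lform_cov_T z W : O z -> lhor z -> vertical_field z W ->
  lform L z (cov_T z z.2 (W z.1) (W z.1))
  = rderive (fun y => lform L y (cov_field y (W y.1) W)) z (hlift Gam z z.2)
    - gform L z (alpha z (P z (cov_field z z.2 W))) (W z.1)
    - gform L z (alpha z (W z.1)) (cov_field z z.2 W).
Proof.
move=> Oz hz vW; have [sW vW1] := vW; have sWf := smooth_field sW.
set w := W z.1; set b := cov_field z z.2 W; set Sp := hlift Gam z z.2.
have Pw : P z w = w by rewrite proj_id// (nbhs_singleton vW1).
have [dT DT] := rderive_lform_oneill_T Sp Oz sWf sWf.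
have sC : smooth_at (fun y => cov_field y (W y.1) W) z by exact: smooth_cov_field.
have dC := smooth_at_diff (smooth_lform_comp F Oz sC).
have TC : \forall y \near z, lhor y ->
    lform L y (oneill_T y (W y.1) (W y.1))
    = lform L y (cov_field y (W y.1) W).
  apply: filterS2 (lf_near F Oz) (vertical_field_near vW) => y Oy vWy hy.
  have [_ vWy1] := vWy.
  rewrite /oneill_T proj_id//; last exact: (nbhs_singleton vWy1).
  by rewrite lform_chi// gform_alpha.
have E := rtangent_derive_eq Oz hz dT dC TC (derive_kvert_spray Oz hz).
rewrite -/Sp DT derive_field -/w in E.
have bE : b = 'D_(z.2) W z.1 + Gam z z.2 w by rewrite /b field_cov.unlock.
have lc c : lform L z (oneill_T z c w) = gform L z (alpha z (P z c)) w.
  by rewrite /oneill_T lform_chi.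
have rc c : lform L z (oneill_T z w c) = gform L z (alpha z w) c.
  by rewrite /oneill_T lform_chi// Pw.
rewrite /cov_T !(lformB F)// (lform_acov _ Oz (smooth_oneill_T _ _ Oz)) -E.
rewrite -/Sp bE !lc !rc projD (alphaD _ _ Oz) (gformDl F)// (gformDr F)//.
rewrite /Sp /=.
rlra.
Qed.

Lemma vertical_curvature z w : O z -> lhor z -> dmap z w = 0 ->
  lform L z (curv Gam z z.2 w w)
  = lform L z (cov_T z z.2 w w)
    + gform L z (oneill_A z z.2 w) (oneill_A z z.2 w)
    - gform L z (oneill_T z w z.2) (oneill_T z w z.2).
Proof.
move=> Oz hz vw; have [W vW Ww] := vertical_field_ext Oz vw.
have [sW _] := vW; have sWf := smooth_field sW.
have k0 := (kvert_eq0 Oz).2 hz.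
have Pv : P z z.2 = 0 by rewrite -k0 vpart.unlock.
set b := cov_field z z.2 W; set q := b - P z b.
have hq : ghor z q by exact: ghor_proj.
have vP : dmap z (P z b) = 0 by exact: ls_proj_vertical.
have AE : oneill_A z z.2 w = q.
  by rewrite /oneill_A Pv subr0 -Ww chi_field.
have TE : oneill_T z w z.2 = - alpha z w.
  by rewrite /oneill_T proj_id// chi_lhor.
have sC : smooth_at (fun y => cov_field y (W y.1) W) z by exact: smooth_cov_field.
have sC2 : smooth_at (fun y => cov_field y y.2 W) z.
  by apply: smooth_cov_field => //; exact: smooth_snd.
have H := lform_cov_T Oz hz vW.
(* The three terms of [curv_field] paired with [z.2]: the second is the derivative of [vdefect W]
   along the lift of [w], the third is given by [gform_alpha]. *)
have H1 : lform L z (curv Gam z z.2 w w)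
    = rderive (fun y => lform L y (cov_field y (W y.1) W)) z (hlift Gam z z.2)
      - (gform L z (alpha z w) b + gform L z (alpha z (alpha z w)) w)
      - gform L z (alpha z b) w.
  rewrite -Ww (curv_field Oz sW) !(lformB F)// (lform_acov _ Oz sC).
  rewrite (lform_acov _ Oz sC2) -(rderive_vdefect_hlift (W z.1) Oz hz vW).
  by rewrite (gform_alpha _ Oz hz vW).
have H2 := gform_alpha_sym Oz hz (alpha_vertical w Oz hz) vw.
have H3 := gform_alpha_ghor Oz hz vW hq; rewrite Ww -/b in H3.
have bE : b = q + P z b by rewrite subrK.
clearbody q.
have H4 : gform L z q b = gform L z q q.
  apply: etrans (congr1 (gform L z q) bE) _.
  by rewrite (gformDr F q (P z b) q Oz) (hq _ vP) addr0.
have H5 : gform L z (alpha z b) w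
    = gform L z (alpha z q) w + gform L z (alpha z (P z b)) w.
  apply: etrans (congr1 (fun c => gform L z (alpha z c) w) bE) _.
  by rewrite (alphaD _ _ Oz) (gformDl F).
rewrite AE TE (gformNl F)// (gformNr F)// opprK.
rewrite Ww -/b in H.
move: H H1 H2 H3 H4 H5.
rlra.
Qed.

(** For vertical fields W one has g(P x, W) = g(x, W). Differentiating along the spray, with P x = 0
    at [z], leaves g(x, nabla_v W) on the right, known from [gform_alpha_ghor]. *)
Lemma derive_proj_vertical_pos z x : O z -> lhor z -> ghor z x ->
  'D_(hlift Gam z z.2) (fun y => P y x) z = P z (Gam z x z.2) - alpha z x.
Proof.
move=> Oz hz hx; have Px := proj_ghor Oz hx.
have sP := ls_proj_smooth S x Oz; set t := hlift Gam z z.2.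
have va := alpha_vertical x Oz hz.
rewrite -[alpha z x](proj_id Oz)// -projB.
apply: proj_unique => //.
  apply: (derive_vertical0 t Oz (smooth_at_diff sP)) => // y.
  exact: ls_proj_vertical.
move=> w vw; have [W vW Ww] := vertical_field_ext Oz vw.
have [sW vW1] := vW; have dW := smooth_at_diff (smooth_field sW).
have E1 : rderive (fun y => gform L y (P y x) (W y.1)) z t
    = rderive (fun y => gform L y x (W y.1)) z t.
  apply: rderive_near.
  by apply: filterS2 (lf_near F Oz) vW1 => y Oy; exact: ls_proj_orthogonal.
have H := rderive_gform F t Oz (smooth_at_diff sP) dW.
have H' := rderive_gform F t Oz (differentiable_cst x z) dW.
rewrite E1 Px (gform0l F)// addr0 Ww (rderive_gform0 F _ _ Oz) add0r in H.
rewrite derive_cst (gform0l F)// addr0 derive_field Ww /t (lf_metric F)// in H'.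
have H2 := gform_alpha_ghor Oz hz vW hx.
rewrite field_cov.unlock Ww (gformDr F)// in H2.
rewrite -H H' (gformBl F)// (lf_Gam_sym F x z.2 Oz).
move: H2; rewrite /=.
rlra.
Qed.

(** For a vertical field W extending [a], [sff z a] is minus the image of nabla_v W; isometry and
    [gform_alpha_ghor] give the product. *)
Lemma gform_sff z x a : O z -> lhor z -> ghor z x -> dmap z a = 0 ->
  gform L' (tlift z) (sff z a) (dmap z x) = gform L z (alpha z x) a.
Proof.
move=> Oz hz hx va; have [W vW Wa] := vertical_field_ext Oz va.
have [Oz' _] := ls_horizontal S Oz hz.
have -> : sff z a = - dmap z (cov_field z z.2 W).
  have := vertical_field_derive z.2 Oz vW.
  rewrite Wa field_cov.unlock Wa => D.
  rewrite /sff va (lin0 (lf_Gam_linl F' _ _)) addr0 (linD (dmap_lin Oz)).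
  rewrite (d2map_sym z.2 a Oz) in D; move/eqP: D; rewrite addr_eq0 => /eqP ->.
  by rewrite (lf_Gam_sym F a z.2 Oz) opprD.
rewrite (gformNl F')// -gform_lhor// (gform_sym F)//.
by rewrite (gform_alpha_ghor Oz hz vW hx) Wa opprK.
Qed.

(** The derivative of the spray defect along the lift of [x], corrected by [(0, alpha z x)] to
    become tangent to the set of horizontal vectors. The correction is the right-hand side. *)
Lemma horizontal_eq1 z x : O z -> lhor z -> ghor z x ->
  d3map z x z.2 z.2 - 2 *: d2map z (Gam z x z.2) z.2
  + 'D_(hlift Gam' (tlift z) (dmap z x)) (spray Gam') (tlift z)
  - d2map z x (spray Gam z) - dmap z ('D_(hlift Gam z x) (spray Gam) z)
  = 2 *: sff z (alpha z x).
Proof.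
move=> Oz hz hx; have va := alpha_vertical x Oz hz.
set t : Z := hlift Gam z x - (0, alpha z x).
have t1 : t.1 = x by rewrite /t /= subr0.
have t2 : t.2 = - Gam z x z.2 - alpha z x by [].
have Dk : 'D_t kvert z = 0.
  by rewrite /t vpart_cov.unlock; exact: derive_kvert_tangent.
have D0 := derive_spray_defect_tangent Oz hz Dk.
have [_ DE] := derive_spray_defect t Oz hz.
rewrite DE t1 t2 in D0.
have s0 := sff_ghor Oz hz hx.
have hE : d2map z x z.2 + dmap z (- Gam z x z.2 - alpha z x)
    = - Gam' (tlift z) (dmap z x) (dmap z z.2).
  rewrite (linB (dmap_lin Oz)) va subr0 (linN (dmap_lin Oz)).
  apply/eqP; rewrite -subr_eq0 opprK addrAC -/(sff z x); exact/eqP.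
rewrite hE -/(hlift Gam' (tlift z) (dmap z x)) in D0.
have DG : 'D_t (spray Gam) z
    = 'D_(hlift Gam z x) (spray Gam) z - 2 *: Gam z (alpha z x) z.2.
  rewrite -(derive_spray_fiber F)//.
  exact: (deriveBr _ _ (diff_spray F Oz)).
rewrite DG (linB (d2map_linl _ Oz)) (linN (d2map_linl _ Oz)) in D0.
rewrite (linB (dmap_lin Oz)) (linZ (dmap_lin Oz)) in D0.
rewrite /sff va (lin0 (lf_Gam_linl F' _ _)) addr0.
set a := d3map z _ _ _; set b := d2map z (Gam _ _ _) _ in D0 *.
set c := d2map z (alpha _ _) _ in D0 *; set d := 'D_ _ (spray Gam') _ in D0 *.
set e := d2map z x _ in D0 *; set f := dmap z ('D_ _ _ _) in D0 *.
set g := dmap z (Gam z (alpha _ _) _) in D0 *.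
rewrite -/a in D0.
clearbody a b c d e f g.
apply/rowP => i; have := congr1 (fun v : V' => v 0 i) D0; rewrite !mxE.
lra.
Qed.

(** The derivative along the spray of [sff] at the horizontal part of [x], which vanishes on
    horizontal vectors by [sff_ghor]. *)
Lemma horizontal_eq2 z x : O z -> lhor z -> ghor z x ->
  d3map z z.2 x z.2 - d2map z x (spray Gam z)
  + ('D_(hlift Gam' (tlift z) (dmap z z.2)) (fun y => Gam' y (dmap z x) y.2)
       (tlift z)
     + Gam' (tlift z) (d2map z z.2 x) (dmap z z.2))
  - d2map z z.2 (Gam z x z.2)
  - dmap z ('D_(hlift Gam z z.2) (fun y => Gam y x y.2) z)
  = sff z (P z (Gam z x z.2) - alpha z x).
Proof.
move=> Oz hz hx; have [Oz' _] := ls_horizontal S Oz hz.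
have Px := proj_ghor Oz hx; have va := alpha_vertical x Oz hz.
have sP := ls_proj_smooth S x Oz.
(* [u y] remains horizontal for [gform L y] while [y] moves, and equals [x] at [z]; its variation is
   the one of the projection. *)
set t := hlift Gam z z.2; pose u y := x - P y x.
have su : smooth_at u z by apply: smooth_atB => //; exact: smooth_at_cst.
have uz : u z = x by rewrite /u Px subr0.
set p := P z (Gam z x z.2) - alpha z x.
have Du : 'D_t u z = - p.
  rewrite /p -(derive_proj_vertical_pos Oz hz hx) -/t.
  apply: etrans (derive_sub t (differentiable_cst x z) (smooth_at_diff sP)) _.
  by rewrite derive_cst sub0r.
have vp : dmap z p = 0.
  by rewrite (linB (dmap_lin Oz)) va subr0; exact: ls_proj_vertical.
have sl := smooth_tlift Oz; have dl := smooth_at_diff sl.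
have sv := smooth_snd z.
have s1 : smooth_at (fun y : Z => d2map y (u y) y.2) z.
  exact: smooth_d2map_comp.
have s2 : smooth_at (fun y : Z => Gam' (tlift y) (dmap y (u y)) (dmap y y.2)) z.
  apply: (@smooth_pbilin R Z V' V' V' (fun y => Gam' (tlift y))) => //.
  - exact: findim_rV.
  - exact: findim_rV.
  - by apply: filterS (lf_near F Oz) => y _ b; exact: (lf_Gam_linl F').
  - by apply: filterS (lf_near F Oz) => y _ b; exact: (lf_Gam_linr F').
  - move=> a b; apply: (smooth_at_comp (f := tlift)) (lf_Gam_smooth F' a b Oz') => //.
    by apply: findim_prod; exact: findim_rV.
  - exact: smooth_dmap_comp.
  - exact: smooth_dmap_comp.
have s3 : smooth_at (fun y : Z => Gam y (u y) y.2) z by exact: (smooth_Gam F).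
have s4 : smooth_at (fun y : Z => dmap y (Gam y (u y) y.2)) z.
  exact: smooth_dmap_comp.
have H1 := derive_d2map t Oz su sv.
rewrite uz Du derive_snd in H1.
have tE : d2map z z.2 z.2 - dmap z (spray Gam z) = - spray Gam' (tlift z).
  have := spray_defect_lhor Oz hz; rewrite spray_diff.unlock addrAC => /eqP.
  by rewrite addr_eq0 => /eqP.
have dmu := derive_dmap t Oz (smooth_at_diff su).
rewrite uz Du (linN (dmap_lin Oz)) vp oppr0 addr0 in dmu.
have dmv := derive_dmap t Oz (diff_snd z).
rewrite derive_snd /= (linN (dmap_lin Oz)) tE in dmv.
have H2 : 'D_t (fun y : Z => Gam' (tlift y) (dmap y (u y)) (dmap y y.2)) z
    = 'D_(hlift Gam' (tlift z) (dmap z z.2)) (fun y => Gam' y (dmap z x) y.2)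
       (tlift z) + Gam' (tlift z) (d2map z z.2 x) (dmap z z.2).
  rewrite (derive_nonlinear_connection F' _ _ Oz').
  have dT a b : differentiable (fun y => Gam' (tlift y) a b) z.
    exact: (differentiable_comp dl (diff_Gam F' a b Oz')).
  have lT1 : \forall y \near z, forall b, linear (Gam' (tlift y) ^~ b).
    by apply: filterS (lf_near F Oz) => y _ b; exact: (lf_Gam_linl F').
  have lT2 : \forall y \near z, forall b, linear (Gam' (tlift y) b).
    by apply: filterS (lf_near F Oz) => y _ b; exact: (lf_Gam_linr F').
  have du := smooth_at_diff (smooth_dmap_comp Oz su).
  have dv := smooth_at_diff (smooth_dmap_comp Oz sv).
  apply: etrans (@derive_pbilin R Z V' V' V' (fun y => Gam' (tlift y)) _ _ z t
    (findim_rV m) (findim_rV m) lT1 lT2 dT du dv) _.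
  rewrite uz dmu dmv addrAC.
  apply: (congr2 +%R); last by [].
  apply: (congr2 +%R); last by [].
  apply: etrans (derive_comp t dl (diff_Gam F' _ _ Oz')) _.
  rewrite (derive_tlift t Oz) /= (linN (dmap_lin Oz)) tE.
  by [].
have H3 := derive_dmap t Oz (smooth_at_diff s3).
have DGu : 'D_t (fun y : Z => Gam y (u y) y.2) z
    = 'D_t (fun y => Gam y x y.2) z - Gam z p z.2.
  rewrite (derive_nonlinear_connection F _ _ Oz).
  apply: etrans (derive_Gam F t Oz (smooth_at_diff su) (diff_snd z)) _.
  by rewrite uz Du derive_snd (linN (lf_Gam_linl F _ _)) addrAC.
rewrite uz DGu (linB (dmap_lin Oz)) in H3.
have s12 := smooth_atD s1 s2.
have D0 : 'D_t (fun y => sff y (u y)) z = 0.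
  have f0 : \forall y \near z, lhor y -> sff y (u y) = 0.
    by apply: filterS (lf_near F Oz) => y Oy hy; apply: sff_ghor => //;
      exact: ghor_proj.
  have df : differentiable (fun y => sff y (u y)) z.
    exact: (smooth_at_diff (smooth_atB s12 s4)).
  rewrite (tangent_derive t Oz hz df f0).
  by rewrite /t derive_kvert_spray// derive0.
have D1 := derive_sub t (smooth_at_diff s12) (smooth_at_diff s4).
have D2 := derive_add t (smooth_at_diff s1) (smooth_at_diff s2).
have := etrans (esym D1) D0.
rewrite D2 H1 H2 H3 /sff vp (lin0 (lf_Gam_linl F' _ _)) addr0.
rewrite (linN (d2map_lin _ Oz)) (linN (d2map_linl _ Oz)) /=.
set a := d3map z _ _ _; set b := d2map z p _; set c := d2map z x _.
set d := 'D_ _ _ _ + _; set e := d2map z _ _; set f := dmap z ('D_ _ _ _).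
set g := dmap z (Gam z p _).
clearbody a b c d e f g.
move=> E; apply/rowP => i; have := congr1 (fun v : V' => v 0 i) E; rewrite !mxE.
lra.
Qed.

(** In the difference of [horizontal_eq1] and [horizontal_eq2] the third derivatives of [sg] cancel
    and the Jacobi operators of both spaces appear. The factor 3 is the 2 of the first equation plus
    the 1 of the second. *)
Lemma dmap_curv z x : O z -> lhor z -> ghor z x ->
  dmap z (curv Gam z x z.2 z.2)
  = curv Gam' (tlift z) (dmap z x) (dmap z z.2) (dmap z z.2)
    - 3 *: sff z (alpha z x).
Proof.
move=> Oz hz hx; have [Oz' _] := ls_horizontal S Oz hz.
have E1 := horizontal_eq1 Oz hz hx; have E2 := horizontal_eq2 Oz hz hx.
have C1 := curv_jacobi F x Oz; have C2 := curv_jacobi F' (dmap z x) Oz'.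
have s0 := sff_ghor Oz hz hx.
have s1 := sff_ghor Oz hz (@ghor_proj z (Gam z x z.2) Oz).
have sE : d2map z x z.2
    = dmap z (Gam z x z.2) - Gam' (tlift z) (dmap z x) (dmap z z.2).
  by apply/eqP; rewrite eq_sym subr_eq eq_sym -subr_eq0; exact/eqP.
rewrite (d2map_sym z.2 x Oz) sE (linB (lf_Gam_linl F' _ _)) in E2.
rewrite (linB (sff_lin Oz)) in E2.
have := linB (sff_lin Oz) (Gam z x z.2) (P z (Gam z x z.2)).
rewrite s1 => s2.
have s3 : sff z (Gam z x z.2) = d2map z (Gam z x z.2) z.2
    + Gam' (tlift z) (dmap z (Gam z x z.2)) (dmap z z.2)
    - dmap z (Gam z (Gam z x z.2) z.2) by [].
rewrite C1 C2 (linB (dmap_lin Oz)) (linD (dmap_lin Oz)).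
rewrite (d2map_sym z.2 _ Oz) (d3map_sym z.2 x z.2 Oz) in E2.
rewrite -[(tlift z).2]/(dmap z z.2).
move: E1 E2 s2 s3.
set a := d3map z _ _ _; set b := d2map z (Gam _ _ _) _.
set c := 'D_ _ (spray Gam') _; set d := d2map z x _.
set e := dmap z ('D_ _ (spray _) _); set f := sff z (alpha z x).
set g := 'D_ _ _ (tlift z); set h := Gam' _ (dmap z (Gam _ _ _)) _.
set i := Gam' _ (Gam' _ _ _) _; set j := dmap z ('D_ _ _ _).
set k := sff z _; set l := sff z _; set o := dmap z _.
clearbody a b c d e f g h i j k l o.
move=> E1 E2 s2 s3; apply/rowP => r.
have := congr1 (fun v : V' => v 0 r) E1; have := congr1 (fun v : V' => v 0 r) E2.
have := congr1 (fun v : V' => v 0 r) s2; have := congr1 (fun v : V' => v 0 r) s3.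
rewrite !mxE; lra.
Qed.

(** [lform_curv] on both spaces moves [x] out of the curvature, so that [dmap_curv] and the isometry
    apply. *)
Lemma horizontal_curvature z x : O z -> lhor z -> ghor z x ->
  lform L z (curv Gam z z.2 x x)
  = lform L' (tlift z) (curv Gam' (tlift z) (dmap z z.2) (dmap z x) (dmap z x))
    - 3 * gform L z (oneill_A z x z.2) (oneill_A z x z.2).
Proof.
move=> Oz hz hx; have [Oz' _] := ls_horizontal S Oz hz.
have va := alpha_vertical x Oz hz.
have AE : oneill_A z x z.2 = - alpha z x.
  by rewrite /oneill_A (proj_ghor Oz hx) subr0 chi_lhor.
have N1 : curv Gam z z.2 x z.2 = - curv Gam z x z.2 z.2 by rewrite /curv opprB.
have N2 : curv Gam' (tlift z) (dmap z z.2) (dmap z x) (dmap z z.2)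
    = - curv Gam' (tlift z) (dmap z x) (dmap z z.2) (dmap z z.2).
  by rewrite /curv opprB.
rewrite AE (lform_curv F _ _ _ Oz) (lform_curv F' _ _ _ Oz').
rewrite -[(tlift z).2]/(dmap z z.2) N1 N2.
rewrite !(gformNl F _ _ Oz) (gformNr F _ _ Oz) (gformNl F' _ _ Oz') !opprK.
rewrite (gform_lhor _ Oz hz hx) (dmap_curv Oz hz hx) (gformBl F' _ _ _ Oz').
by rewrite (gformZl F' _ _ _ Oz') (gform_sff Oz hz hx va).
Qed.

End LocalSubmersion.

(** * Smooth matrix-valued maps *)

Section SmoothMatrices.
Context {R : realType} {X : normedModType R}.
Implicit Types (x : X).

Definition smooth_mx k l (F : X -> 'M[R]_(k, l)) x : Prop :=
  forall i j, smooth_at (fun y => F y i j) x.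

Lemma smooth_mx_mul k l r (F : X -> 'M[R]_(k, l)) (G : X -> 'M[R]_(l, r)) x :
  smooth_mx F x -> smooth_mx G x -> smooth_mx (fun y => F y *m G y) x.
Proof.
move=> sF sG i j.
have -> : (fun y => (F y *m G y) i j) = fun y => \sum_h F y i h *: G y h j.
  by apply/funext => y; rewrite mxE.
by apply: smooth_at_sum => h; exact: smooth_at_scale.
Qed.

Lemma smooth_mx_tr k l (F : X -> 'M[R]_(k, l)) x :
  smooth_mx F x -> smooth_mx (fun y => (F y)^T) x.
Proof.
move=> sF i j; have -> : (fun y => (F y)^T i j) = fun y => F y j i.
  by apply/funext => y; rewrite mxE.
exact: sF.
Qed.

Lemma smooth_det k (F : X -> 'M[R]_k) x : smooth_mx F x ->
  smooth_at (fun y => \det (F y)) x.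
Proof.
move=> sF; rewrite /determinant; apply: smooth_at_sum => s.
by apply: (@smooth_at_scaler R X R); apply: smooth_at_prod => i.
Qed.

(** Cramer's formula: cofactors over the determinant. *)
Lemma smooth_mx_inv k (F : X -> 'M[R]_k) x : smooth_mx F x ->
  (\forall y \near x, F y \in unitmx) -> smooth_mx (fun y => invmx (F y)) x.
Proof.
move=> sF uF i j.
have d0 : \det (F x) != 0 by rewrite -unitfE -unitmxE; exact: nbhs_singleton uF.
have sC : smooth_at (fun y => cofactor (F y) j i) x.
  rewrite /cofactor; apply: (@smooth_at_scaler R X R); apply: smooth_det => a b.
  have -> : (fun y => (row' j (col' i (F y))) a b)
      = fun y => F y (lift j a) (lift i b) by apply/funext => y; rewrite !mxE.
  exact: sF.
have sI := @smooth_at_inv R X (fun y => \det (F y)) x d0 (smooth_det sF).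
have := @smooth_at_scale R X R _ _ x sI sC.
apply: smooth_at_eq.
by apply: filterS uF => y uy; rewrite /invmx uy !mxE.
Qed.

End SmoothMatrices.

(** * The orthogonal projection on vertical vectors *)

Section VerticalProjection.
Context {R : realType} {n m : nat}.
Local Notation V := 'rV[R]_n.
Local Notation Z := (V * V)%type.
Local Notation V' := 'rV[R]_m.
Variables (O : set Z) (L : Z -> R) (Gam : Z -> V -> V -> V) (sg : V -> V').
Local Notation dmap z := (deriv1 sg z.1).
Hypothesis F : local_finsler O L Gam.
Hypothesis sg_smooth : forall z, O z -> smooth_at sg z.1.
Hypothesis sg_surjective : forall z u', O z -> exists u, dmap z u = u'.
Hypothesis vert_nondegenerate : forall z w, O z -> dmap z w = 0 ->
  (forall w', dmap z w' = 0 -> gform L z w w' = 0) -> w = 0.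

Definition dmx (z : Z) : 'M[R]_(n, m) := \matrix_i dmap z (delta_mx 0 i).
Definition gmx (z : Z) : 'M[R]_n :=
  \matrix_(i, j) gform L z (delta_mx 0 i) (delta_mx 0 j).
Definition smx (z : Z) : 'M[R]_m := (dmx z)^T *m invmx (gmx z) *m dmx z.

(* The horizontal vectors are the [r *m (dmx z)^T *m invmx (gmx z)], and      *)
(* [smx z] maps [r] to the image of that vector by [dmap z].                  *)
Definition vproj (z : Z) (b : V) : V :=
  b - b *m (dmx z *m invmx (smx z) *m (dmx z)^T *m invmx (gmx z)).

Let dmapl z : O z -> linear (dmap z).
Proof.
move=> Oz; rewrite deriv1.unlock.
by apply: derive_linear; apply/smooth_at_diff/sg_smooth.
Qed.

Lemma mul_dmx z u : O z -> u *m dmx z = dmap z u.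
Proof.
move=> Oz; rewrite mulmx_sum_row {2}[u]row_sum_delta.
rewrite (linear_sum_scale _ _ _ (dmapl Oz)).
by apply: eq_bigr => i _; rewrite rowK.
Qed.

Lemma mul_gmx z a b : O z -> a *m gmx z *m b^T = (gform L z a b)%:M.
Proof.
move=> Oz; apply/rowP => k; rewrite !ord1 !mxE eqxx mulr1n.
have lr c : linear (gform L z c).
  by move=> r u v; rewrite (gformDr F)// (gformZr F).
have ll c : linear (gform L z ^~ c).
  by move=> r u v; rewrite (gformDl F)// (gformZl F).
rewrite {2}[b]row_sum_delta (linear_sum_scale _ _ _ (lr a)).
apply: eq_bigr => j _; rewrite !mxE mulrC; congr (_ * _).
rewrite {2}[a]row_sum_delta (linear_sum_scale _ _ _ (ll _)).
by apply: eq_bigr => i _; rewrite !mxE.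
Qed.

Lemma gmx_unit z : O z -> gmx z \in unitmx.
Proof.
move=> Oz; rewrite -row_free_unit; apply: inj_row_free => a a0.
apply: (lf_nondegenerate F Oz) => b.
have := mul_gmx a b Oz; rewrite a0 mul0mx => /rowP/(_ 0).
by rewrite !mxE eqxx mulr1n.
Qed.

(** A kernel vector [r] gives a horizontal vector [h] that is also vertical, hence zero by
    non-degeneracy of the vertical space. Then [r] is orthogonal to the image of [dmap z], which is
    everything. *)
Lemma smx_unit z : O z -> smx z \in unitmx.
Proof.
move=> Oz; rewrite -row_free_unit; apply: inj_row_free => r r0.
have uG := gmx_unit Oz.
set h : V := r *m (dmx z)^T *m invmx (gmx z).
have hG : h *m gmx z = r *m (dmx z)^T by rewrite /h mulmxKV.
have h0 : h = 0.
  apply: (vert_nondegenerate Oz) => [|w vw].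
    by rewrite -mul_dmx// /h -r0 /smx !mulmxA.
  have := mul_gmx h w Oz; rewrite hG -mulmxA -trmx_mul mul_dmx// vw trmx0 mulmx0.
  by move=> /rowP/(_ 0); rewrite !mxE eqxx mulr1n.
have rD : r *m (dmx z)^T = 0 by rewrite -hG h0 mul0mx.
apply/rowP => i; have [u uE] := sg_surjective (delta_mx 0 i) Oz.
have : u *m (r *m (dmx z)^T)^T = 0 by rewrite rD trmx0 mulmx0.
rewrite trmx_mul trmxK mulmxA mul_dmx// uE -rowE => /rowP/(_ 0).
by rewrite !mxE.
Qed.

Lemma smooth_dmx z : O z -> smooth_mx dmx z.
Proof.
move=> Oz i j.
have -> : (fun y => dmx y i j) = fun y => dmap y (delta_mx 0 i) 0 j.
  by apply/funext => y; rewrite !mxE.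
apply: smooth_at_coord.
apply: (@smooth_at_comp R _ _ _ fst (fun x => deriv1 sg x (delta_mx 0 i))).
- exact: findim_rV.
- exact: smooth_fst.
- by rewrite deriv1.unlock; apply: smooth_at_derive; exact: sg_smooth.
Qed.

Lemma smooth_gmx z : O z -> smooth_mx gmx z.
Proof.
move=> Oz i j.
have -> : (fun y => gmx y i j)
    = fun y => gform L y (delta_mx 0 i) (delta_mx 0 j).
  by apply/funext => y; rewrite mxE.
exact: (smooth_gform F).
Qed.

Lemma smooth_vproj z b : O z -> smooth_at (fun y => vproj y b) z.
Proof.
move=> Oz; apply: smooth_atB; first exact: smooth_at_cst.
have sD := smooth_dmx Oz.
have sG : smooth_mx (fun y => invmx (gmx y)) z.
  apply: (smooth_mx_inv (smooth_gmx Oz)).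
  by apply: filterS (lf_near F Oz) => y; exact: gmx_unit.
have sS : smooth_mx (fun y => invmx (smx y)) z.
  apply: smooth_mx_inv.
    by do 2?apply: smooth_mx_mul => //; exact: smooth_mx_tr.
  by apply: filterS (lf_near F Oz) => y; exact: smx_unit.
have sb : smooth_mx (fun _ : Z => b) z by move=> i j; exact: smooth_at_cst.
apply: smooth_at_rV => j; apply: (smooth_mx_mul sb).
by do 3?apply: smooth_mx_mul => //; exact: smooth_mx_tr.
Qed.

Lemma vproj_linear z : linear (vproj z).
Proof.
move=> a b b'; rewrite /vproj mulmxDl -scalemxAl scalerBr opprD.
by rewrite addrACA.
Qed.

Lemma vproj_vertical z b : O z -> dmap z (vproj z b) = 0.
Proof.
move=> Oz; have uS := smx_unit Oz.
rewrite -mul_dmx// /vproj mulmxBl -!mulmxA.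
have -> : (dmx z)^T *m (invmx (gmx z) *m dmx z) = smx z by rewrite /smx mulmxA.
by rewrite mulVmx// mulmx1 subrr.
Qed.

Lemma vproj_orthogonal z b w : O z -> dmap z w = 0 ->
  gform L z (vproj z b) w = gform L z b w.
Proof.
move=> Oz vw; rewrite /vproj (gformBl F)//.
set h := b *m _.
suff -> : gform L z h w = 0 by rewrite subr0.
have := mul_gmx h w Oz; rewrite /h -!mulmxA mulKmx; last exact: gmx_unit.
rewrite -trmx_mul mul_dmx// vw trmx0 !mulmx0 => /rowP/(_ 0).
by rewrite !mxE eqxx mulr1n.
Qed.

End VerticalProjection.

(** * Charts *)

(** The change of coordinates of tangent vectors at [q]. On their domains [tcoord], [tvec] and [ext]
    are all instances of it, with a preferred chart at one or both ends. *)
HB.lock Definition trans {R : realType} {n : nat} {M : manifold R n}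
  (c d : chart R n M) (q : M) (u : 'rV[R]_n) : 'rV[R]_n :=
  'D_u (d \o cinv c) (c q).

Section Charts.
Context {R : realType} {n : nat} {M : manifold R n}.
Local Notation V := 'rV[R]_n.
Implicit Types (p q : M) (c d e : chart R n M).

Lemma trans_derive c d q u : trans c d q u = 'D_u (d \o cinv c) (c q).
Proof. by rewrite trans.unlock. Qed.

Lemma atlas_at p : atlas M (chart_at p).
Proof. exact: s2valP. Qed.

Lemma cdom_at p : cdom (chart_at p) p.
Proof. exact: (s2valP' (cid2 (atlas_cover p))). Qed.

Lemma cimg_map c q : cdom c q -> cimg c (c q).
Proof. by move=> cq; exists q. Qed.

Lemma cinvK c x : cimg c x -> c (cinv c x) = x.
Proof. by move=> [q cq <-]; rewrite cmapK. Qed.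

Lemma cdom_cinv c x : cimg c x -> cdom c (cinv c x).
Proof. by move=> [q cq <-]; rewrite cmapK. Qed.

Lemma near_cimg c x : cimg c x -> \forall y \near x, cimg c y.
Proof. by move=> cx; apply: open_nbhs_nbhs; split=> //; exact: cimg_open. Qed.

Lemma near_cinv c x (Om : set M) : open Om -> cimg c x -> Om (cinv c x) ->
  \forall y \near x, Om (cinv c y).
Proof.
move=> oOm cx Omx; apply: (cinv_continuous cx).
exact: open_nbhs_nbhs.
Qed.

Lemma image_chart c (Om : set M) :
  c @` (cdom c `&` Om) = [set x | cimg c x /\ Om (cinv c x)].
Proof.
apply/seteqP; split=> x /=.
  by move=> [q [cq Oq] <-]; rewrite cmapK//; split=> //; exact: cimg_map.
by move=> [cx Ox]; exists (cinv c x); [split=> //; exact: cdom_cinv|exact: cinvK].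
Qed.

Lemma open_image_chart c (Om : set M) : open Om -> open (c @` (cdom c `&` Om)).
Proof.
move=> oOm; rewrite image_chart openE => x /= [cx Ox].
exact: filterS2 (near_cimg cx) (near_cinv oOm cx Ox).
Qed.

Lemma open_preimage_chart c (D : set V) : open D -> open (cdom c `&` c @^-1` D).
Proof.
move=> oD; rewrite openE => q [cq Dq].
have n1 : \forall q' \near q, cdom c q'.
  by apply: open_nbhs_nbhs; split=> //; exact: cdom_open.
have n2 : \forall q' \near q, D (c q').
  by apply: (cmap_continuous cq); exact: open_nbhs_nbhs.
by apply: filterS2 n1 n2.
Qed.

Lemma smooth_at_chart (W : normedModType R) c q (f : V -> W) (Om : set M) : open Om ->
  cdom c q -> Om q -> smooth_on (c @` (cdom c `&` Om)) f ->
  smooth_at f (c q).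
Proof.
move=> oOm cq Oq; apply: smooth_onW; first exact: open_image_chart.
by exists q.
Qed.

Lemma smooth_trans c d q : atlas M c -> atlas M d -> cdom c q -> cdom d q ->
  smooth_at (d \o cinv c) (c q).
Proof.
move=> ac ad cq dq.
apply: (@smooth_at_chart V c q _ (cdom d)) => //; first exact: cdom_open.
exact: atlas_compat.
Qed.

Lemma trans_lin c d q : atlas M c -> atlas M d -> cdom c q -> cdom d q ->
  linear (trans c d q).
Proof.
move=> ac ad cq dq; rewrite trans.unlock; apply: derive_linear.
by apply: smooth_at_diff; exact: smooth_trans.
Qed.

Lemma transE c d q u : atlas M c -> atlas M d -> cdom c q -> cdom d q ->
  'd (d \o cinv c) (c q) u = trans c d q u.
Proof.
move=> ac ad cq dq; rewrite trans.unlock deriveE//.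
by apply: smooth_at_diff; exact: smooth_trans.
Qed.

Lemma derive_change (W : normedModType R) c d q u (g : V -> W) : atlas M c ->
  atlas M d -> cdom c q -> cdom d q -> differentiable g (c q) ->
  'D_u (fun x => g (c (cinv d x))) (d q) = 'D_(trans d c q u) g (c q).
Proof.
move=> ac ad cq dq dg; rewrite trans.unlock.
have df := smooth_at_diff (smooth_trans ad ac dq cq).
have fE : (c \o cinv d) (d q) = c q by rewrite /= cmapK.
have dg' : differentiable g ((c \o cinv d) (d q)) by rewrite fE.
by have := derive_comp u df dg'; rewrite fE.
Qed.

Lemma trans_comp c d e q u : atlas M c -> atlas M d -> atlas M e ->
  cdom c q -> cdom d q -> cdom e q ->
  trans d e q (trans c d q u) = trans c e q u.
Proof.
move=> ac ad ae cq dq eq.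
have dde := smooth_at_diff (smooth_trans ad ae dq eq).
have := derive_change u ad ac dq cq dde.
rewrite (trans_derive d e) => <-; rewrite (trans_derive c e).
apply: near_eq_derive.
have cimq := cimg_map cq.
have dcq : cdom d (cinv c (c q)) by rewrite cmapK.
apply: filterS (near_cinv (cdom_open d) cimq dcq) => x dx /=.
by rewrite cmapK.
Qed.

Lemma trans_id c q u : cdom c q -> trans c c q u = u.
Proof.
move=> cq; rewrite trans.unlock -[RHS](clinear_derive (c q) u (@clinear_id R V)).
apply: near_eq_derive.
by apply: filterS (near_cimg (cimg_map cq)) => x cx; exact: cinvK.
Qed.

Lemma transK c d q u : atlas M c -> atlas M d -> cdom c q -> cdom d q ->
  trans d c q (trans c d q u) = u.
Proof. by move=> ac ad cq dq; rewrite trans_comp// trans_id. Qed.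

Lemma tcoordE c q u : atlas M c -> cdom c q ->
  tcoord c q u = trans (chart_at q) c q u.
Proof.
by move=> ac cq; rewrite /tcoord transE//; [exact: atlas_at|exact: cdom_at].
Qed.

Lemma tvecE c x u : atlas M c -> cimg c x ->
  tvec c x u = trans c (chart_at (cinv c x)) (cinv c x) u.
Proof.
move=> ac [q cq <-]; rewrite /tvec cmapK// transE//.
- exact: atlas_at.
- exact: cdom_at.
Qed.

Lemma extE p u q : cdom (chart_at p) q ->
  ext p u q = trans (chart_at p) (chart_at q) q u.
Proof.
by move=> pq; rewrite /ext transE//; [exact: atlas_at|exact: atlas_at|exact: cdom_at].
Qed.

Lemma tvecK c x u : atlas M c -> cimg c x ->
  tcoord c (cinv c x) (tvec c x u) = u.
Proof.
move=> ac cx; have cq := cdom_cinv cx.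
by rewrite tcoordE// tvecE// transK//; [exact: atlas_at|exact: cdom_at].
Qed.

Lemma tcoordK c x u : atlas M c -> cimg c x ->
  tvec c x (tcoord c (cinv c x) u) = u.
Proof.
move=> ac cx; have cq := cdom_cinv cx.
by rewrite tcoordE// tvecE// transK//; [exact: atlas_at|exact: cdom_at].
Qed.

Lemma tvec_lin c x : atlas M c -> cimg c x -> linear (tvec c x).
Proof.
move=> ac cx a u v; rewrite !tvecE// trans_lin//.
- exact: atlas_at.
- exact: cdom_cinv.
- exact: cdom_at.
Qed.

Lemma smooth_trans_vec c d q u : atlas M c -> atlas M d -> cdom c q -> cdom d q ->
  smooth_at (fun x => trans c d (cinv c x) u) (c q).
Proof.
move=> ac ad cq dq.
apply: smooth_at_eq (smooth_at_derive u (smooth_trans ac ad cq dq)).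
apply: filterS (near_cimg (cimg_map cq)) => x cx.
by rewrite trans.unlock cinvK.
Qed.

Lemma tcoord_trans c d q u : atlas M c -> atlas M d -> cdom c q -> cdom d q ->
  tcoord d q u = trans c d q (tcoord c q u).
Proof.
move=> ac ad cq dq; rewrite !tcoordE// trans_comp//; first exact: atlas_at.
exact: cdom_at.
Qed.

Lemma vfield_inE c (E : vfield M) q : cdom c q ->
  vfield_in c E (c q) = tcoord c q (E q).
Proof. by move=> cq; rewrite /vfield_in cmapK. Qed.

Lemma smooth_change c d (W : normedModType R) (f : V -> W) q : atlas M c ->
  atlas M d -> cdom c q -> cdom d q -> smooth_at f (c q) ->
  smooth_at (fun x => f (c (cinv d x))) (d q).
Proof.
move=> ac ad cq dq sf; apply: (smooth_at_comp (f := c \o cinv d)).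
- exact: findim_rV.
- exact: smooth_trans.
- by rewrite /= cmapK.
Qed.

Lemma smooth_vfield_chart c (Om : set M) (E : vfield M) : atlas M c ->
  open Om -> Om `<=` cdom c ->
  (forall q, Om q -> smooth_at (vfield_in c E) (c q)) -> smooth_vfield Om E.
Proof.
move=> ac oOm Oc sE d ad; apply: smooth_at_on => x [q [dq Oq] <-].
have cq := Oc q Oq.
have lT : \forall x \near c q, linear (trans c d (cinv c x)).
  have cimq := cimg_map cq.
  have dcq : cdom d (cinv c (c q)) by rewrite cmapK.
  apply: filterS2 (near_cimg cimq) (near_cinv (cdom_open d) cimq dcq) => y cy dy.
  by apply: trans_lin => //; exact: cdom_cinv.
have sT : smooth_at (fun x => trans c d (cinv c x) (vfield_in c E x)) (c q).
  apply: (@smooth_plin R V V V (fun x => trans c d (cinv c x))) => //.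
  - exact: findim_rV.
  - by move=> b; exact: smooth_trans_vec.
  - exact: sE.
apply: smooth_at_eq (smooth_change ac ad cq dq sT).
have dimq := cimg_map dq.
have cdq : cdom c (cinv d (d q)) by rewrite cmapK.
apply: filterS2 (near_cimg dimq) (near_cinv (cdom_open c) dimq cdq) => y dy cy.
rewrite /vfield_in !cmapK// (@tcoord_trans c d)//; exact: cdom_cinv.
Qed.

Lemma smooth_fun_chart c (Om : set M) (f : M -> R) : atlas M c ->
  open Om -> Om `<=` cdom c ->
  (forall q, Om q -> smooth_at (f \o cinv c) (c q)) -> smooth_fun Om f.
Proof.
move=> ac oOm Oc sE d ad; apply: smooth_at_on => x [q [dq Oq] <-].
have cq := Oc q Oq.
apply: smooth_at_eq (smooth_change ac ad cq dq (sE q Oq)).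
have dimq := cimg_map dq.
have cdq : cdom c (cinv d (d q)) by rewrite cmapK.
apply: filterS2 (near_cimg dimq) (near_cinv (cdom_open c) dimq cdq) => y dy cy.
by rewrite /= cmapK.
Qed.

Lemma smooth_vfield_at c (Om : set M) (E : vfield M) q : atlas M c ->
  open Om -> smooth_vfield Om E -> cdom c q -> Om q ->
  smooth_at (vfield_in c E) (c q).
Proof. by move=> ac oOm sE cq Oq; exact: (smooth_at_chart oOm cq Oq (sE c ac)). Qed.

Lemma vfield_in_ext c p u q : atlas M c -> cdom c q -> cdom (chart_at p) q ->
  vfield_in c (ext p u) (c q) = trans (chart_at p) c q u.
Proof.
move=> ac cq pq; rewrite vfield_inE// extE// tcoordE// trans_comp//.
- exact: atlas_at.
- exact: atlas_at.
- exact: cdom_at.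
Qed.

Lemma ext_const p u x : cimg (chart_at p) x ->
  vfield_in (chart_at p) (ext p u) x = u.
Proof.
move=> [q pq <-]; rewrite vfield_in_ext//; last exact: atlas_at.
exact: trans_id.
Qed.

Lemma smooth_ext p u : smooth_vfield (cdom (chart_at p)) (ext p u).
Proof.
apply: (smooth_vfield_chart (atlas_at p)) => //; first exact: cdom_open.
move=> q pq; apply: smooth_at_eq (smooth_at_cst u _).
by apply: filterS (near_cimg (cimg_map pq)) => x px; rewrite ext_const.
Qed.

Lemma dfunE c q u (f : M -> R) : atlas M c -> cdom c q ->
  differentiable (f \o cinv c) (c q) ->
  dfun q u f = 'D_(tcoord c q u) (f \o cinv c) (c q).
Proof.
move=> ac cq df; have aq := atlas_at q; have dq := cdom_at q.
rewrite tcoordE// -(derive_change u ac aq cq dq df).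
apply: near_eq_derive.
have cdq : cdom c (cinv (chart_at q) (chart_at q q)) by rewrite cmapK.
apply: filterS (near_cinv (cdom_open c) (cimg_map dq) cdq) => x cx.
by rewrite /= cmapK.
Qed.

(** Read in the chart at [q], the fields are first derivatives of the transition map, so the bracket
    is a difference of mixed second derivatives. *)
Lemma bracket_ext p u v q : cdom (chart_at p) q ->
  bracket (ext p u) (ext p v) q = 0.
Proof.
move=> pq; have ap := atlas_at p; have aq := atlas_at q; have dq := cdom_at q.
set c := chart_at p in ap pq *; set d := chart_at q in aq dq *.
have sT := smooth_trans ap aq pq dq.
have sT' := smooth_trans aq ap dq pq.
have D a b : 'D_(ext p a q) (vfield_in d (ext p b)) (d q)
    = 'D_a ('D_b (d \o cinv c)) (c q).
  have Ea : trans d c q (ext p a q) = a by rewrite (extE a pq); exact: transK.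
  apply: etrans _ (congr1 (fun w => 'D_w ('D_b (d \o cinv c)) (c q)) Ea).
  apply: etrans _ (derive_change (ext p a q) ap aq pq dq
    (smooth_at_diff (smooth_at_derive b sT))).
  apply: near_eq_derive.
  have cdq : cdom c (cinv d (d q)) by rewrite cmapK.
  apply: filterS2 (near_cimg (cimg_map dq))
    (near_cinv (cdom_open c) (cimg_map dq) cdq) => x dx cx.
  rewrite -{1}(cinvK dx) vfield_in_ext//; last exact: cdom_cinv.
  by rewrite trans.unlock.
rewrite /bracket -/d !D (derive_sym u v sT).
exact: subrr.
Qed.

End Charts.

(** Expanding over the basis makes the coefficients bilinear at every [z], even outside the
    admissible domain. *)
HB.lock Definition christoffel {R : realType} {n : nat} {M : manifold R n}
  (nabla : connection M) (p : M) (z : 'rV[R]_n * 'rV[R]_n) (a b : 'rV[R]_n) :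
  'rV[R]_n :=
  \sum_i \sum_j (a 0 i * b 0 j) *: tcoord (chart_at p) (cinv (chart_at p) z.1)
    (nabla (ext p (delta_mx 0 i)) (ext p (delta_mx 0 j))
       (tchart_inv (chart_at p) z)).

(** * Anisotropic connections in a chart *)

Section Connection.
Context {R : realType} {n : nat} {M : manifold R n}.
Local Notation V := 'rV[R]_n.
Variables (A : set (tangent M)) (nabla : connection M).
Hypothesis HN : anisotropic_connection A nabla.

Lemma tcoord_linear (c : chart R n M) q : linear (tcoord c q).
Proof. by move=> a u v; rewrite /tcoord linearP. Qed.

Lemma vfield_in_comb (c : chart R n M) (f : M -> R) (E1 E2 : vfield M) x :
  vfield_in c (fun q => f q *: E1 q + E2 q) x
  = f (cinv c x) *: vfield_in c E1 x + vfield_in c E2 x.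
Proof. exact: tcoord_linear. Qed.

Lemma smooth_vfield_comb (Om : set M) (f : M -> R) (E1 E2 : vfield M) :
  open Om -> smooth_fun Om f -> smooth_vfield Om E1 -> smooth_vfield Om E2 ->
  smooth_vfield Om (fun q => f q *: E1 q + E2 q).
Proof.
move=> oOm sf s1 s2 d ad; apply: smooth_at_on => x [q [dq Oq] <-].
have H1 := smooth_vfield_at ad oOm s1 dq Oq.
have H2 := smooth_vfield_at ad oOm s2 dq Oq.
have H3 : smooth_at (f \o cinv d) (d q).
  exact: (smooth_at_chart oOm dq Oq (sf d ad)).
have -> : vfield_in d (fun q => f q *: E1 q + E2 q)
    = fun x => (f \o cinv d) x *: vfield_in d E1 x + vfield_in d E2 x.
  by apply/funext => y; exact: vfield_in_comb.
by apply: smooth_atD => //; exact: smooth_at_scale.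
Qed.

Lemma smooth_fun_cst (Om : set M) (a : R) : open Om -> smooth_fun Om (fun=> a).
Proof. by move=> oOm d ad; apply: smooth_at_on => x _; exact: smooth_at_cst. Qed.

Lemma smooth_vfield0 (Om : set M) : open Om -> smooth_vfield Om (fun=> 0).
Proof.
move=> oOm d ad; apply: smooth_at_on => x _.
have -> : vfield_in d (fun=> 0) = fun=> 0.
  by apply/funext => y; exact: (lin0 (tcoord_linear _ _)).
exact: smooth_at_cst.
Qed.

Lemma smooth_vfieldS (Om Om' : set M) (E : vfield M) :
  Om' `<=` Om -> smooth_vfield Om E -> smooth_vfield Om' E.
Proof.
move=> sOm sE d ad k; apply: Ck_on_sub (sE d ad k).
by move=> x [q [dq Oq] <-]; exists q => //; split => //; exact: sOm.
Qed.

(* Equal to 0 on the open set [Om], hence smooth there, and to 1 elsewhere:   *)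
(* multiplying by it a total field that vanishes on [Om] does nothing.        *)
Definition off (Om : set M) (q : M) : R := (q \notin Om)%:R.

Lemma smooth_off (Om : set M) : open Om -> smooth_fun Om (off Om).
Proof.
move=> oOm d ad; apply: smooth_at_on => x [q [dq Oq] <-].
apply: smooth_at_eq (smooth_at_cst 0 _).
have Oq' : Om (cinv d (d q)) by rewrite cmapK.
apply: filterS (near_cinv oOm (cimg_map dq) Oq') => y Oy.
by rewrite /= /off (mem_set Oy).
Qed.

Lemma offZ (Om : set M) (D : vfield M) : (forall q, Om q -> D q = 0) ->
  (fun q => off Om q *: D q) = D.
Proof.
move=> D0; apply/funext => q; rewrite /off; case: (boolP (q \in Om)) => qO /=.
  by rewrite scale0r D0//; exact: set_mem.
by rewrite scale1r.
Qed.

Section Locality.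
Variables (Om : set M) (v : tangent M).
Hypotheses (oOm : open Om) (Av : A v) (Ov : Om v.1).

Lemma off0 : off Om v.1 = 0.
Proof. by rewrite /off (mem_set Ov). Qed.

Lemma nabla0l H : smooth_vfield Om H -> nabla (fun=> 0) H v = 0.
Proof.
move=> sH; have s0 := smooth_vfield0 oOm.
have := nabla_linearl HN oOm (smooth_fun_cst 1 oOm) s0 s0 sH Av Ov.
have -> : (fun q : M => 1 *: (0 : V) + 0) = fun=> 0.
  by apply/funext => q; rewrite scaler0 addr0.
rewrite scale1r => /eqP; rewrite -subr_eq0 opprD addrA subrr sub0r oppr_eq0.
by move/eqP.
Qed.

(** [D] equals [off Om] times itself, and linearity extracts this factor, which is zero at [v.1].
    Locality allows replacing a field by its expansion in coordinate fields, valid on a chart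
    only. *)
Lemma nabla_vanish_l D H : smooth_vfield Om D -> smooth_vfield Om H ->
  (forall q, Om q -> D q = 0) -> nabla D H v = 0.
Proof.
move=> sD sH D0; have s0 := smooth_vfield0 oOm.
have := nabla_linearl HN oOm (smooth_off oOm) sD s0 sH Av Ov.
rewrite off0 scale0r add0r nabla0l// => <-; congr (nabla _ H v).
by rewrite -{1}(offZ D0); apply/funext => q; rewrite addr0.
Qed.

Lemma nabla_local_l E E' H : smooth_vfield Om E -> smooth_vfield Om E' ->
  smooth_vfield Om H -> (forall q, Om q -> E q = E' q) ->
  nabla E H v = nabla E' H v.
Proof.
move=> sE sE' sH EE'.
have sD : smooth_vfield Om (fun q => -1 *: E' q + E q).
  by apply: smooth_vfield_comb => //; exact: smooth_fun_cst.
have := nabla_linearl HN oOm (smooth_fun_cst 1 oOm) sD sE' sH Av Ov.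
rewrite (nabla_vanish_l sD)//; last first.
  by move=> q Oq; rewrite scaleN1r EE'// addNr.
rewrite scaler0 add0r => <-; congr (nabla _ H v).
by apply/funext => q; rewrite scale1r scaleN1r addrAC addNr add0r.
Qed.

Lemma nabla_vanish_r E D : smooth_vfield Om E -> smooth_vfield Om D ->
  (forall q, Om q -> D q = 0) -> nabla E D v = 0.
Proof.
move=> sE sD D0; have := nabla_leibniz HN oOm (smooth_off oOm) sE sD Av Ov.
by rewrite offZ// off0 scale0r addr0 D0// scaler0.
Qed.

Lemma nabla_local_r E H H' : smooth_vfield Om E -> smooth_vfield Om H ->
  smooth_vfield Om H' -> (forall q, Om q -> H q = H' q) ->
  nabla E H v = nabla E H' v.
Proof.
move=> sE sH sH' HH'.
have sD : smooth_vfield Om (fun q => -1 *: H' q + H q).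
  by apply: smooth_vfield_comb => //; exact: smooth_fun_cst.
have := nabla_additiver HN oOm sE sD sH' Av Ov.
rewrite (nabla_vanish_r sE sD); last first.
  by move=> q Oq; rewrite scaleN1r HH'// addNr.
rewrite add0r => <-; congr (nabla E _ v).
by apply/funext => q; rewrite scaleN1r addrAC addNr add0r.
Qed.

Lemma nabla_suml (I : Type) (r : seq I) (f : I -> M -> R) (X : I -> vfield M) H :
  (forall i, smooth_fun Om (f i)) -> (forall i, smooth_vfield Om (X i)) ->
  smooth_vfield Om H ->
  smooth_vfield Om (fun q => \sum_(i <- r) f i q *: X i q) /\
  nabla (fun q => \sum_(i <- r) f i q *: X i q) H v
  = \sum_(i <- r) f i v.1 *: nabla (X i) H v.
Proof.
move=> sf sX sH; elim: r => [|i r [sS IH]].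
  have -> : (fun q : M => \sum_(i <- [::]) f i q *: X i q) = fun=> 0.
    by apply/funext => q; rewrite big_nil.
  by rewrite big_nil nabla0l//; split=> //; exact: smooth_vfield0.
have -> : (fun q : M => \sum_(j <- i :: r) f j q *: X j q)
    = fun q => f i q *: X i q + \sum_(j <- r) f j q *: X j q.
  by apply/funext => q; rewrite big_cons.
split; first exact: smooth_vfield_comb.
by rewrite (nabla_linearl HN oOm (sf i) (sX i) sS sH Av Ov) IH big_cons.
Qed.

Lemma nabla_sumr (I : Type) (r : seq I) (f : I -> M -> R) (X : I -> vfield M) E :
  (forall i, smooth_fun Om (f i)) -> (forall i, smooth_vfield Om (X i)) ->
  smooth_vfield Om E ->
  smooth_vfield Om (fun q => \sum_(i <- r) f i q *: X i q) /\
  nabla E (fun q => \sum_(i <- r) f i q *: X i q) v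
  = \sum_(i <- r) (dfun v.1 (E v.1) (f i) *: X i v.1 + f i v.1 *: nabla E (X i) v).
Proof.
move=> sf sX sE; have s0 := smooth_vfield0 oOm; elim: r => [|i r [sS IH]].
  have -> : (fun q : M => \sum_(i <- [::]) f i q *: X i q) = fun=> 0.
    by apply/funext => q; rewrite big_nil.
  by rewrite big_nil nabla_vanish_r.
have -> : (fun q : M => \sum_(j <- i :: r) f j q *: X j q)
    = fun q => f i q *: X i q + \sum_(j <- r) f j q *: X j q.
  by apply/funext => q; rewrite big_cons.
split; first exact: smooth_vfield_comb.
have sfX : smooth_vfield Om (fun q => f i q *: X i q).
  have -> : (fun q => f i q *: X i q) = (fun q => f i q *: X i q + 0).
    by apply/funext => q; rewrite addr0.
  exact: smooth_vfield_comb.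
rewrite (nabla_additiver HN oOm sE sfX sS Av Ov) IH big_cons.
by rewrite (nabla_leibniz HN oOm (sf i) sE (sX i) Av Ov).
Qed.

End Locality.

Section Coordinates.
Variable p : M.
Local Notation Z := (V * V)%type.
Local Notation c := (chart_at p).
Local Notation Gam := (christoffel nabla p).
Let ac : atlas M c := atlas_at p.

Lemma christoffel_linl z b : linear (Gam z ^~ b).
Proof.
move=> r a a'; rewrite christoffel.unlock scaler_sumr -big_split/=.
apply: eq_bigr => i _; rewrite scaler_sumr -big_split/=; apply: eq_bigr => j _.
by rewrite !mxE mulrDl scalerDl -mulrA scalerA.
Qed.

Lemma christoffel_linr z a : linear (Gam z a).
Proof.
move=> r b b'; rewrite christoffel.unlock scaler_sumr -big_split/=.
apply: eq_bigr => i _; rewrite scaler_sumr -big_split/=; apply: eq_bigr => j _.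
by rewrite !mxE mulrDr scalerDl mulrCA scalerA.
Qed.

Lemma smooth_coord_fun (Om : set M) (E : vfield M) i : open Om ->
  Om `<=` cdom c -> smooth_vfield Om E ->
  smooth_fun Om (fun q => vfield_in c E (c q) 0 i).
Proof.
move=> oOm Oc sE; apply: (smooth_fun_chart ac oOm Oc) => q Oq; have cq := Oc q Oq.
have sEq := smooth_vfield_at ac oOm sE cq Oq.
apply: smooth_at_eq (smooth_at_coord i sEq).
by apply: filterS (near_cimg (cimg_map cq)) => x cx; rewrite /= cinvK.
Qed.

Lemma vfield_sum (E : vfield M) q : cdom c q -> E q
  = \sum_i vfield_in c E (c q) 0 i *: ext p (delta_mx 0 i) q.
Proof.
move=> cq; have aq := atlas_at q; have dq := cdom_at q.
have -> : E q = trans c (chart_at q) q (vfield_in c E (c q)).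
  by rewrite vfield_inE// tcoordE// transK.
rewrite {1}[vfield_in c E _]row_sum_delta.
rewrite (linear_sum_scale _ _ _ (trans_lin ac aq cq dq)).
by apply: eq_bigr => i _; rewrite extE.
Qed.

Lemma tcoord_ext u q : cdom c q -> tcoord c q (ext p u q) = u.
Proof. by move=> cq; rewrite -vfield_inE// ext_const//; exact: cimg_map. Qed.

Section Point.
Variables (Om : set M) (z : Z).
Hypotheses (oOm : open Om) (cz : cimg c z.1) (Az : A (tchart_inv c z)).
Hypothesis (Oz : Om (cinv c z.1)).
Let v := tchart_inv c z.
Let q := cinv c z.1.
Hypothesis Omc : Om `<=` cdom c.
Let cq : cdom c q. Proof. exact: cdom_cinv. Qed.
Let sext u : smooth_vfield Om (ext p u).
Proof. exact: smooth_vfieldS (smooth_ext p u). Qed.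

Lemma nabla_coordl E H : smooth_vfield Om E -> smooth_vfield Om H ->
  nabla E H v
  = \sum_i vfield_in c E z.1 0 i *: nabla (ext p (delta_mx 0 i)) H v.
Proof.
move=> sE sH.
have sf i := smooth_coord_fun i oOm Omc sE.
have [sS SE] := nabla_suml oOm Az Oz (index_enum 'I_n) sf
  (fun i => sext (delta_mx 0 i)) sH.
rewrite (nabla_local_l oOm Az Oz sE sS sH); last first.
  by move=> q' /Omc cq'; exact: vfield_sum.
by rewrite SE /= cinvK.
Qed.

Lemma nabla_coordr E H : smooth_vfield Om E -> smooth_vfield Om H ->
  tcoord c q (nabla E H v) = 'D_(vfield_in c E z.1) (vfield_in c H) z.1
  + \sum_j vfield_in c H z.1 0 j *:
      tcoord c q (nabla E (ext p (delta_mx 0 j)) v).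
Proof.
move=> sE sH.
have sf i := smooth_coord_fun i oOm Omc sH.
have [sS SE] := nabla_sumr oOm Az Oz (index_enum 'I_n) sf
  (fun i => sext (delta_mx 0 i)) sE.
rewrite (nabla_local_r oOm Az Oz sE sH sS); last first.
  by move=> q' /Omc cq'; exact: vfield_sum.
have sHz : smooth_at (vfield_in c H) z.1.
  by rewrite -(cinvK cz); apply: (smooth_vfield_at ac oOm sH cq).
have dHz := smooth_at_diff sHz.
rewrite SE /= big_split /= (linD (tcoord_linear _ _)).
rewrite !(linear_sum_scale _ _ _ (tcoord_linear _ _)) cinvK//; congr (_ + _).
rewrite [RHS]row_sum_delta; apply: eq_bigr => j _.
rewrite derive_coord// tcoord_ext//; congr (_ *: _).
have dj : differentiable (fun x => vfield_in c H (c (cinv c x)) 0 j) (c q).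
  rewrite cinvK//; apply: smooth_at_diff; apply: smooth_at_eq (smooth_at_coord j sHz).
  by apply: filterS (near_cimg cz) => x cx; rewrite cinvK.
have qz : c q = z.1 by exact: cinvK.
apply: etrans (@dfunE R n M c q (E q) (fun q => vfield_in c H (c q) 0 j) ac cq dj) _.
rewrite qz; apply: near_eq_derive.
by apply: filterS (near_cimg cz) => x cx; rewrite /= cinvK.
Qed.

Lemma nabla_coord_in E H : smooth_vfield Om E -> smooth_vfield Om H ->
  tcoord c q (nabla E H v) = 'D_(vfield_in c E z.1) (vfield_in c H) z.1
    + Gam z (vfield_in c E z.1) (vfield_in c H z.1).
Proof.
move=> sE sH; rewrite nabla_coordr//; congr (_ + _).
rewrite christoffel.unlock exchange_big /=; apply: eq_bigr => j _.
rewrite (nabla_coordl sE (sext _)) (linear_sum_scale _ _ _ (tcoord_linear _ _)).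
by rewrite scaler_sumr; apply: eq_bigr => i _; rewrite scalerA mulrC.
Qed.

End Point.

Lemma nabla_coord (Om : set M) z E H : open Om -> cimg c z.1 ->
  A (tchart_inv c z) -> Om (cinv c z.1) ->
  smooth_vfield Om E -> smooth_vfield Om H ->
  tcoord c (cinv c z.1) (nabla E H (tchart_inv c z))
  = 'D_(vfield_in c E z.1) (vfield_in c H) z.1
    + Gam z (vfield_in c E z.1) (vfield_in c H z.1).
Proof.
move=> oOm cz Az Oz sE sH.
have sOm : Om `&` cdom c `<=` Om by move=> ? [].
apply: (@nabla_coord_in (Om `&` cdom c)) => //.
- by apply: openI => //; exact: cdom_open.
- by split=> //; exact: cdom_cinv.
- exact: smooth_vfieldS sE.
- exact: smooth_vfieldS sH.
Qed.

Hypothesis oA : topen A.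

Lemma open_tchart : open (tchart_pre c A).
Proof. exact: oA. Qed.

Lemma smooth_christoffel z a b : tchart_pre c A z ->
  smooth_at (fun y => Gam y a b) z.
Proof.
move=> Az; rewrite christoffel.unlock.
apply: smooth_at_sum => i; apply: smooth_at_sum => j; apply: smooth_at_scaler.
apply: smooth_onW open_tchart Az _ => k.
have := nabla_smooth HN (cdom_open c) (smooth_ext p (delta_mx 0 i))
  (smooth_ext p (delta_mx 0 j)) ac k.
apply: Ck_on_sub => y [cy Ay]; split=> //; split=> //.
exact: (cdom_cinv cy).
Qed.

Section CovariantCoordinates.
Variables (z : Z) (Om : set M) (E : vfield M).
Hypotheses (Az : tchart_pre c A z) (oOm : open Om) (Oz : Om (cinv c z.1)).
Hypothesis sE : smooth_vfield Om E.
Let q := cinv c z.1.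
Let v := tchart_inv c z.
Let V := ext q v.2.
Let Vh := vfield_in c V.
Let cz : cimg c z.1. Proof. by case: Az. Qed.
Let Avz : A v. Proof. by case: Az. Qed.
Let cq : cdom c q. Proof. exact: cdom_cinv. Qed.
Let qz : c q = z.1. Proof. exact: cinvK. Qed.
Let dq : cdom (chart_at q) q. Proof. exact: cdom_at. Qed.

Let smoothVh : smooth_at Vh z.1.
Proof.
rewrite -qz; apply: (smooth_vfield_at ac (cdom_open (chart_at q))) => //.
exact: smooth_ext.
Qed.

Let Vhz : Vh z.1 = z.2.
Proof.
rewrite -qz /Vh vfield_inE// /V extE// trans_id// /v /=.
exact: tvecK.
Qed.

(** The extension of [v], constant in the chart at [q], seen in the chart at [p] as a section of the
    tangent bundle. *)
Let Lh (y : 'rV[R]_n) : Z := (y, Vh y).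

Let smoothLh : smooth_at Lh z.1.
Proof. by apply: smooth_at_pair => //; exact/clinear_smooth/clinear_id. Qed.

Let Lhz : Lh z.1 = z. Proof. by rewrite /Lh Vhz -surjective_pairing. Qed.

Let deriveLh e : 'D_e Lh z.1 = (e, 'D_e Vh z.1).
Proof.
rewrite (derive_pair _ (clinear_differentiable z.1 (@clinear_id R _))
  (smooth_at_diff smoothVh)).
by rewrite (clinear_derive _ _ (@clinear_id R _)).
Qed.

Let LhE y : cimg c y -> (cinv c y, V (cinv c y)) = tchart_inv c (Lh y).
Proof.
move=> cy; rewrite /tchart_inv /=; congr (_, _).
by rewrite /Vh /vfield_in tcoordK.
Qed.

Let nearLh (Q : Z -> Prop) : (\forall y \near z, Q y) ->
  \forall y \near z.1, Q (Lh y).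
Proof.
by move=> Qz; apply: (smooth_at_cont smoothLh); rewrite Lhz.
Qed.

Let nablaV : tcoord c q (nabla E V v)
  = 'D_(vfield_in c E z.1) Vh z.1 + Gam z (vfield_in c E z.1) z.2.
Proof.
rewrite -Vhz.
apply: (@nabla_coord (Om `&` cdom (chart_at q))) => //.
- by apply: openI => //; exact: cdom_open.
- by apply: smooth_vfieldS sE => ? [].
- by apply: smooth_vfieldS (smooth_ext q v.2) => ? [].
Qed.

Let derive_fiber (W : normedModType R) (Fh : Z -> W) (f : 'rV[R]_n -> W) e :
  differentiable Fh z -> (\forall y \near z, y.1 = z.1 -> f (tvec c z.1 y.2) = Fh y) ->
  'D_e f v.2 = 'D_((0, tcoord c q e) : Z) Fh z.
Proof.
move=> dF fF.
have cK : clinear (tcoord c q).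
  by apply: findim_clinear; [exact: findim_rV|exact: tcoord_linear].
pose K (u : 'rV[R]_n) : Z := (z.1, tcoord c q u).
have sK u : smooth_at K u.
  by apply: smooth_at_pair; [exact: smooth_at_cst|exact: clinear_smooth].
have Kv : K v.2 = z by rewrite /K /v /= tvecK// -surjective_pairing.
have DK : 'D_e K v.2 = (0, tcoord c q e).
  rewrite (derive_pair _ (differentiable_cst _ _) (clinear_differentiable _ cK)).
  by rewrite derive_cst (clinear_derive _ _ cK).
have dF' : differentiable Fh (K v.2) by rewrite Kv.
have := derive_comp e (smooth_at_diff (sK v.2)) dF'; rewrite DK Kv => <-.
apply: near_eq_derive.
have nK (Q : Z -> Prop) : (\forall y \near z, Q y) -> \forall u \near v.2, Q (K u).
  by move=> Qz; apply: (smooth_at_cont (sK v.2)); rewrite Kv.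
apply: filterS (nK (fun y => y.1 = z.1 -> f (tvec c z.1 y.2) = Fh y) fF) => u fu.
rewrite -[RHS]fu// /K /=; congr f; exact: esym (tcoordK u ac cz).
Qed.

(** With e the value of [E], the base term differentiates [Xh] along (e, De V), while the fibre
    correction subtracts the derivative along (0, De V + Gam e y). The difference is the lift of e:
    the extension V disappears. *)
Lemma cov_avfield_coord (X : avfield M) (Xh : Z -> 'rV[R]_n) : smooth_at Xh z ->
  (\forall y \near z, tcoord c (cinv c y.1) (X (tchart_inv c y)) = Xh y) ->
  tcoord c q (cov_avfield nabla E X v)
  = cov_local Gam z (vfield_in c E z.1) Xh.
Proof.
move=> sX XX; rewrite /cov_avfield (linB (tcoord_linear _ _)).
have sXL : smooth_at (Xh \o Lh) z.1.
  apply: smooth_at_comp => //; first by apply: findim_prod; exact: findim_rV.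
  by rewrite Lhz.
pose XV q' := X (q', V q').
have XVE : \forall y \near z.1, vfield_in c XV y = (Xh \o Lh) y.
  apply: filterS2 (near_cimg cz) (nearLh XX) => y cy /= <-.
  by rewrite /vfield_in /XV LhE.
have sXV : smooth_at (vfield_in c XV) z.1.
  by apply: smooth_at_eq sXL; apply: filterS XVE => y ->.
have [D [oD Dz DX]] := near_open (smooth_at_near sXV).
have := @nabla_coord (Om `&` (cdom c `&` c @^-1` D)) z E XV.
rewrite -/v -[cinv c z.1]/q -/V => ->//; last first.
- apply: smooth_vfield_chart ac _ _ _.
  + by apply: openI => //; exact: open_preimage_chart.
  + by move=> ? [_ []].
  + by move=> q' [_ [_ /DX]].
- by apply: smooth_vfieldS sE => ? [].
- by split=> //; split=> //=; rewrite qz.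
- by apply: openI => //; exact: open_preimage_chart.
have cJ : clinear (tvec c z.1).
  apply: findim_clinear; first exact: findim_rV.
  exact: tvec_lin.
have dX := smooth_at_diff sX.
have -> : tcoord c q ('D_(nabla E V v) (fun u => X (v.1, u)) v.2)
    = 'D_((0, tcoord c q (nabla E V v)) : Z) Xh z.
  rewrite (@derive_fiber _ (fun y => tvec c z.1 (Xh y))).
  - rewrite (derive_comp _ dX (clinear_differentiable _ cJ)).
    by rewrite (clinear_derive _ _ cJ) tvecK.
  - exact: (differentiable_comp dX (clinear_differentiable _ cJ)).
  - apply: filterS XX => y <- yz; rewrite /tchart_inv yz.
    exact: (esym (tcoordK _ ac cz)).
have -> : vfield_in c XV z.1 = Xh z.
  by rewrite (nbhs_singleton XVE) /= Lhz.
have dXL : differentiable Xh (Lh z.1) by rewrite Lhz.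
have -> : 'D_(vfield_in c E z.1) (vfield_in c XV) z.1
    = 'D_((vfield_in c E z.1, 'D_(vfield_in c E z.1) Vh z.1) : Z) Xh z.
  rewrite (near_eq_derive _ XVE).
  rewrite (derive_comp _ (smooth_at_diff smoothLh) dXL).
  by rewrite deriveLh Lhz.
rewrite nablaV cov_local.unlock addrAC; congr (_ + _).
rewrite -(deriveBr _ _ dX); congr ('D_ _ _ _).
apply: (congr2 pair); rewrite /= ?subr0//.
by rewrite opprD addrA subrr add0r.
Qed.

Lemma cov_fun_coord (f : tangent M -> R) (fh : Z -> R) : smooth_at fh z ->
  (\forall y \near z, f (tchart_inv c y) = fh y) ->
  cov_fun nabla E f v = rderive fh z (hlift Gam z (vfield_in c E z.1)).
Proof.
move=> sf ff; rewrite /cov_fun; have df := smooth_at_diff sf.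
pose fV q' := f (q', V q').
have fVE : \forall y \near z.1, (fV \o cinv c) y = (fh \o Lh) y.
  apply: filterS2 (near_cimg cz) (nearLh ff) => y cy /= <-.
  by rewrite /fV LhE.
have dfL : differentiable fh (Lh z.1) by rewrite Lhz.
have dfV : differentiable (fV \o cinv c) (c q).
  rewrite qz; apply: near_eq_differentiable (differentiable_comp
    (smooth_at_diff smoothLh) dfL).
  by apply: filterS fVE => y ->.
have D1 : dfun q (E q) fV
    = 'D_((vfield_in c E z.1, 'D_(vfield_in c E z.1) Vh z.1) : Z) fh z.
  rewrite (dfunE _ ac cq dfV) qz (near_eq_derive _ fVE).
  by rewrite (derive_comp _ (smooth_at_diff smoothLh) dfL) deriveLh Lhz.
have D2 : 'D_(nabla E V v) (fun u => f (v.1, u)) v.2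
    = 'D_((0, tcoord c q (nabla E V v)) : Z) fh z.
  apply: derive_fiber => //.
  by apply: filterS ff => y <- yz; rewrite /tchart_inv yz.
apply: etrans (congr2 (fun a b => a - b) D1 D2) _.
rewrite nablaV rderive.unlock; apply: etrans (esym (deriveBr _ _ df)) _.
congr ('D_ _ _ _); apply: (congr2 pair); rewrite /= ?subr0//.
by rewrite opprD addrA subrr add0r.
Qed.

End CovariantCoordinates.

End Coordinates.
End Connection.

(** * The Levi-Civita-Chern connection in a chart *)

Section LeviCivita.
Context {R : realType} {n : nat} {M : manifold R n}.
Local Notation V := 'rV[R]_n.
Local Notation Z := (V * V)%type.
Variables (A : set (tangent M)) (L : tangent M -> R) (nabla : connection M).
Hypotheses (HF : pseudo_Finsler A L) (HL : Levi_Civita_Chern A L nabla).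
Variable p : M.
Local Notation c := (chart_at p).
Local Notation Gam := (christoffel nabla p).
Local Notation Lh := (L \o tchart_inv c).
Let ac : atlas M c := atlas_at p.
Let HN := lcc_connection HL.
Let oA := admissible_open HF.

Lemma smooth_metric_chart z : tchart_pre c A z -> smooth_at Lh z.
Proof.
move=> Az; apply: (smooth_onW (oA ac) Az).
exact: (metric_smooth HF ac).
Qed.

Lemma fundamental_tensorE z a b : tchart_pre c A z ->
  fundamental_tensor L (tchart_inv c z) (tvec c z.1 a) (tvec c z.1 b)
  = gform Lh z a b.
Proof.
move=> Az; have [cz _] := Az; have sL := smooth_metric_chart Az.
have lJ := tvec_lin ac cz.
pose zs (s : R) : Z := z + s *: (0, a).
have z0 : zs 0 = z by rewrite /zs scale0r addr0.
have LE s t : L ((tchart_inv c z).1,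
    (tchart_inv c z).2 + s *: tvec c z.1 a + t *: tvec c z.1 b)
    = Lh (zs s + t *: (0, b)).
  congr (L (_, _)); rewrite /= ?scaler0 ?addr0//.
  by rewrite !(linD lJ) !(linZ lJ).
have cs : {for (0 : R), continuous zs}.
  apply: differentiable_continuous.
  have /derivable1_diffP := @ex_derive _ _ _ _ _ _ _ (@derive_line R Z Z id z (0, a) 0
    (clinear_differentiable _ (@clinear_id R Z))).
  exact.
have nz : \forall s \near 0, smooth_at Lh (zs s).
  have := smooth_at_near sL; rewrite -{1}z0; exact: cs.
have D1 : \forall s \near 0, derive1 (fun t => L ((tchart_inv c z).1,
    (tchart_inv c z).2 + s *: tvec c z.1 a + t *: tvec c z.1 b)) 0
    = rderive Lh (zs s) (0, b).
  apply: filterS nz => s sLs; rewrite derive1E rderive.unlock.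
  have -> : (fun t => L ((tchart_inv c z).1,
      (tchart_inv c z).2 + s *: tvec c z.1 a + t *: tvec c z.1 b))
      = fun t => Lh (zs s + t *: (0, b)) by apply/funext => t; exact: LE.
  have dL : differentiable Lh (zs s + 0 *: (0, b)).
    by rewrite scale0r addr0; exact: smooth_at_diff.
  by rewrite (derive_val (is_derive := derive_line dL)) scale0r addr0.
rewrite gform.unlock lform.unlock /fundamental_tensor derive1E.
rewrite (near_eq_derive _ D1).
have dB := smooth_at_diff (smooth_rderive (0, b) sL).
rewrite (rderive_scale _ _ dB); congr (_ * _).
have dB' : differentiable (fun y => rderive Lh y (0, b)) (z + 0 *: (0, a)).
  by rewrite scale0r addr0.
rewrite (derive_val (is_derive := derive_line dB')) scale0r addr0.
by rewrite rderive.unlock.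
Qed.

Lemma fundamental_tensor_coord z e h : tchart_pre c A z ->
  fundamental_tensor L (tchart_inv c z) e h
  = gform Lh z (tcoord c (cinv c z.1) e) (tcoord c (cinv c z.1) h).
Proof.
move=> Az; have [cz _] := Az.
apply: etrans _ (fundamental_tensorE _ _ Az).
exact: (congr2 _ (esym (tcoordK e ac cz)) (esym (tcoordK h ac cz))).
Qed.

(** The test fields are constant in the chart at the point, not in the chart at [p]; their
    derivatives occur in the product rule and in their covariant derivatives, and cancel. *)
Lemma cov_tensor02_chart z e a b : tchart_pre c A z ->
  cov_tensor02 nabla (fundamental_tensor L) (tchart_inv c z)
    (tvec c z.1 e) (tvec c z.1 a) (tvec c z.1 b)
  = rderive (fun y => gform Lh y a b) z (hlift Gam z e)
    - gform Lh z (Gam z e a) b - gform Lh z a (Gam z e b).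
Proof.
move=> Az; have [cz _] := Az; have sL := smooth_metric_chart Az.
pose q := cinv c z.1; have cq : cdom c q by exact: cdom_cinv.
have qz : c q = z.1 by exact: cinvK.
have oq := cdom_open (chart_at q); have dq := cdom_at q.
pose X u := vfield_in c (ext q (tvec c z.1 u)).
have Xz u : X u z.1 = u.
  by rewrite /X -{2}qz vfield_inE// extE// trans_id// tvecK.
have sX u : smooth_at (X u) z.1.
  by rewrite -qz; apply: (smooth_vfield_at ac oq (smooth_ext q _)).
have sXf u : smooth_at (fun y : Z => X u y.1) z.
  by apply: (smooth_at_comp (f := fst)) (sX u);
    [exact: findim_rV|exact/clinear_smooth/clinear_fst].
have XE u : \forall y \near z, tcoord c (cinv c y.1)
    (ext q (tvec c z.1 u) (tchart_inv c y).1) = X u y.1.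
  exact: filterE.
have sE := smooth_ext q (tvec c z.1 e).
have lJ := tvec_lin ac cz.
have nL := smooth_at_near sL.
have ll : \forall y \near z, forall v, linear (gform Lh y ^~ v).
  by apply: filterS nL => y sy v; exact: gform_linl_at.
have lr : \forall y \near z, forall v, linear (gform Lh y v).
  by apply: filterS nL => y sy v; exact: gform_linr_at.
have sg u v : smooth_at (fun y => gform Lh y u v) z by exact: smooth_gform_at.
have sf : smooth_at (fun y => gform Lh y (X a y.1) (X b y.1)) z.
  apply: (@smooth_pbilin R Z V V R (gform Lh)) => //; exact: findim_rV.
have fE : \forall y \near z, fundamental_tensor L (tchart_inv c y)
    (ext q (tvec c z.1 a) (tchart_inv c y).1)
    (ext q (tvec c z.1 b) (tchart_inv c y).1)
    = gform Lh y (X a y.1) (X b y.1).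
  apply: filterS (open_nbhs_nbhs (conj (oA ac) Az)) => y Ay; have [cy _] := Ay.
  exact: fundamental_tensor_coord.
have DX u : cov_local Gam z e (fun y : Z => X u y.1) = 'D_e (X u) z.1 + Gam z e u.
  by rewrite cov_local.unlock Xz.
pose EX u : avfield M := fun v' => ext q (tvec c z.1 u) v'.1.
have := @cov_fun_coord R n M A nabla HN p z _ _ Az oq dq sE
  (fun v' => fundamental_tensor L v' (EX a v') (EX b v')) _ sf fE.
have := @cov_avfield_coord R n M A nabla HN p z _ _ Az oq dq sE (EX a) _ (sXf a) (XE a).
have := @cov_avfield_coord R n M A nabla HN p z _ _ Az oq dq sE (EX b) _ (sXf b) (XE b).
rewrite -/(X e) Xz !DX => Eb Ea Ef.
rewrite /cov_tensor02.
have Fa := etrans (fundamental_tensor_coord _ _ Az)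
  (congr2 (gform Lh z) Ea (tvecK b ac cz)).
have Fb := etrans (fundamental_tensor_coord _ _ Az)
  (congr2 (gform Lh z) (tvecK a ac cz) Eb).
apply: etrans (congr2 (fun r s => r - s) (congr2 (fun r s => r - s) Ef Fa) Fb) _.
have D := @rderive_pbilin R Z V V (gform Lh) (fun y => X a y.1) (fun y => X b y.1)
  z (hlift Gam z e) (findim_rV n) (findim_rV n) ll lr
  (fun u v => smooth_at_diff (sg u v)) (smooth_at_diff (sXf a))
  (smooth_at_diff (sXf b)).
rewrite D !Xz.
have DD u : 'D_(hlift Gam z e) (fun y : Z => X u y.1) z = 'D_e (X u) z.1 by [].
rewrite !DD (linD (gform_linl_at sL _)) (linD (gform_linr_at sL _)).
have cancel (r x y s t : R) : r + x + y - (x + s) - (y + t) = r - s - t by ring.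
exact: cancel.
Qed.

Lemma christoffel_sym z a b : tchart_pre c A z -> Gam z a b = Gam z b a.
Proof.
move=> [cz Az]; rewrite christoffel.unlock exchange_big /=.
apply: eq_bigr => j _; apply: eq_bigr => i _; rewrite mulrC; congr (_ *: _).
have cq := cdom_cinv cz.
have := lcc_torsion_free HL (cdom_open c) (smooth_ext p (delta_mx 0 i))
  (smooth_ext p (delta_mx 0 j)) Az cq.
rewrite (bracket_ext _ _ cq) => /eqP; rewrite subr_eq0 => /eqP N.
by rewrite N.
Qed.

(** [Om] will be the preimage of the chart of the base on the total space, and everything on the
    base. *)
Definition chart_domain (Om : set M) : set Z :=
  tchart_pre c [set v | A v /\ Om v.1].

Lemma chart_domain_pre Om z : chart_domain Om z -> tchart_pre c A z.
Proof. by move=> [cz [Az _]]. Qed.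

Lemma open_chart_domain Om : open Om -> open (chart_domain Om).
Proof.
move=> oOm; rewrite openE => z Oz; have [cz [Az Omz]] := Oz.
have n1 := open_nbhs_nbhs (conj (oA ac) (chart_domain_pre Oz)).
have n2 : \forall y \near z, Om (cinv c y.1).
  have cf : {for z, continuous (fst : Z -> V)} by exact: (clinear_fst _ _).2.
  exact: cf _ (near_cinv oOm cz Omz).
by apply: filterS2 n1 n2 => y [cy Ay] Oy.
Qed.

Lemma tchart_invZ z (r : R) : cimg c z.1 ->
  tchart_inv c (z.1, r *: z.2)
  = ((tchart_inv c z).1, r *: (tchart_inv c z).2).
Proof.
by move=> cz; rewrite /tchart_inv /= (linZ (tvec_lin ac cz)).
Qed.

Lemma local_finsler_chart Om : open Om ->
  local_finsler (chart_domain Om) Lh Gam.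
Proof.
move=> oOm; split.
- exact: open_chart_domain.
- by move=> z /chart_domain_pre; exact: smooth_metric_chart.
- move=> z r [cz [Az Oz]] r0; split=> //; rewrite tchart_invZ//.
  by split=> //; exact: (admissible_conic HF).
- move=> z r [cz [Az Oz]] r0; rewrite /= tchart_invZ//.
  exact: (metric_homogeneous HF).
- move=> z a Oz ga; have Az := chart_domain_pre Oz; have [cz AAz] := Az.
  have lK := @tcoord_linear R n M c (cinv c z.1).
  rewrite -(tvecK a ac cz) -(lin0 lK); congr (tcoord _ _ _).
  apply: (metric_nondegenerate HF AAz) => // h _.
  by rewrite fundamental_tensor_coord// tvecK// ga.
- by move=> z a b /chart_domain_pre; exact: smooth_christoffel.
- exact: christoffel_linl.
- exact: christoffel_linr.
- by move=> z a b /chart_domain_pre; exact: christoffel_sym.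
- move=> z e a b /chart_domain_pre Az; have [cz AAz] := Az.
  have := cov_tensor02_chart e a b Az; rewrite (lcc_metric HL)//.
  move/eqP; rewrite eq_sym !subr_eq add0r addrC => /eqP ->.
  by rewrite addrC.
Qed.

Lemma tchart_inv_at v : tchart_inv c (c p, v) = (p, v).
Proof.
have cp := cdom_at p; rewrite /tchart_inv /= cmapK//; congr (_, _).
by rewrite tvecE//; [rewrite cmapK// trans_id|exact: cimg_map].
Qed.

Lemma tchart_pre_at v : A (p, v) -> tchart_pre c A (c p, v).
Proof.
by move=> Av; split; [exact: cimg_map (cdom_at p)|rewrite tchart_inv_at].
Qed.

Lemma tcoord_at u : tcoord c p u = u.
Proof. by have cp := cdom_at p; rewrite tcoordE// trans_id. Qed.

Lemma nabla_const z h b : tchart_pre c A z ->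
  tcoord c (cinv c z.1) (nabla (ext p h) (ext p b) (tchart_inv c z))
  = Gam z h b.
Proof.
move=> [cz Az]; have cq := cdom_cinv cz.
rewrite (nabla_coord HN (cdom_open c) cz Az cq (smooth_ext p h) (smooth_ext p b)).
rewrite !ext_const//.
rewrite (@near_eq_derive _ _ _ _ (cst b)) ?derive_cst ?add0r//.
by apply: filterS (near_cimg cz) => x cx; rewrite ext_const.
Qed.

Lemma cov_avfield_const z h (X : avfield M) (Xh : Z -> V) :
  tchart_pre c A z -> smooth_at Xh z ->
  (\forall y \near z, tcoord c (cinv c y.1) (X (tchart_inv c y)) = Xh y) ->
  tcoord c (cinv c z.1) (cov_avfield nabla (ext p h) X (tchart_inv c z))
  = cov_local Gam z h Xh.
Proof.
move=> Az sX XX; have [cz _] := Az; have cq := cdom_cinv cz.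
rewrite (cov_avfield_coord HN Az (cdom_open c) cq (smooth_ext p h) sX XX).
by rewrite ext_const.
Qed.

Lemma cov_avfield_at v h (X : avfield M) (Xh : Z -> V) :
  A (p, v) -> smooth_at Xh (c p, v) ->
  (\forall y \near (c p, v : V), tcoord c (cinv c y.1) (X (tchart_inv c y)) = Xh y) ->
  cov_avfield nabla (ext p h) X (p, v) = cov_local Gam (c p, v) h Xh.
Proof.
move=> Av sX XX; have cp := cdom_at p.
have Az := tchart_pre_at Av.
have := cov_avfield_const h Az sX XX; rewrite tchart_inv_at /= cmapK//.
by rewrite tcoord_at.
Qed.

(** Only at the centre of the chart are vectors equal to their coordinates ([tcoord_at]), and this
    is the only place where the curvature is needed. *)
Lemma curvature_chart v e h b : A (p, v) ->
  curvature nabla (p, v) e h b = curv Gam (c p, v) e h b.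
Proof.
move=> Av; have cp := cdom_at p.
have Az := tchart_pre_at Av.
have nA := open_nbhs_nbhs (conj (oA ac) Az).
have D u w : cov_avfield nabla (ext p u) (nabla (ext p w) (ext p b)) (p, v)
    = cov_local Gam (c p, v) u (fun y => Gam y w b).
  apply: cov_avfield_at => //; first exact: (smooth_christoffel HN oA _ _ Az).
  by apply: filterS nA => y; exact: nabla_const.
rewrite /curvature /curvature_field !D /curv cov_local.unlock.
have -> : nabla (bracket (ext p e) (ext p h)) (ext p b) (p, v) = 0.
  apply: (nabla_vanish_l HN (cdom_open c) Av cp _ (smooth_ext p b)).
    apply: (smooth_vfield_chart ac (cdom_open c)) => // q cq.
    apply: smooth_at_eq (smooth_at_cst 0 _).
    apply: filterS (near_cimg (cimg_map cq)) => x /cdom_cinv cx.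
    by rewrite /vfield_in bracket_ext// (lin0 (tcoord_linear _ _)).
  by move=> q cq; exact: bracket_ext.
by rewrite subr0.
Qed.

Lemma fundamental_tensor_at v e h : A (p, v) ->
  fundamental_tensor L (p, v) e h = gform Lh (c p, v) e h.
Proof.
move=> Av; have cp := cdom_at p.
have Az := tchart_pre_at Av.
have := fundamental_tensor_coord e h Az; rewrite tchart_inv_at /= cmapK//.
by rewrite !tcoord_at.
Qed.

Lemma flag_curvature_chart v e : A (p, v) -> flag_curvature nabla L (p, v) e
  = lform Lh (c p, v) (curv Gam (c p, v) v e e)
    / (L (p, v) * gform Lh (c p, v) e e - gform Lh (c p, v) v e ^+ 2).
Proof.
move=> Av; have cp := cdom_at p.
have Az : chart_domain setT (c p, v).
  by split; [exact: cimg_map|rewrite tchart_inv_at].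
have LF := local_finsler_chart openT.
rewrite /flag_curvature !fundamental_tensor_at// curvature_chart//.
rewrite (gform_sym LF _ _ Az) -(gform_pos_hom LF _ Az).
by [].
Qed.

End LeviCivita.

(** * Submersions in charts *)

Section SubmersionCharts.
Context {R : realType} {n m : nat} {M : manifold R n} {B : manifold R m}.
Local Notation V := 'rV[R]_n.
Local Notation Z := (V * V)%type.

Lemma tcoord_inj k (N : manifold R k) (c : chart R k N) q : atlas N c ->
  cdom c q -> injective (tcoord c q).
Proof.
move=> ac cq u u' E; have aq := atlas_at q; have dq := cdom_at q.
move: E; rewrite !tcoordE// => E.
by rewrite -[u](transK _ aq ac dq cq) E transK.
Qed.

Variables (A : set (tangent M)) (L : tangent M -> R).
Variables (A' : set (tangent B)) (L' : tangent B -> R) (s : M -> B).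
Variable nabla : connection M.
Hypothesis HF : pseudo_Finsler A L.
Hypothesis HS : pseudo_Finsler_submersion A L A' L' s.
Hypothesis HL : Levi_Civita_Chern A L nabla.
Hypothesis ND : forall v, A v ->
  nondegenerate_on (fundamental_tensor L v) (vertical s v.1).
Variable p : M.
Local Notation c := (chart_at p).
Local Notation d := (chart_at (s p)).
Local Notation Om := (s @^-1` cdom d).
Local Notation O := (chart_domain A p Om).
Local Notation O' := (chart_domain A' (s p) setT).
Local Notation Lh := (L \o tchart_inv c).
Local Notation Lh' := (L' \o tchart_inv d).
Local Notation Gam := (christoffel nabla p).
Local Notation sg := (d \o s \o cinv c).
Local Notation dmap z := (deriv1 sg z.1).
Local Notation P := (vproj Lh sg).
Let ac : atlas M c := atlas_at p.
Let ad : atlas B d := atlas_at (s p).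
Let HN := lcc_connection HL.

Lemma open_Om : open Om.
Proof.
rewrite openE => q dq; have [cs _] := subm_smooth HS.
by apply: (cs q); apply: open_nbhs_nbhs; split=> //; exact: cdom_open.
Qed.

Let LF := local_finsler_chart HF HL p open_Om.

Lemma smooth_sg q : cdom c q -> Om q -> smooth_at sg (c q).
Proof.
move=> cq dq; have [_ ss] := subm_smooth HS.
exact: (smooth_at_chart open_Om cq dq (ss c d ac ad)).
Qed.

Lemma differential_chart q e : cdom c q -> Om q ->
  tcoord d (s q) (differential s q e) = deriv1 sg (c q) (tcoord c q e).
Proof.
move=> cq dq; have [cs ss] := subm_smooth HS.
have a1 := atlas_at q; have c1q := cdom_at q.
have a2 := atlas_at (s q); have c2q := cdom_at (s q).
set c1 := chart_at q in a1 c1q *; set c2 := chart_at (s q) in a2 c2q *.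
have o2 : open (s @^-1` cdom c2).
  rewrite openE => q' dq'; apply: (cs q').
  by apply: open_nbhs_nbhs; split=> //; exact: cdom_open.
have sf := smooth_at_chart o2 c1q c2q (ss c1 c2 a1 a2).
have df := smooth_at_diff sf.
rewrite /differential -/c1 -/c2 -deriveE// tcoordE// -/c2 trans_derive.
have fE : (c2 \o s \o cinv c1) (c1 q) = c2 (s q) by rewrite /= cmapK.
have dt := smooth_at_diff (smooth_trans a2 ad c2q dq); rewrite -fE in dt.
have E1 := derive_comp e df dt; rewrite fE in E1; rewrite -E1.
have dsg := smooth_at_diff (smooth_sg cq dq).
rewrite tcoordE// -/c1 deriv1.unlock -(derive_change e ac a1 cq c1q dsg).
apply: near_eq_derive; have im1 := cimg_map c1q.
have n1 : \forall x \near c1 q, cdom c (cinv c1 x).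
  by apply: (near_cinv (cdom_open c) im1); rewrite cmapK.
have n2 : \forall x \near c1 q, cdom c2 (s (cinv c1 x)).
  by apply: (near_cinv o2 im1); rewrite /= cmapK.
by apply: filterS2 n1 n2 => x cx c2x; rewrite /= !cmapK.
Qed.

Lemma smooth_sg_O z : O z -> smooth_at sg z.1.
Proof.
move=> [cz [_ Oz]]; rewrite -(cinvK cz); apply: smooth_sg => //.
exact: cdom_cinv.
Qed.

Lemma differential_dmap z e : O z ->
  tcoord d (s (cinv c z.1)) (differential s (cinv c z.1) e)
  = dmap z (tcoord c (cinv c z.1) e).
Proof.
move=> [cz [_ Oz]]; rewrite differential_chart//; last exact: cdom_cinv.
by rewrite cinvK.
Qed.

Lemma vertical_dmap z e : O z ->
  vertical s (cinv c z.1) e <-> dmap z (tcoord c (cinv c z.1) e) = 0.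
Proof.
move=> Oz; have [_ [_ dz]] := Oz.
have l0 := lin0 (@tcoord_linear R m B d (s (cinv c z.1))).
rewrite -differential_dmap//; split=> [->//|E].
by apply: (tcoord_inj ad dz); rewrite E l0.
Qed.

Lemma dmap_surjective z u' : O z -> exists u, dmap z u = u'.
Proof.
move=> Oz; have [cz [_ dz]] := Oz.
have [u uE] := subm_differential HS (cinv c z.1)
  (tvec d (d (s (cinv c z.1))) u').
exists (tcoord c (cinv c z.1) u); rewrite -differential_dmap// uE.
by have := tvecK u' ad (cimg_map dz); rewrite cmapK.
Qed.

Lemma vertical_nondegenerate z w : O z -> dmap z w = 0 ->
  (forall w', dmap z w' = 0 -> gform Lh z w w' = 0) -> w = 0.
Proof.
move=> Oz vw gw; have [cz [Az dz]] := Oz; have Az' := chart_domain_pre Oz.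
have l0 := lin0 (@tcoord_linear R n M c (cinv c z.1)).
rewrite -(tvecK w ac cz) -[RHS]l0; congr (tcoord _ _ _).
apply: (ND Az) => [|h /(vertical_dmap _ Oz) vh].
  by apply/(vertical_dmap _ Oz); rewrite tvecK.
by rewrite (fundamental_tensor_coord HF _ _ Az') tvecK// gw.
Qed.

Lemma tchart_inv_tlift z : O z -> tchart_inv d (tlift sg z) = tmap s (tchart_inv c z).
Proof.
move=> Oz; have [cz [_ dz]] := Oz; rewrite /tmap /tchart_inv /=.
congr (_, _); first by rewrite cmapK.
have := differential_dmap (tvec c z.1 z.2) Oz; rewrite tvecK// => <-.
have := tcoordK (differential s (cinv c z.1) (tvec c z.1 z.2)) ad (cimg_map dz).
by rewrite cmapK.
Qed.

Lemma metric_horizontal_chart z e : O z ->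
  metric_horizontal L s (tchart_inv c z) e
  <-> ghor Lh sg z (tcoord c (cinv c z.1) e).
Proof.
move=> Oz; have [cz [Az dz]] := Oz; have Az' := chart_domain_pre Oz.
split=> [he w vw|he w /(vertical_dmap _ Oz) vw]; last first.
  by rewrite (fundamental_tensor_coord HF _ _ Az') he.
have := he (tvec c z.1 w); rewrite (fundamental_tensor_coord HF _ _ Az') tvecK//.
by apply; apply/(vertical_dmap _ Oz); rewrite tvecK.
Qed.

Lemma horizontal_chart z : O z ->
  horizontal A L s (tchart_inv c z) <-> lhor Lh sg z.
Proof.
move=> Oz; have [cz [Az dz]] := Oz.
have E : metric_horizontal L s (tchart_inv c z) (tchart_inv c z).2
    <-> ghor Lh sg z z.2.
  by rewrite metric_horizontal_chart// /= tvecK.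
split=> [[_ /E hz] w vw|hz]; first by rewrite -(gform_pos_hom LF _ Oz) hz.
by split=> //; apply/E => w vw; rewrite (gform_pos_hom LF _ Oz) hz.
Qed.

Lemma local_submersion_chart : local_submersion O Lh O' Lh' sg P.
Proof.
have nd := vertical_nondegenerate; have sj := dmap_surjective.
split.
- exact: smooth_sg_O.
- exact: sj.
- move=> z Oz hz; have [cz [Az dz]] := Oz.
  have [Asz LE] := subm_horizontal HS ((horizontal_chart Oz).2 hz).
  rewrite /= tchart_inv_tlift//; split=> //; split; first exact: cimg_map.
  by rewrite /= tchart_inv_tlift.
- exact: (smooth_vproj LF smooth_sg_O sj nd).
- exact: vproj_linear.
- exact: (vproj_vertical LF smooth_sg_O sj nd).
- exact: (vproj_orthogonal LF smooth_sg_O).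
- exact: nd.
Qed.

Let S := local_submersion_chart.

(** The set from which [xget] selects is inhabited by the projection built from matrices, so the
    default value is not taken; [proj_unique] identifies the choice. *)
Lemma vert_chart z b : O z -> tcoord c (cinv c z.1) (vert L s (tchart_inv c z) b)
  = P z (tcoord c (cinv c z.1) b).
Proof.
move=> Oz; have [cz [Az dz]] := Oz; have lK := @tcoord_linear R n M c (cinv c z.1).
set D := [set w | vertical s (tchart_inv c z).1 w
  /\ metric_horizontal L s (tchart_inv c z) (b - w)].
have [vw hw] : D (xget 0 D).
  apply: xgetPex; exists (tvec c z.1 (P z (tcoord c (cinv c z.1) b))); split.
    apply/(vertical_dmap _ Oz); rewrite tvecK//.
    exact: (ls_proj_vertical S _ Oz).
  apply/(metric_horizontal_chart _ Oz); rewrite (linB lK) tvecK//.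
  by have := @ghor_proj _ _ _ _ _ _ _ _ _ _ LF S z (tcoord c (cinv c z.1) b) Oz.
rewrite /vert -/D; apply: (proj_unique LF S Oz).
  exact: (vertical_dmap _ Oz).1.
move=> w vw'; have := (metric_horizontal_chart _ Oz).1 hw w vw'.
rewrite (linB lK) (gformBl LF _ _ _ Oz) => /eqP; rewrite subr_eq0 => /eqP.
by [].
Qed.

Lemma hor_chart z b : O z -> tcoord c (cinv c z.1) (hor L s (tchart_inv c z) b)
  = tcoord c (cinv c z.1) b - P z (tcoord c (cinv c z.1) b).
Proof.
by move=> Oz; rewrite /hor (linB (@tcoord_linear R n M c _)) vert_chart.
Qed.

(** The definition extends [e] by a field constant in the chart at the point considered;
    [chi_tensorial] passes to the constant extension in the chart at [p]. *)
Lemma ONeill_chi_chart z h e : O z ->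
  tcoord c (cinv c z.1) (ONeill_chi L s nabla (tchart_inv c z) h e)
  = chi_local P Gam z (tcoord c (cinv c z.1) h) (tcoord c (cinv c z.1) e).
Proof.
move=> Oz; have [cz [Az dz]] := Oz; have Az' := chart_domain_pre Oz.
pose q := cinv c z.1; have cq : cdom c q by exact: cdom_cinv.
have qz : c q = z.1 by exact: cinvK.
have oq := cdom_open (chart_at q); have dq := cdom_at q.
pose u (y : Z) := vfield_in c (ext q e) y.1.
have extq a : vfield_in c (ext q a) z.1 = tcoord c q a.
  by rewrite -qz vfield_inE// extE// trans_id.
have su : smooth_at u z.
  apply: (smooth_at_comp (f := fst)); first exact: findim_rV.
    exact: smooth_fst.
  by rewrite /= -qz; exact: (smooth_vfield_at ac oq (smooth_ext q e)).
have nO := lf_near LF Oz.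
have sPu := smooth_proj LF S Oz su.
have E1 : \forall y \near z, tcoord c (cinv c y.1)
    (hor L s (tchart_inv c y) (ext q e (tchart_inv c y).1)) = u y - P y (u y).
  by apply: filterS nO => y Oy; rewrite hor_chart.
have E2 : \forall y \near z, tcoord c (cinv c y.1)
    (vert L s (tchart_inv c y) (ext q e (tchart_inv c y).1)) = P y (u y).
  by apply: filterS nO => y Oy; rewrite vert_chart.
have sh := smooth_ext q h.
have C1 := cov_avfield_coord HN Az' oq dq sh
  (X := fun v' => hor L s v' (ext q e v'.1)) (smooth_atB su sPu) E1.
have C2 := cov_avfield_coord HN Az' oq dq sh
  (X := fun v' => vert L s v' (ext q e v'.1)) sPu E2.
rewrite extq in C1 C2.
rewrite /ONeill_chi (linD (@tcoord_linear R n M c _)) vert_chart// hor_chart//.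
apply: etrans (congr2 (fun a b => P z a + (b - P z b)) C1 C2) _.
apply: etrans (chi_tensorial LF S _ Oz su) _.
exact: (congr1 _ (extq e)).
Qed.

Lemma ONeill_T_chart z b e : O z ->
  tcoord c (cinv c z.1) (ONeill_T L s nabla (tchart_inv c z) b e)
  = oneill_T Gam P z (tcoord c (cinv c z.1) b) (tcoord c (cinv c z.1) e).
Proof. by move=> Oz; rewrite /ONeill_T ONeill_chi_chart// vert_chart. Qed.

Lemma ONeill_A_chart z b e : O z ->
  tcoord c (cinv c z.1) (ONeill_A L s nabla (tchart_inv c z) b e)
  = oneill_A Gam P z (tcoord c (cinv c z.1) b) (tcoord c (cinv c z.1) e).
Proof. by move=> Oz; rewrite /ONeill_A ONeill_chi_chart// hor_chart. Qed.

Section BasePoint.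
Variable v : V.
Hypothesis Av : A (p, v).
Local Notation z0 := ((c p, v) : Z).

Lemma chart_domain_at : O z0.
Proof.
split; first exact: cimg_map (cdom_at p).
by rewrite tchart_inv_at; split=> //; exact: cdom_at.
Qed.

Lemma ONeill_T_at b e : ONeill_T L s nabla (p, v) b e = oneill_T Gam P z0 b e.
Proof.
have cp := cdom_at p; have := ONeill_T_chart b e chart_domain_at.
rewrite tchart_inv_at [(c p, v).1]/= cmapK//.
by rewrite !tcoord_at.
Qed.

Lemma ONeill_A_at b e : ONeill_A L s nabla (p, v) b e = oneill_A Gam P z0 b e.
Proof.
have cp := cdom_at p; have := ONeill_A_chart b e chart_domain_at.
rewrite tchart_inv_at [(c p, v).1]/= cmapK//.
by rewrite !tcoord_at.
Qed.

Lemma cov_ONeill_T_at e a b :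
  cov_tensor12 nabla (ONeill_T L s nabla) (p, v) e a b = cov_T Gam P z0 e a b.
Proof.
have Oz := chart_domain_at; have nO := lf_near LF Oz.
have Ec u : \forall y \near z0,
    tcoord c (cinv c y.1) (ext p u (tchart_inv c y).1) = u.
  apply: filterS nO => y [cy _]; apply: tcoord_ext; exact: cdom_cinv.
have Cu u : cov_avfield nabla (ext p e) (fun v' => ext p u v'.1) (p, v)
    = Gam z0 e u.
  rewrite (cov_avfield_at HL e Av (smooth_at_cst u z0) (Ec u)).
  by rewrite cov_local.unlock derive_cst add0r.
have sT := smooth_oneill_T LF S a b Oz.
have ET : \forall y \near z0, tcoord c (cinv c y.1)
    (ONeill_T L s nabla (tchart_inv c y) (ext p a (tchart_inv c y).1)
       (ext p b (tchart_inv c y).1)) = oneill_T Gam P y a b.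
  apply: filterS nO => y Oy; rewrite ONeill_T_chart//.
  by have [/cdom_cinv cy _] := Oy; rewrite !tcoord_ext.
have CT := cov_avfield_at HL e
  (X := fun v' => ONeill_T L s nabla v' (ext p a v'.1) (ext p b v'.1)) Av sT ET.
by rewrite /cov_tensor12 /= CT !Cu !ONeill_T_at.
Qed.

End BasePoint.
End SubmersionCharts.

Theorem corollary8 (R : realType) (n m : nat)
    (M : manifold R n) (B : manifold R m)
    (A : set (tangent M)) (L : tangent M -> R)
    (A' : set (tangent B)) (L' : tangent B -> R)
    (s : M -> B) (nabla : connection M) (nabla' : connection B) :
  pseudo_Finsler A L ->
  pseudo_Finsler A' L' ->
  pseudo_Finsler_submersion A L A' L' s ->
  Levi_Civita_Chern A L nabla ->
  Levi_Civita_Chern A' L' nabla' ->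
  (forall v, A v -> nondegenerate_on (fundamental_tensor L v) (vertical s v.1)) ->
  forall (v : tangent M) (x w : 'rV[R]_n),
    horizontal A L s v ->
    metric_horizontal L s v x ->
    vertical s v.1 w ->
    let g := fundamental_tensor L v in
    let TT := ONeill_T L s nabla in
    let AA := ONeill_A L s nabla in
    (nondegenerate_plane g v.2 w ->
      flag_curvature nabla L v w =
      (g (cov_tensor12 nabla TT v v.2 w w) v.2
       + g (AA v v.2 w) (AA v v.2 w)
       - g (TT v w v.2) (TT v w v.2))
      / (L v * g w w - g v.2 w ^+ 2)) /\
    (nondegenerate_plane g v.2 x ->
      flag_curvature nabla L v x =
      flag_curvature nabla' L' (tmap s v) (differential s v.1 x)
      - 3 * g (AA v x v.2) (AA v x v.2)
        / (L v * g x x - g v.2 x ^+ 2)).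
Proof.
move=> HF HF' HS HL HL' ND [p v] x w hv hx vw g TT AA.
have [Av _] := hv; have [A'v Leq] := subm_horizontal HS hv.
have LF := local_finsler_chart HF HL p (open_Om HS p).
have LF' := local_finsler_chart HF' HL' (s p) openT.
have S := local_submersion_chart HF HS HL ND p.
have Oz := chart_domain_at s Av; have cp := cdom_at p.
set c := chart_at p in LF S Oz cp *; set d := chart_at (s p) in LF' S *.
pose z : 'rV[R]_n * 'rV[R]_n := (c p, v).
pose sg := d \o s \o cinv c.
have hz : lhor (L \o tchart_inv c) sg z.
  by apply/(horizontal_chart HF HS HL Oz); rewrite tchart_inv_at.
have dE e : deriv1 sg (c p) e = differential s p e.
  have := differential_dmap HS e Oz.
  by rewrite /= cmapK// !tcoord_at.
have hxz : ghor (L \o tchart_inv c) sg z x.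
  have := (metric_horizontal_chart HF HS x Oz).1.
  rewrite tchart_inv_at /= cmapK// tcoord_at; exact.
have vwz : deriv1 sg z.1 w = 0 by rewrite dE.
have tE : tlift sg z = (d (s p), differential s p v).
  have sp : sg (c p) = d (s p) by rewrite /sg /= cmapK.
  by rewrite -dE -sp.
have gE a b : g a b = gform (L \o tchart_inv c) z a b.
  exact: (fundamental_tensor_at HF).
have gA b e : gform (L \o tchart_inv c) z
    (oneill_A (christoffel nabla p) (vproj (L \o tchart_inv c) sg) z b e)
    (oneill_A (christoffel nabla p) (vproj (L \o tchart_inv c) sg) z b e)
    = g (AA (p, v) b e) (AA (p, v) b e).
  have E := ONeill_A_at HF HS HL ND Av b e.
  exact: esym (etrans (congr2 g E E) (gE _ _)).
have gT b e : gform (L \o tchart_inv c) z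
    (oneill_T (christoffel nabla p) (vproj (L \o tchart_inv c) sg) z b e)
    (oneill_T (christoffel nabla p) (vproj (L \o tchart_inv c) sg) z b e)
    = g (TT (p, v) b e) (TT (p, v) b e).
  have E := ONeill_T_at HF HS HL ND Av b e.
  exact: esym (etrans (congr2 g E E) (gE _ _)).
have lT : lform (L \o tchart_inv c) z
    (cov_T (christoffel nabla p) (vproj (L \o tchart_inv c) sg) z v w w)
    = g (cov_tensor12 nabla TT (p, v) v w w) v.
  have E := cov_ONeill_T_at HF HS HL ND Av v w w.
  apply: esym (etrans (congr1 (g ^~ v) E) (etrans (gE _ _) _)).
  by rewrite (gform_sym LF _ v Oz) -(gform_pos_hom LF _ Oz).
have den a : L (p, v) * gform (L \o tchart_inv c) z a a
    - gform (L \o tchart_inv c) z v a ^+ 2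
    = L (p, v) * g a a - g v a ^+ 2 by rewrite (gE a a) (gE v a).
split=> _.
- apply: etrans (flag_curvature_chart HF HL w Av) _.
  apply: (congr2 (fun a b => a / b)); last exact: den.
  apply: etrans (vertical_curvature LF LF' S Oz hz vwz) _.
  exact: (congr2 (fun a b => a - b) (congr2 +%R lT (gA v w)) (gT w v)).
- have H := horizontal_curvature LF LF' S Oz hz hxz.
  have F1 := flag_curvature_chart HF HL x Av.
  have F2 := flag_curvature_chart HF' HL' (differential s p x) A'v.
  (* By isometry, taken at [x] and at [v], and by [Leq], the flag curvatures above and below have
     the same denominator. *)
  have E a := gform_lhor LF LF' S a Oz hz hxz.
  rewrite -/c -/z in F1; rewrite -/d in F2.
  move: H (E x) (E v) F1 F2; rewrite (gA x v) (den x) !dE tE -Leq.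
  move=> -> <- <- -> ->; rewrite (den x) mulrBl.
  by [].
Qed.
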